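(* For each $n$, let $p=p(n)$, $m=m(n)\le p$, and let $\rho^1,\dots,\rho^m\in\mathbb{R}^p$ (depending on $n$) be mutually orthogonal with $\|\rho^1\|>\|\rho^2\|\ge\cdots\ge\|\rho^m\|$. Let $\sigma>0$ be fixed. Observe $x_1,\dots,x_n\in\mathbb{R}^p$ from the multicomponent model $$x_i=\sum_{j=1}^m v_i^j\rho^j+\sigma z_i,\qquad i=1,\dots,n,$$ where the $v_i^j$ ($j=1,\dots,m$, $i=1,\dots,n$) are independent $N(0,1)$, the $z_i$ are independent $N_p(0,I_p)$, and the $z_i$ are independent of the $\{v_i^j\}$. Assume that the sequences of norms converge in $\ell_1(\mathbb{N})$: $$(\|\rho^1(n)\|,\dots,\|\rho^{m(n)}(n)\|,0,0,\dots)\to\varrho=(\varrho_1,\varrho_2,\dots)\quad\text{in }\ell_1,$$ and write $\varrho_+=\sum_j\varrho_j$. Assume $p(n)/n\to c\in[0,\infty)$. Let $S=n^{-1}\sum_{i=1}^nx_ix_i^T$ and let $\hat\rho^1$ be a unit eigenvector of $S$ associated with its largest eigenvalue. Then $$\limsup_{n\to\infty}\sin\angle(\hat\rho^1,\rho^1)\le\frac{4\sigma\sqrt c}{\varrho_1^2-\varrho_2^2}\bigl[\varrho_++(2+\sqrt c)\sigma\bigr]$$ so long as the right side is at most $4/5$. Moreover, if $c>0$, then $$\liminf_{n\to\infty}E\,\angle(\hat\rho^1,\rho^1)>0.$$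
   Context: For nonzero $\xi,\eta\in\mathbb{R}^p$, the angle is $\angle(\xi,\eta)=\cos^{-1}\bigl(|\xi^T\eta|/(\|\xi\|_2\|\eta\|_2)\bigr)\in[0,\pi/2]$. The mean of the model is known and taken to be zero. The quantities $p,m,\rho^j$ may depend on $n$; $\sigma$ does not. *)

(* Defs.v *)
From HB Require Import structures.
From mathcomp Require Import all_boot all_order all_algebra.
From mathcomp Require Import all_classical all_reals all_analysis.
Set Implicit Arguments. Unset Strict Implicit. Unset Printing Implicit Defensive.
Import Order.TTheory GRing.Theory Num.Theory.

Local Open Scope classical_set_scope.
Local Open Scope ring_scope.

Section Defs.
Variable R : realType.

Definition vdot (p : nat) (a b : 'cV[R]_p) : R := \sum_(k < p) a k 0 * b k 0.
Definition vnorm (p : nat) (a : 'cV[R]_p) : R := Num.sqrt (vdot a a).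

Definition vangle (p : nat) (a b : 'cV[R]_p) : R :=
  acos (`|vdot a b| / (vnorm a * vnorm b)).

Definition top_unit_eigvec (p : nat) (S : 'M[R]_p) (u : 'cV[R]_p) : Prop :=
  vnorm u = 1 /\
  exists lam : R, S *m u = lam *: u /\
    (forall (mu : R) (w : 'cV[R]_p), w != 0 -> S *m w = mu *: w -> mu <= lam).

End Defs.

Section Prob.
Context {d : measure_display} {T : measurableType d} {R : realType}.
Variable P : probability T R.

Definition iid_std_normal (I : eqType) (X : I -> T -> R) : Prop :=
  (forall i, measurable_fun setT (X i)) /\
  (forall i (A : set R), measurable A ->
      P (X i @^-1` A) = normal_prob 0 1 A) /\
  (forall (s : seq I) (A : I -> set R), uniq s ->
      (forall i, measurable (A i)) ->
      P (\bigcap_(i in [set i | i \in s]) (X i @^-1` A i)) =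
      (\prod_(i <- s) P (X i @^-1` A i))%E).
End Prob.

Definition join_arrays {T R : Type} (v z : nat -> nat -> T -> R)
  (k : ((nat * nat) + (nat * nat))%type) : T -> R :=
  match k with inl (i, j) => v i j | inr (i, l) => z i l end.

Section Model.
Variable R : realType.

(* observation x_i (in R^{p}) = sum_{j<m} v_i^j rho^j + sigma z_i, where
   z_i consists of the first p coordinates of the i-th noise row *)
Definition obs {T : Type} (p : nat) (rho : nat -> 'cV[R]_p) (m : nat) (sigma : R)
  (v z : nat -> nat -> T -> R) (i : nat) (w : T) : 'cV[R]_p :=
  \sum_(j < m) v i j w *: rho j + sigma *: \col_(k < p) z i k w.

Definition sample_cov {T : Type} (n p : nat) (rho : nat -> 'cV[R]_p) (m : nat)
  (sigma : R) (v z : nat -> nat -> T -> R) (w : T) : 'M[R]_p :=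
  (n%:R)^-1 *: \sum_(i < n) (obs rho m sigma v z i w *m (obs rho m sigma v z i w)^T).

(* padded norm sequence (|rho^1|,...,|rho^m|,0,0,...) (0-indexed) *)
Definition norm_seq (p : nat) (rho : nat -> 'cV[R]_p) (m : nat) (j : nat) : R :=
  if (j < m)%N then vnorm (rho j) else 0.
End Model.

(* Main.v *)
(** Write [q] for the direction of [rho^1], [u] for the leading eigenvector of [S],
    [a] for the sum of the norms [|rho^j|] and [s = sqrt (p / n)].  Comparing the Rayleigh
    quotients of [u] and [q] gives, for [x = sin (u, q) = |u - (u.q) q|], an inequality
    [x (|rho^1|^2 - |rho^2|^2 - 2 sigma (a - |rho^1|) s - sigma^2 beta) <=
     2 sigma s (|rho^1| + sigma)], up to errors of order [eta], as soon as a sample is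
    [eta]-good: the vectors of factors [v^j] and of noise along [q] are nearly orthonormal,
    the cross products of the noise with each of them have norm at most [(1 + eta) (s + eta)],
    and the noise covariance differs from the identity by at most [beta = O(s + s^2)].
    By rotation invariance of the Gaussian law, all of these reduce to chi-square tails
    (the last one through a net of the sphere), so a sample fails to be good with
    exponentially small probability; Borel-Cantelli and [eta -> 0] give the limsup bound,
    the assumption [bound <= 4/5] being what makes the noise terms in the gap harmless.

    For the liminf, the component of [S q] orthogonal to [q] contains a Gaussian vector of
    norm about [sigma sqrt (p / n)], so [q] is not close to an eigenvector of the bounded
    matrix [S] when [p / n] stays away from [0]: with probability at least one half the angle
    exceeds a fixed positive constant. *)

Require Import Defs.
From HB Require Import structures.
From mathcomp Require Import all_boot all_order all_algebra.
From mathcomp Require Import all_classical all_reals all_analysis.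
From mathcomp Require Import measurable_realfun.
From mathcomp Require Import ring lra zify.
Import Order.TTheory GRing.Theory Num.Theory numFieldTopology.Exports numFieldNormedType.Exports.
Set Implicit Arguments. Unset Strict Implicit. Unset Printing Implicit Defensive.
Local Open Scope classical_set_scope.
Local Open Scope ring_scope.

(** Independence is given only as a product formula on finitely many coordinates. It determines the
    law on the cylinder sigma-algebra, so the family may be replaced by one that reads two blocks of
    coordinates from two independent copies of the space. Freezing one block there is how all
    conditioning is done. Orthogonal invariance is built from rotations of two coordinates at a
    time, because only a double Gaussian integral has to be rotated.

    The eigenvector is an arbitrary choice depending on the sample. The probabilistic part therefore
    proves bounds valid for all vectors at once outside a measurable set of small probability, and
    the spectral part is deterministic. A product of noise with one fixed column is linear in the
    test vector, so uniformity reduces to the norm of a single Gaussian vector. Only the quadratic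
    noise form calls for a net: rounded multiples of unit vectors, integer points of l1 norm at most
    [3 p]. The price is the crude constant [beta = 5 / 3 (4 s + 8 s^2)], affordable because
    [sigma s] is at most a fifth of the leading norm in the limit. *)

(** * Laws of i.i.d. families, and independence of blocks by decoupling *)

Lemma measurable_bigcap_seq d (T : measurableType d) (I : eqType) (s : seq I)
    (F : I -> set T) : (forall i, measurable (F i)) ->
  measurable (\bigcap_(i in [set i | i \in s]) F i).
Proof.
move=> mF; elim: s => [|i s IH].
  by rewrite (_ : \bigcap_(i in _) _ = setT)//; apply/seteqP; split.
rewrite (_ : \bigcap_(i in _) _ = F i `&` \bigcap_(j in [set j | j \in s]) F j).
  exact: measurableI.
apply/seteqP; split => w /=.
  by move=> h; split; [apply: h; rewrite /= inE eqxx|move=> j /= js; apply: h; rewrite /= inE js orbT].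
by move=> [h1 h2] j /=; rewrite inE => /orP[/eqP ->//|]; exact: h2.
Qed.

(** Generators of the product sigma-algebra. The list may repeat indices, so that an intersection of
    two cylinders is a cylinder over the concatenated list. *)
Definition cylinder (I : eqType) (R : realType) : set (set (I -> R)) :=
  [set C | exists s : seq I, exists A : I -> set R, (forall i, measurable (A i)) /\
     C = [set f | forall i, i \in s -> A i (f i)]].

Notation family I R := (g_sigma_algebraType (@cylinder I R)).

Section law_of_family.
Context (R : realType) (I : eqType).
Local Notation fam := (family I R).
Local Notation cyl := (@cylinder I R).

Lemma cylinder_setI_closed : setI_closed cyl.
Proof.
move=> _ _ [s [A [mA ->]]] [t [B [mB ->]]].
exists (s ++ t), (fun i => (if i \in s then A i else setT) `&`
                           (if i \in t then B i else setT)); split.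
  by move=> i; apply: measurableI; case: ifP.
apply/seteqP; split => f /=.
  move=> [fA fB] i _; split; case: ifPn => // ?; first exact: fA.
  exact: fB.
move=> fAB; split => i ii.
  by have /fAB[] : i \in s ++ t; rewrite ?mem_cat ii.
by have /fAB[_] : i \in s ++ t; rewrite ?mem_cat ii ?orbT.
Qed.

Lemma measurable_coord (i : I) : measurable_fun setT (fun f : fam => f i).
Proof.
move=> _ A mA; rewrite setTI; apply: sub_sigma_algebra.
exists [:: i], (fun=> A); split => //.
by apply/seteqP; split => f /= => [fA j|]; [rewrite inE => /eqP ->|apply; rewrite inE].
Qed.

Lemma measurable_family d (T : measurableType d) (X : I -> T -> R) :
  (forall i, measurable_fun setT (X i)) ->
  measurable_fun setT (fun w : T => (X^~ w) : fam).
Proof.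
move=> mX; apply: (@measurability _ _ T fam setT _ cyl erefl).
move=> _ [_ [s [A [mA ->]] <-]]; rewrite setTI.
rewrite [X in measurable X](_ : _ = \bigcap_(i in [set i | i \in s]) (X i @^-1` A i)).
  by apply: measurable_bigcap_seq => i; rewrite -[_ @^-1` _]setTI; exact: mX.
by apply/seteqP; split => w /=.
Qed.

(** Cylinders are a generating class closed under intersection, so two probability laws that agree
    on them coincide. *)
Lemma iid_eq_law d (T : measurableType d) (P : probability T R)
    d' (T' : measurableType d') (P' : probability T' R)
    (X : I -> T -> R) (X' : I -> T' -> R) :
  iid_std_normal P X -> iid_std_normal P' X' ->
  forall F : fam -> \bar R, measurable_fun setT F -> (forall f, 0 <= F f)%E ->
  (\int[P]_w F (X^~ w) = \int[P']_w F (X'^~ w))%E.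
Proof.
move=> [mX [lX iX]] [mX' [lX' iX']] F mF F0.
pose fX : {mfun T >-> fam} := mfun_Sub (mem_set (measurable_family mX)).
pose fX' : {mfun T' >-> fam} := mfun_Sub (mem_set (measurable_family mX')).
rewrite -[LHS](@ge0_integral_pushforward _ _ _ _ _ fX _ P setT F)//.
rewrite -[RHS](@ge0_integral_pushforward _ _ _ _ _ fX' _ P' setT F)//.
apply: eq_measure_integral => C mC _.
apply: (@measure_unique _ R fam cyl (fun=> setT) erefl _ _ _ (pushforward P fX) (pushforward P' fX')) => //.
- exact: cylinder_setI_closed.
- by move=> _; exists [::], (fun=> setT); split => //; apply/seteqP; split.
- by apply/seteqP; split => // f _; exists 0%N.
- move=> _ [s [A [mA ->]]]; rewrite /pushforward.
  (* Independence is stated for duplicate-free lists, whereas a cylinder may list an index twice,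
     with the same constraint; [undup] reconciles the two. *)
  have E (V : Type) (Y : I -> V -> R) :
    (fun w : V => Y^~ w) @^-1` [set f | forall i, i \in s -> A i (f i)] =
    \bigcap_(i in [set i | i \in undup s]) (Y i @^-1` A i).
    apply/seteqP; split => w /= h i /= si; apply: h; first by rewrite -mem_undup.
    by rewrite /= mem_undup.
  rewrite [X in P X = _](E _ X) [X in _ = P' X](E _ X') iX ?undup_uniq// iX' ?undup_uniq//.
  by apply: eq_bigr => i _; rewrite lX ?lX'.
- by move=> k; change (P (fX @^-1` setT) < +oo)%E; rewrite preimage_setT probability_setT ltry.
Qed.

End law_of_family.

(* A family that reads its coordinates in [J] from one copy of the space and the
   other ones from an independent copy has the same law. *)
Lemma iid_decoupled (R : realType) (I : eqType) d (T : measurableType d)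
    (P : probability T R) (X : I -> T -> R) (J : pred I) :
  iid_std_normal P X ->
  iid_std_normal (P \x P)%E (fun i (w : T * T) => if J i then X i w.1 else X i w.2).
Proof.
move=> [mX [lX iX]].
have mXA i (A : set R) : measurable A -> measurable (X i @^-1` A).
  by move=> mA; rewrite -[_ @^-1` _]setTI; exact: mX.
have law i (A : set R) : measurable A ->
    (P \x P)%E ((fun w : T * T => if J i then X i w.1 else X i w.2) @^-1` A) = P (X i @^-1` A).
  move=> mA; case: (boolP (J i)) => Ji.
    rewrite (_ : _ @^-1` _ = (X i @^-1` A) `*` setT); last first.
      by apply/seteqP; split => w //= [].
    by rewrite product_measure1E//; [rewrite [X in (_ * X)%E]probability_setT mule1|exact: mXA].
  rewrite (_ : _ @^-1` _ = setT `*` (X i @^-1` A)); last first.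
    by apply/seteqP; split => w //= [].
  by rewrite product_measure1E//; [rewrite [X in (X * _)%E]probability_setT mul1e|exact: mXA].
split; [|split].
- by move=> i; case: (J i); apply: measurableT_comp.
- by move=> i A mA; rewrite -(lX i A mA); exact: law.
- move=> s A us mA.
  rewrite [RHS](eq_bigr (fun i => P (X i @^-1` A i))); last by move=> i _; exact: law.
  have mC (Q : pred I) : measurable (\bigcap_(i in [set i | i \in seq.filter Q s]) (X i @^-1` A i)).
    by apply: measurable_bigcap_seq => i; exact: mXA.
  rewrite (_ : \bigcap_(i in _) _ =
    (\bigcap_(i in [set i | i \in seq.filter J s]) (X i @^-1` A i)) `*`
    (\bigcap_(i in [set i | i \in seq.filter (predC J) s]) (X i @^-1` A i))); last first.
    apply/seteqP; split => w /=.
      by move=> h; split => i /=; rewrite mem_filter => /andP[Ji /h] /=;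
        [rewrite Ji|rewrite (negbTE Ji)].
    move=> [h1 h2] i /= si; case: ifPn => Ji; [apply: h1|apply: h2] => /=;
      by rewrite mem_filter si /= Ji.
  etransitivity; first exact: (product_measure1E P P (mC J) (mC (predC J))).
  rewrite [RHS](bigID J)/= -!(big_filter s).
  by congr (_ * _)%E; apply: iX; rewrite ?filter_uniq.
Qed.

Section blocks.
Context (R : realType) (I : eqType) d (T : measurableType d) (P : probability T R)
  (X : I -> T -> R).
Hypothesis iX : iid_std_normal P X.
Local Notation fam := (family I R).

(** The decoupled family has the law of [X], and Tonelli applies to it. The inner integral plays the
    part of the conditional expectation given the coordinates in [J]. *)
Lemma iid_fubini (J : pred I) (F : fam -> \bar R) :
  measurable_fun setT F -> (forall f, 0 <= F f)%E ->
  (\int[P]_w F (X^~ w) =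
   \int[P]_w \int[P]_w' F (fun i => if J i then X i w else X i w'))%E.
Proof.
move=> mF F0; have iY := iid_decoupled J iX.
rewrite (iid_eq_law iX iY mF F0) fubini_tonelli1//.
by apply: measurableT_comp mF _; apply: measurable_family; have [] := iY.
Qed.

Lemma iid_blocksM (J : pred I) (F G : fam -> \bar R) :
  measurable_fun setT F -> (forall f, 0 <= F f)%E ->
  measurable_fun setT G -> (forall f, 0 <= G f)%E ->
  (forall f g : fam, (forall i, J i -> f i = g i) -> F f = F g) ->
  (forall f g : fam, (forall i, ~~ J i -> f i = g i) -> G f = G g) ->
  (\int[P]_w (F (X^~ w) * G (X^~ w)) =
   (\int[P]_w F (X^~ w)) * (\int[P]_w G (X^~ w)))%E.
Proof.
move=> mF F0 mG G0 JF JG; have [mX _] := iX.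
have mFX : measurable_fun setT (fun w => F (X^~ w)) by apply: measurableT_comp mF _; exact: measurable_family.
have mGX : measurable_fun setT (fun w => G (X^~ w)) by apply: measurableT_comp mG _; exact: measurable_family.
rewrite (@iid_fubini J (fun f => F f * G f)%E); last 2 first.
- exact: emeasurable_funM.
- by move=> f; exact: mule_ge0.
rewrite -ge0_integralZr//; last by apply: integral_ge0.
apply: eq_integral => w _; rewrite -ge0_integralZl//.
apply: eq_integral => w' _; congr (_ * _)%E.
  by apply: JF => i ->.
by apply: JG => i /negbTE ->.
Qed.

(** Used to bring the variables into the shape expected by the conditional bounds: a left block to
    freeze and a Gaussian array on the right. *)
Lemma iid_reindex (K : eqType) (h : K -> I) : injective h ->
  iid_std_normal P (X \o h).
Proof.
move=> hI; have [mX [lX jX]] := iX; split; [|split].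
- by move=> i; exact: mX.
- by move=> i A mA; exact: lX.
- move=> s A us mA.
  have [->|/eqP s0] := eqVneq s [::].
    rewrite big_nil (_ : \bigcap_(i in _) _ = setT) ?probability_setT//.
    by apply/seteqP; split.
  have [k0 _] : exists k0, k0 \in s by case: (s) s0 => // k0 ? _; exists k0; rewrite inE eqxx.
  (* A left inverse of [h] on [s]: the product formula asks for a set at every index of [I], not
     only at those in the image of [h]. *)
  pose g i := nth k0 s (index i (map h s)).
  have gK k : k \in s -> g (h k) = k by move=> ks; rewrite /g index_map// nth_index.
  have := jX (map h s) (A \o g); rewrite map_inj_uniq// => /(_ us (fun i => mA _)).
  rewrite big_map [in X in _ = X -> _](eq_big_seq (fun i => P (X (h i) @^-1` A i))); last first.
    by move=> i si; rewrite /= gK.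
  move=> <-; congr (P _); apply/seteqP; split => w /= hw i /=.
    by move=> /mapP[k ks ->] /=; rewrite gK//; exact: hw.
  by move=> si; have := hw (h i) (map_f _ si); rewrite /= gK.
Qed.

End blocks.

(** * Rotation invariance of the planar Gaussian integral, and the exponential moment of a square *)

Section gaussian_integrals.
Context (R : realType).
Local Notation mu := (@lebesgue_measure R).
Local Open Scope ereal_scope.

Lemma lebesgue_measure_shift (a : R) (A : set (measurableTypeR R)) : measurable A ->
  pushforward mu (fun x : R => (x + a)%R : measurableTypeR R) A = mu A.
Proof.
pose f (x : measurableTypeR R) : measurableTypeR R := (x + a)%R.
have mf : measurable_fun setT f by exact: measurable_funD.
move=> mA; apply/esym.
pose nu := measure_function_pushforward__canonical__measure_function_Measure mu mf.
apply: (@lebesgue_measure_unique R nu) => // _ [[b c] _ <-].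
rewrite /nu /= /pushforward /=.
rewrite [X in _ = mu X](_ : _ = `](b - a)%R, (c - a)%R]%classic); last first.
  by apply/seteqP; split => x /=; rewrite !in_itv/= ltrBlDr lerBrDr.
rewrite !lebesgue_measure_itv/= !lte_fin ltrD2r.
by case: ifP => // _; rewrite -!EFinB; congr EFin; ring.
Qed.

Lemma ge0_integral_shift (a : R) (f : R -> \bar R) :
  measurable_fun setT f -> (forall x, 0 <= f x) ->
  \int[mu]_x f (x + a)%R = \int[mu]_x f x.
Proof.
move=> mf f0.
have mshift : measurable_fun setT (fun x : measurableTypeR R => (x + a)%R : measurableTypeR R).
  exact: measurable_funD.
rewrite -[LHS](@ge0_integral_pushforward _ _ _ _ _ _ mshift mu setT f)//.
by apply: eq_measure_integral => A mA _; exact: lebesgue_measure_shift.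
Qed.

(** The Radon-Nikodym derivative of the normal law agrees almost everywhere with [normal_pdf], since
    both have the same integral over every measurable set. *)
Lemma ge0_integral_normal_prob (f : R -> \bar R) :
  measurable_fun setT f -> (forall x, 0 <= f x) ->
  \int[normal_prob 0 1]_x f x = \int[mu]_x (f x * (normal_pdf 0 1 x)%:E).
Proof.
move=> mf f0; have dom := @normal_prob_dominates R 0 1.
rewrite -(@Radon_Nikodym_SigmaFinite.change_of_variables _ _ _ _ _ dom)//.
have mg : measurable_fun setT (Radon_Nikodym_SigmaFinite.f (normal_prob 0 1) mu).
  exact: (measurable_int _ (Radon_Nikodym_SigmaFinite.f_integrable dom)).
have mp : measurable_fun setT (fun x : R => (normal_pdf 0 1 x)%:E).
  by apply/measurable_EFinP; exact: measurable_normal_pdf.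
apply: ae_eq_integral => //.
- exact: emeasurable_funM.
- exact: emeasurable_funM.
- apply: ae_eqe_mul2l; apply: integral_ae_eq => //.
    exact: Radon_Nikodym_SigmaFinite.f_integrable.
  by move=> E _ mE; rewrite -Radon_Nikodym_SigmaFinite.f_integral.
Qed.


(** Tonelli puts the sheared variable inside, where for fixed [y] the shear is a translation. *)
Lemma integral_shear1 (t : R) (f : R -> R -> \bar R) :
  measurable_fun setT (fun z : R * R => f z.1 z.2) -> (forall x y, 0 <= f x y) ->
  \int[mu]_x \int[mu]_y f (x + t * y)%R y = \int[mu]_x \int[mu]_y f x y.
Proof.
move=> mf f0.
have mf' : measurable_fun setT (fun z : R * R => f (z.1 + t * z.2)%R z.2).
  have mg : measurable_fun setT (fun z : R * R => ((z.1 + t * z.2)%R, z.2)).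
    apply/measurable_fun_pairP; split => /=; last exact: measurable_snd.
    by apply: measurable_funD => //; apply: measurable_funM.
  exact: (measurableT_comp mf mg).
apply: (etrans (fubini_tonelli (m1 := mu) (m2 := mu) _ mf' (fun z => f0 _ _))).
apply: (etrans _ (esym (fubini_tonelli (m1 := mu) (m2 := mu) _ mf (fun z => f0 _ _)))).
apply: eq_integral => y _; apply: (ge0_integral_shift (t * y) (f := f^~ y)) => //.
exact: (measurableT_comp mf (pair2_measurable y)).
Qed.

Lemma integral_shear2 (t : R) (f : R -> R -> \bar R) :
  measurable_fun setT (fun z : R * R => f z.1 z.2) -> (forall x y, 0 <= f x y) ->
  \int[mu]_x \int[mu]_y f x (y + t * x)%R = \int[mu]_x \int[mu]_y f x y.
Proof.
move=> mf f0.
apply: eq_integral => x _; apply: (ge0_integral_shift (t * x) (f := f x)) => //.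
exact: (measurableT_comp mf (pair1_measurable x)).
Qed.

(* A rotation is a product of three shears. *)
Lemma integral_rotation (a b : R) (f : R -> R -> \bar R) :
  (0 <= a)%R -> (a ^+ 2 + b ^+ 2 = 1)%R ->
  measurable_fun setT (fun z : R * R => f z.1 z.2) -> (forall x y, 0 <= f x y) ->
  \int[mu]_x \int[mu]_y f (a * x + b * y)%R (- b * x + a * y)%R =
  \int[mu]_x \int[mu]_y f x y.
Proof.
(* [t] is the tangent of half the angle, and [0 <= a] keeps [1 + a] away from zero. The three shears
   have parameters [t], [- b] and [t]. *)
move=> a0 ab mf f0; set t := (b / (1 + a))%R.
have a1 : (1 + a != 0)%R by rewrite gt_eqF// ltr_wpDr.
have tb : (t * b = 1 - a)%R.
  rewrite /t mulrAC -expr2 (_ : b ^+ 2 = (1 - a) * (1 + a))%R ?mulfK//.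
  by rewrite -subr_sqr expr1n -ab addrAC subrr add0r.
have ta : (t * (1 + a) = b)%R by rewrite /t divfK.
have mpair (h1 h2 : R * R -> R) : measurable_fun setT h1 -> measurable_fun setT h2 ->
    measurable_fun setT (fun z => f (h1 z) (h2 z)).
  move=> m1 m2; have mg : measurable_fun setT (fun z => (h1 z, h2 z)).
    exact/measurable_fun_pairP.
  exact: (measurableT_comp mf mg).
have mlin (u v : R) : measurable_fun setT (fun z : R * R => u * z.1 + v * z.2)%R.
  by apply: measurable_funD; apply: measurable_funM.
have h1 := @integral_shear1 t f mf f0.
have g0 : measurable_fun setT (fun z : R * R => f (z.1 + t * z.2)%R z.2).
  by apply: mpair => //; apply: measurable_funD => //; apply: measurable_funM.
have h2 := @integral_shear2 (- b) (fun x y => f (x + t * y)%R y) g0 (fun x y => f0 _ _).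
have g1 : measurable_fun setT
    (fun z : R * R => f (z.1 + t * (z.2 + - b * z.1))%R (z.2 + - b * z.1)%R).
  apply: mpair; [apply: measurable_funD => //; apply: measurable_funM => //|];
    by apply: measurable_funD => //; apply: measurable_funM.
have h3 := @integral_shear1 t
  (fun x y => f (x + t * (y + - b * x))%R (y + - b * x)%R) g1 (fun x y => f0 _ _).
apply: (etrans _ (etrans h3 (etrans h2 h1))).
apply: eq_integral => x _; apply: eq_integral => y _.
have E2 : (y + - b * (x + t * y) = - b * x + a * y)%R.
  by transitivity (- b * x + (1 - t * b) * y)%R; [ring|rewrite tb; ring].
rewrite E2; congr (f _ _).
by transitivity ((1 - t * b) * x + t * (1 + a) * y)%R; [rewrite tb ta; ring|ring].
Qed.

Lemma normal_pdf01E (x : R) :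
  normal_pdf 0 1 x = (normal_peak 1 * expR (- (x ^+ 2 / 2)))%R.
Proof.
rewrite normal_pdfE ?oner_neq0// /normal_fun subr0 expr1n; congr (_ * expR _)%R.
by rewrite mulNr.
Qed.

(** The product density depends on [x ^+ 2 + y ^+ 2] only, so it can be absorbed into the integrand
    before the Lebesgue integral is rotated. *)
Lemma normal_rotation (a b : R) (f : R -> R -> \bar R) :
  (0 <= a)%R -> (a ^+ 2 + b ^+ 2 = 1)%R ->
  measurable_fun setT (fun z : R * R => f z.1 z.2) -> (forall x y, 0 <= f x y) ->
  \int[normal_prob 0 1]_x \int[normal_prob 0 1]_y f (a * x + b * y)%R (- b * x + a * y)%R =
  \int[normal_prob 0 1]_x \int[normal_prob 0 1]_y f x y.
Proof.
move=> a0 ab mf f0.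
have step (g : R -> R -> \bar R) : measurable_fun setT (fun z : R * R => g z.1 z.2) ->
    (forall x y, 0 <= g x y) ->
    \int[normal_prob 0 1]_x \int[normal_prob 0 1]_y g x y =
    \int[mu]_x \int[mu]_y (g x y * (normal_pdf 0 1 x * normal_pdf 0 1 y)%:E).
  move=> mg g0.
  rewrite ge0_integral_normal_prob; last 2 first.
  - exact: (measurable_fun_fubini_tonelli_F (m2 := normal_prob 0 1) (fun z => g z.1 z.2)).
  - by move=> x; apply: integral_ge0.
  apply: eq_integral => x _.
  have mgx : measurable_fun setT (g x) by exact: (measurableT_comp mg (pair1_measurable x)).
  have mp : measurable_fun setT (fun x : R => (normal_pdf 0 1 x)%:E).
    by apply/measurable_EFinP; exact: measurable_normal_pdf.
  rewrite ge0_integral_normal_prob// -ge0_integralZr//; last 3 first.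
  - exact: emeasurable_funM.
  - by move=> y _; rewrite mule_ge0// lee_fin normal_pdf_ge0.
  - by rewrite lee_fin normal_pdf_ge0.
  by apply: eq_integral => y _; rewrite -muleA -EFinM mulrC.
have mp : measurable_fun setT (fun x : R => normal_pdf 0 1 x) by exact: measurable_normal_pdf.
have mg : measurable_fun setT
    (fun z : R * R => ((a * z.1 + b * z.2)%R, (- b * z.1 + a * z.2)%R)).
  by apply/measurable_fun_pairP; split; apply: measurable_funD; apply: measurable_funM.
rewrite (step f mf f0) (step (fun x y => f (a * x + b * y)%R (- b * x + a * y)%R)); last 2 first.
- exact: (measurableT_comp mf mg).
- by [].
pose g x y := f x y * (normal_pdf 0 1 x * normal_pdf 0 1 y)%:E.
have mg' : measurable_fun setT (fun z : R * R => g z.1 z.2).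
  apply: emeasurable_funM; first exact: mf.
  apply/measurable_EFinP; apply: measurable_funM.
    exact: (measurableT_comp mp measurable_fst).
  exact: (measurableT_comp mp measurable_snd).
have g0 x y : 0 <= g x y by rewrite mule_ge0// lee_fin mulr_ge0// normal_pdf_ge0.
apply: (etrans _ (integral_rotation a0 ab mg' g0)).
apply: eq_integral => x _; apply: eq_integral => y _; congr (_ * _%:E).
rewrite !normal_pdf01E mulrACA [RHS]mulrACA -!expRD; congr (_ * expR _)%R.
by rewrite -[LHS]mulr1 -[X in (_ * X)%R]ab; field.
Qed.

(** The weight turns the standard density into [s] times the centred normal density of standard
    deviation [s], where [s ^+ 2 = (1 - 2 * t)^-1]. *)
Lemma normal_exp_sqr (t : R) : (t < 2^-1)%R ->
  \int[normal_prob 0 1]_x (expR (t * x ^+ 2))%:E = ((Num.sqrt (1 - 2 * t))^-1)%:E.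
Proof.
move=> t2; have u0 : (0 < 1 - 2 * t)%R by lra.
set s := (Num.sqrt (1 - 2 * t))^-1%R.
have s0 : (0 < s)%R by rewrite invr_gt0 sqrtr_gt0.
have s2 : (s ^+ 2 = (1 - 2 * t)^-1)%R by rewrite exprVn sqr_sqrtr// ltW.
have mE : measurable_fun setT (fun x : R => (expR (t * x ^+ 2))%:E).
  apply/measurable_EFinP; apply: measurableT_comp => //.
  by apply: measurable_funM => //; exact: measurable_funX.
have E (x : R) : (t * x ^+ 2 - x ^+ 2 / 2 = - x ^+ 2 / ((1 - 2 * t)^-1 *+ 2))%R.
  by field; rewrite gt_eqF.
rewrite ge0_integral_normal_prob//.
transitivity (\int[mu]_x (s%:E * (normal_pdf 0 s x)%:E)).
  apply: eq_integral => x _; rewrite -!EFinM; congr EFin.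
  rewrite normal_pdf01E normal_pdfE ?gt_eqF// /normal_fun subr0 mulrCA -expRD [RHS]mulrA.
  congr (_ * _)%R.
    rewrite /normal_peak expr1n mul1r -mulrnAr sqrtrM ?sqr_ge0// sqrtr_sqr gtr0_norm//.
    by rewrite invfM mulrA divff ?mul1r// gt_eqF.
  by congr expR; rewrite s2 E.
rewrite ge0_integralZl_EFin//; last 3 first.
- by move=> x _; rewrite lee_fin normal_pdf_ge0.
- by apply/measurable_EFinP; exact: measurable_normal_pdf.
- exact: ltW.
by rewrite integral_normal_pdf mule1.
Qed.

End gaussian_integrals.

(** * Orthogonal changes of coordinates of an i.i.d. Gaussian family *)

Lemma prode_split (R : realType) (I : eqType) (i : I) (s : seq I) (g : I -> \bar R) :
  uniq s ->
  (\prod_(k <- s) g k = (if i \in s then g i else 1) * \prod_(k <- s | k != i) g k)%E.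
Proof.
move=> us; case: ifPn => si; first exact: bigD1_seq.
rewrite mul1e big_seq [RHS]big_seq_cond; apply: eq_bigl => k.
by case: (boolP (k \in s)) => //= ks; apply/esym; apply: contra si => /eqP <-.
Qed.

Section givens.
Context (R : realType) (I : eqType) d (T : measurableType d) (P : probability T R).

Lemma iid_expect1 (X : I -> T -> R) (i : I) (f : R -> \bar R) :
  iid_std_normal P X -> measurable_fun setT f -> (forall x, 0 <= f x)%E ->
  (\int[P]_w f (X i w) = \int[normal_prob 0 1]_x f x)%E.
Proof.
move=> [mX [lX _]] mf f0.
have mXi : @measurable_fun _ _ T (measurableTypeR R) setT (X i) := mX i.
have h := @ge0_integral_pushforward _ _ _ (measurableTypeR R) _ _ mXi P setT f measurableT mf
  (fun y _ => f0 y).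
apply: (etrans (esym h)).
pose nu := measure_function_pushforward__canonical__measure_function_Measure P mXi.
apply: (@eq_measure_integral _ (measurableTypeR R) R setT (normal_prob 0 1) nu f) => A mA _.
exact: lX.
Qed.

Lemma iid_expect2 (X : I -> T -> R) (i j : I) (f : R -> R -> \bar R) :
  i != j -> iid_std_normal P X ->
  measurable_fun setT (fun z : R * R => f z.1 z.2) -> (forall x y, 0 <= f x y)%E ->
  (\int[P]_w f (X i w) (X j w) =
   \int[normal_prob 0 1]_x \int[normal_prob 0 1]_y f x y)%E.
Proof.
move=> ij iX mf f0.
have mp : measurable_fun setT (fun g : family I R => (g i, g j)).
  by apply/measurable_fun_pairP; split; exact: measurable_coord.
rewrite (iid_fubini iX (pred1 i) (F := fun g => f (g i) (g j))); last 2 first.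
- exact: (measurableT_comp mf mp).
- by move=> g.
rewrite /= eqxx eq_sym (negbTE ij).
rewrite -(@iid_expect1 X i (fun x => \int[normal_prob 0 1]_y f x y)%E iX); last 2 first.
- exact: (measurable_fun_fubini_tonelli_F (m2 := normal_prob 0 1) (fun z => f z.1 z.2)).
- by move=> x; apply: integral_ge0.
apply: eq_integral => w _; apply: (@iid_expect1 X j (f (X i w))) => //.
exact: (measurableT_comp mf (pair1_measurable (X i w))).
Qed.

Definition givens (i j : I) (a b : R) (X : I -> T -> R) : I -> T -> R :=
  fun k w => if k == i then a * X i w + b * X j w
             else if k == j then - b * X i w + a * X j w else X k w.

(** The rotated pair is a function of coordinates [i] and [j], independent of the others: the
    probability factors into the expectation of [F], computed by [normal_rotation], and that of the
    indicator [G] of the untouched constraints. *)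
Lemma iid_givens_ge0 (X : I -> T -> R) (i j : I) (a b : R) :
  i != j -> 0 <= a -> a ^+ 2 + b ^+ 2 = 1 ->
  iid_std_normal P X -> iid_std_normal P (givens i j a b X).
Proof.
move=> ij a0 ab iX; have [mX [lX jX]] := iX.
have ji : (j == i) = false by rewrite eq_sym (negbTE ij).
have mY k : measurable_fun setT (givens i j a b X k).
  rewrite /givens; case: (k == i); last case: (k == j) => //.
    by apply: measurable_funD; apply: measurable_funM.
  by apply: measurable_funD; apply: measurable_funM.
suff main (s : seq I) (A : I -> set R) : uniq s -> (forall i, measurable (A i)) ->
    P (\bigcap_(i0 in [set i0 | i0 \in s]) (givens i j a b X i0 @^-1` A i0)) =
    (\prod_(k <- s) normal_prob 0 1 (A k))%E.
  have law k (A : set R) : measurable A -> P (givens i j a b X k @^-1` A) = normal_prob 0 1 A.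
    move=> mA; have := main [:: k] (fun=> A) erefl (fun=> mA).
    rewrite big_seq1 => <-; congr (P _); apply/seteqP; split => w /=.
      by move=> h l /=; rewrite inE => /eqP ->.
    by apply => /=; rewrite inE.
  split => //; split => // s A us mA; rewrite main//.
  by apply: eq_bigr => k _; rewrite law.
move=> us mA.
(* Unlisted coordinates are left unconstrained, so that [F] treats at once all cases of [i] and [j]
   belonging to [s]. *)
pose A' k : set R := if k \in s then A k else setT.
have mA' k : measurable (A' k) by rewrite /A'; case: ifP.
pose s' := [seq k <- s | (k != i) && (k != j)].
pose F (f : family I R) : \bar R :=
  (\1_(A' i) (a * f i + b * f j) * \1_(A' j) (- b * f i + a * f j))%:E.
pose G (f : family I R) : \bar R := (\1_[set f : family I R | forall k, k \in s' -> A k (f k)] f)%:E.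
have mlin (u v : R) : measurable_fun setT (fun f : family I R => u * f i + v * f j).
  by apply: measurable_funD; apply: measurable_funM => //; exact: measurable_coord.
have mF : measurable_fun setT F.
  apply/measurable_EFinP; apply: measurable_funM.
    exact: (measurableT_comp (measurable_indic (mA' i)) (mlin a b)).
  exact: (measurableT_comp (measurable_indic (mA' j)) (mlin (- b) a)).
have mC : measurable [set f : family I R | forall k, k \in s' -> A k (f k)].
  by apply: sub_sigma_algebra; exists s', A.
have mG : measurable_fun setT G.
  by apply/measurable_EFinP; exact: measurable_indic.
have mE : measurable (\bigcap_(i0 in [set i0 | i0 \in s]) (givens i j a b X i0 @^-1` A i0)).
  by apply: measurable_bigcap_seq => k; rewrite -[_ @^-1` _]setTI; exact: mY.
rewrite -[X in P X](setIT _) -integral_indic//.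
transitivity (\int[P]_w (F (X^~ w) * G (X^~ w)))%E.
  apply: eq_integral => w _; rewrite /F /G -EFinM !indicE -!natrM !mulnb; congr ((_ : bool)%:R%:E).
  apply/idP/idP => [|/andP[/andP[]]]; rewrite !inE /=.
    move=> h; apply/andP; split; first apply/andP; first split; rewrite inE /A'.
    - by case: ifPn => // /h; rewrite /= /givens eqxx.
    - by case: ifPn => // /h; rewrite /= /givens ji eqxx.
    - move=> k; rewrite mem_filter => /andP[/andP[/negbTE ki /negbTE kj] /h].
      by rewrite /= /givens ki kj.
  rewrite /A' => hi hj hk k /= ks; rewrite /givens.
  have [ki|ki] := eqVneq k i; first by move: hi; rewrite -ki ks.
  have [kj|kj] := eqVneq k j; first by move: hj; rewrite -kj ks.
  by apply: hk; rewrite mem_filter ki kj.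
rewrite (iid_blocksM iX (J := [pred k | (k == i) || (k == j)])) //; last 4 first.
- by move=> f; rewrite lee_fin mulr_ge0.
- by move=> f; rewrite lee_fin.
- by move=> f g fg; rewrite /F !fg /= ?eqxx ?orbT.
- move=> f g fg; rewrite /G !indicE; congr ((_ : bool)%:R%:E).
  apply/idP/idP; rewrite !inE /= => h k ks'; have := ks'; rewrite mem_filter -negb_or => /andP[kij _].
    by rewrite -fg//; exact: h.
  by rewrite fg//; exact: h.
have -> : (\int[P]_w G (X^~ w) = \prod_(k <- s') normal_prob 0 1 (A k))%E.
  transitivity (P (\bigcap_(k in [set k | k \in s']) (X k @^-1` A k))).
    have mB : measurable (\bigcap_(k in [set k | k \in s']) (X k @^-1` A k)).
      by apply: measurable_bigcap_seq => k; rewrite -[_ @^-1` _]setTI; exact: mX.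
    by rewrite -[X in _ = P X](setIT _) -integral_indic.
  by rewrite jX ?filter_uniq//; apply: eq_bigr => k _; rewrite lX.
have -> : (\int[P]_w F (X^~ w) = normal_prob 0 1 (A' i) * normal_prob 0 1 (A' j))%E.
  pose f (x y : R) : \bar R := (\1_(A' i) x * \1_(A' j) y)%:E.
  have mf : measurable_fun setT (fun z : R * R => f z.1 z.2).
    apply/measurable_EFinP; apply: measurable_funM.
      exact: (measurableT_comp (measurable_indic (mA' i)) measurable_fst).
    exact: (measurableT_comp (measurable_indic (mA' j)) measurable_snd).
  have f0 x y : (0 <= f x y)%E by rewrite lee_fin mulr_ge0.
  have mg : measurable_fun setT (fun z : R * R => (a * z.1 + b * z.2, - b * z.1 + a * z.2)).
    by apply/measurable_fun_pairP; split; apply: measurable_funD; apply: measurable_funM.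
  rewrite (iid_expect2 ij iX (f := fun x y => f (a * x + b * y) (- b * x + a * y))) => //; last first.
    exact: (measurableT_comp mf mg).
  rewrite normal_rotation//.
  have nind (c : R) (B : set R) : 0 <= c -> measurable B ->
      (\int[normal_prob 0 1]_y (c * \1_B y)%:E = c%:E * normal_prob 0 1 B)%E.
    move=> c0 mB; have mI : measurable_fun setT (fun y : R => (\1_B y)%:E : \bar R).
      by apply/measurable_EFinP; exact: measurable_indic.
    transitivity (\int[normal_prob 0 1]_y (c%:E * (\1_B y)%:E))%E.
      by apply: eq_integral => y _; rewrite EFinM.
    rewrite ge0_integralZl_EFin//.
    by congr (_ * _)%E; rewrite -[X in _ = normal_prob _ _ X](setIT B); exact: integral_indic.
  have fE (x : R) : (\int[normal_prob 0 1]_y f x y = (\1_(A' i) x)%:E * normal_prob 0 1 (A' j))%E.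
    exact: nind.
  have fin : normal_prob 0 1 (A' j) \is a fin_num.
    rewrite -(lX j _ (mA' j)); apply: fin_num_measure.
    by rewrite -[_ @^-1` _]setTI; exact: mX.
  transitivity (\int[normal_prob 0 1]_x (fine (normal_prob 0 1 (A' j)) * \1_(A' i) x)%:E)%E.
    by apply: eq_integral => x _; rewrite fE EFinM fineK// muleC.
  by rewrite nind ?fine_ge0// fineK// muleC.
rewrite (prode_split i _ us) -[X in (_ = _ * X)%E]big_filter.
rewrite [in X in (_ = _ * X)%E](prode_split j _ (filter_uniq _ us)) mem_filter ji/=.
rewrite muleA; congr (_ * _)%E.
  by rewrite /A'; congr (_ * _)%E; case: ifP => // _; exact: probability_setT.
rewrite -[in RHS]big_filter -filter_predI; apply: congr_big => //.
by apply: eq_filter => k /=; rewrite andbC.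
Qed.

(** When [a < 0] a quarter turn is split off first, in the direction dictated by the sign of [b], so
    that the remaining rotation has a nonnegative cosine. *)
Lemma iid_givens (X : I -> T -> R) (i j : I) (a b : R) :
  i != j -> a ^+ 2 + b ^+ 2 = 1 ->
  iid_std_normal P X -> iid_std_normal P (givens i j a b X).
Proof.
move=> ij ab iX; have [a0|a0] := leP 0 a; first exact: iid_givens_ge0.
have ji : (j == i) = false by rewrite eq_sym (negbTE ij).
have [b0|b0] := leP 0 b.
  rewrite (_ : givens i j a b X = givens i j b (- a) (givens i j 0 1 X)).
    apply: iid_givens_ge0 => //; first by rewrite sqrrN addrC.
    by apply: iid_givens_ge0 => //; rewrite expr0n expr1n add0r.
  apply/funext => k; apply/funext => w; rewrite /givens !eqxx ji.
  by case: (k == i); [ring|case: (k == j) => //; ring].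
rewrite (_ : givens i j a b X = givens i j (- b) a (givens i j 0 (- 1) X)).
  apply: iid_givens_ge0 => //; [by rewrite oppr_ge0 ltW|by rewrite sqrrN addrC|].
  by apply: iid_givens_ge0 => //; rewrite expr0n sqrrN expr1n add0r.
apply/funext => k; apply/funext => w; rewrite /givens !eqxx ji.
by case: (k == i); [ring|case: (k == j) => //; ring].
Qed.

End givens.

Section rotate_rows.
Context (R : realType) (K : eqType) d (T : measurableType d) (P : probability T R).
Implicit Type X : (K + nat * nat)%type -> T -> R.

(** Only [n] rows are rotated, so that this is a finite composition of plane rotations, one per row.
    The left summand carries variables that stay fixed. *)
Definition rotcol (k : nat) (a b : R) (n : nat) X : (K + nat * nat)%type -> T -> R :=
  fun x w => match x with
  | inl _ => X x w
  | inr (i, l) => if (i < n)%N then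
       if l == 0%N then a * X (inr (i, 0%N)) w + b * X (inr (i, k)) w
       else if l == k then - b * X (inr (i, 0%N)) w + a * X (inr (i, k)) w
       else X x w
     else X x w
  end.

Lemma iid_rotcol (k : nat) (a b : R) (n : nat) X :
  (0 < k)%N -> a ^+ 2 + b ^+ 2 = 1 -> iid_std_normal P X ->
  iid_std_normal P (rotcol k a b n X).
Proof.
move=> k0 ab iX; elim: n => [|n IH].
  rewrite (_ : rotcol _ _ _ _ _ = X)//.
  by apply/funext => -[x|[i l]]; apply/funext => w.
rewrite (_ : rotcol k a b n.+1 X = givens (inr (n, 0%N)) (inr (n, k)) a b (rotcol k a b n X)).
  apply: iid_givens => //; apply/eqP => -[k00]; by rewrite -k00 in k0.
have E (i l l' : nat) : ((inr (i, l) : (K + nat * nat)%type) == inr (n, l')) = (i == n) && (l == l').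
  by apply/eqP/andP => [[-> ->]//|[/eqP -> /eqP ->]].
apply/funext => -[x|[i l]]; apply/funext => w; rewrite /givens//= !E ltnn.
rewrite ltnS leq_eqVlt; have [->|ni] /= := eqVneq i n; last by [].
by rewrite ltnn; case: eqP => // _; case: eqP => // ->.
Qed.

(* A unit vector [q] is completed to an orthogonal change of coordinates, applied to the
   first [n] rows; the sign [eps] is that of [q 0] when [p = 0]. *)
Lemma rotate_rows X (n p : nat) (q : nat -> R) :
  iid_std_normal P X -> \sum_(l < p.+1) q l ^+ 2 = 1 ->
  exists X' (eps : R), [/\ iid_std_normal P X', eps ^+ 2 = 1,
    (forall k w, X' (inl k) w = X (inl k) w),
    (forall i w, (i < n)%N ->
       eps * X' (inr (i, 0%N)) w = \sum_(l < p.+1) q l * X (inr (i, nat_of_ord l)) w) &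
    (forall i i' w, (i < n)%N -> (i' < n)%N ->
       \sum_(l < p.+1) X' (inr (i, nat_of_ord l)) w * X' (inr (i', nat_of_ord l)) w =
       \sum_(l < p.+1) X (inr (i, nat_of_ord l)) w * X (inr (i', nat_of_ord l)) w)].
Proof.
move=> iX q1.
(* Starting from the signed value [q 0] lets the induction begin with the identity; the later [r k]
   are norms of initial segments of [q]. *)
pose r k := if k is 0%N then q 0%N else Num.sqrt (\sum_(l < k.+1) q l ^+ 2).
have r2 k : r k ^+ 2 = \sum_(l < k.+1) q l ^+ 2.
  case: k => [|k] /=; first by rewrite big_ord1.
  by rewrite sqr_sqrtr// sumr_ge0// => l _; exact: sqr_ge0.
have step k : (k <= p)%N -> exists X', [/\ iid_std_normal P X',
    (forall k w, X' (inl k) w = X (inl k) w),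
    (forall i w, (i < n)%N ->
       r k * X' (inr (i, 0%N)) w = \sum_(l < k.+1) q l * X (inr (i, nat_of_ord l)) w),
    (forall i l w, (k < l)%N -> X' (inr (i, l)) w = X (inr (i, l)) w) &
    (forall i i' w, (i < n)%N -> (i' < n)%N ->
       \sum_(l < p.+1) X' (inr (i, nat_of_ord l)) w * X' (inr (i', nat_of_ord l)) w =
       \sum_(l < p.+1) X (inr (i, nat_of_ord l)) w * X (inr (i', nat_of_ord l)) w)].
  elim: k => [_|k IH kp].
    by exists X; split => // i w _; rewrite big_ord1.
  have [X' [iX' e1 e2 e3 e4]] := IH (ltnW kp).
  (* Cosine and sine of the rotation that takes the vector of entries [r k], [q k.+1] to its norm on
     the first axis; it is the identity when both entries vanish. *)
  pose a := if r k.+1 == 0 then 1 else r k / r k.+1.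
  pose b := if r k.+1 == 0 then 0 else q k.+1 / r k.+1.
  have rS : r k.+1 ^+ 2 = r k ^+ 2 + q k.+1 ^+ 2 by rewrite !r2 big_ord_recr.
  have ab : a ^+ 2 + b ^+ 2 = 1.
    rewrite /a /b; case: eqVneq => [_|r0]; first by rewrite expr0n expr1n addr0.
    by rewrite !expr_div_n -mulrDl -rS divff// sqrf_eq0.
  exists (rotcol k.+1 a b n X'); split.
  - exact: iid_rotcol.
  - by move=> x w; rewrite /= e1.
  - move=> i w i_n.
    have ra : r k.+1 * a = r k.
      rewrite /a; case: eqVneq => [r0|r0]; last by rewrite mulrCA divff// mulr1.
      rewrite mulr1 r0; apply/esym/eqP; rewrite -sqrf_eq0; move: rS; rewrite r0 expr0n/= => /esym/eqP.
      by rewrite paddr_eq0 ?sqr_ge0// => /andP[].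
    have rb : r k.+1 * b = q k.+1.
      rewrite /b; case: eqVneq => [r0|r0]; last by rewrite mulrCA divff// mulr1.
      rewrite mulr0; apply/esym/eqP; rewrite -sqrf_eq0; move: rS; rewrite r0 expr0n/= => /esym/eqP.
      by rewrite paddr_eq0 ?sqr_ge0// => /andP[].
    rewrite [RHS]big_ord_recr.
    transitivity (r k * X' (inr (i, 0%N)) w + q k.+1 * X' (inr (i, k.+1)) w).
      by rewrite -ra -rb /rotcol i_n eqxx mulrDr !mulrA.
    by rewrite (e2 i w i_n) (e3 i k.+1).
  - move=> i l w kl; rewrite /= (e3 i l w (ltnW kl)) (gtn_eqF kl).
    by case: ifP => // _; rewrite gtn_eqF// (leq_trans _ kl).
  - move=> i i' w i_n i'_n; rewrite -e4//.
    have kp' : (k.+1 < p.+1)%N by [].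
    pose k1 : 'I_p.+1 := Ordinal kp'.
    have k10 : k1 != ord0 by [].
    rewrite (bigD1 ord0)//= [RHS](bigD1 ord0)//= i_n i'_n.
    rewrite (bigD1 k1)//= [in RHS](bigD1 k1)//= eqxx.
    rewrite !addrA; congr (_ + _).
      set u := X' _ _; set v := X' _ _; set u' := X' _ _; set v' := X' _ _.
      transitivity ((a ^+ 2 + b ^+ 2) * (u * u' + v * v')); last by rewrite ab mul1r.
      ring.
    apply: eq_bigr => l /andP[l0 lk].
    have -> : (nat_of_ord l == 0%N) = false by apply/negbTE; exact: l0.
    by have -> : (nat_of_ord l == k.+1) = false by apply/negbTE; exact: lk.
have [X' [iX' e1 e2 e3 e4]] := step p (leqnn p).
by exists X', (r p); split => //; rewrite r2.
Qed.

End rotate_rows.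

(** * Chernoff bounds for chi-square variables *)

Section exp_inequalities.
Context (R : realType).

Lemma ge0_is_derive_homo (f df : R -> R) (y : R) :
  (forall x : R, is_derive x 1 f (df x)) -> (forall x, 0 <= x -> 0 <= df x) ->
  0 <= y -> f 0 <= f y.
Proof.
move=> fdf df0 y0; rewrite -subr_ge0.
have [|c] := @MVT_segment R f df 0 y y0 (fun x _ => fdf x).
  apply: continuous_subspaceT => x.
  exact/differentiable_continuous/derivable1_diffP/(@ex_derive _ _ _ _ _ _ _ (fdf x)).
by rewrite in_itv/= => /andP[c0 _] ->; rewrite mulr_ge0 ?subr0// df0.
Qed.

Lemma expR_ge_quadratic (x : R) : 0 <= x -> 1 + x + x ^+ 2 / 2 <= expR x.
Proof.
move=> x0; rewrite -subr_ge0.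
pose f (x : R) := expR x - (1 + x + x ^+ 2 / 2).
have f0 : f 0 = 0 by rewrite /f expR0 expr0n /= mul0r !addr0 subrr.
rewrite -/(f x) -f0.
apply: (@ge0_is_derive_homo f (fun x => expR x - (1 + x))) => //.
  move=> y; rewrite /f; apply: is_derive_eq.
  by rewrite !scaler0 /GRing.scale/=; field.
by move=> y _; rewrite subr_ge0; exact: expR_ge1Dx.
Qed.

Lemma expR_sqr_sub_ge (y : R) : 0 <= y -> (1 + y)^-1 <= expR (y ^+ 2 / 2 - y).
Proof.
move=> y0; have y1 : 0 < 1 + y by rewrite ltr_pwDl.
rewrite -[leLHS]mul1r ler_pdivrMr//.
pose f (x : R) := expR (x ^+ 2 / 2 - x) * (1 + x).
have f0 : f 0 = 1 by rewrite /f expr0n /= mul0r subr0 expR0 addr0 mulr1.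
rewrite -/(f y) -f0.
apply: (@ge0_is_derive_homo f (fun x => expR (x ^+ 2 / 2 - x) * x ^+ 2)) => //.
  move=> x; rewrite /f; apply: is_derive_eq.
  by rewrite !scaler0 /GRing.scale/=; field.
by move=> x _; rewrite mulr_ge0 ?expR_ge0 ?sqr_ge0.
Qed.

(** The left side is the chi-square moment generating function with one degree of freedom. After
    squaring, the exponential is bounded below by its quadratic Taylor polynomial, which exceeds the
    left side by [2 * t ^+ 4 / (1 - 2 * t) ^+ 2]. *)
Lemma invsqrt_le_exp (t : R) : 0 <= t < 2^-1 ->
  (Num.sqrt (1 - 2 * t))^-1 <= expR (t + t ^+ 2 / (1 - 2 * t)).
Proof.
move=> /andP[t0 t2]; have u0 : 0 < 1 - 2 * t by lra.
rewrite -(ler_pXn2r (ltn0Sn 1)) ?nnegrE ?expR_ge0 ?invr_ge0 ?sqrtr_ge0//.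
rewrite exprVn sqr_sqrtr ?(ltW u0)// -expRM_natl.
set z := 2 * (t + _).
apply: (@le_trans _ _ (1 + z + z ^+ 2 / 2)); last first.
  by apply: expR_ge_quadratic; rewrite /z mulr_ge0// addr_ge0// divr_ge0 ?sqr_ge0// ltW.
rewrite -subr_ge0.
have -> : 1 + z + z ^+ 2 / 2 - (1 - 2 * t)^-1 = 2 * t ^+ 4 / (1 - 2 * t) ^+ 2.
  by rewrite /z; field; rewrite gt_eqF.
by rewrite divr_ge0 ?sqr_ge0// mulr_ge0// exprn_even_ge0.
Qed.

Lemma invsqrt1D_le_exp (t : R) : 0 <= t ->
  (Num.sqrt (1 + 2 * t))^-1 <= expR (t ^+ 2 - t).
Proof.
move=> t0; have u0 : 0 < 1 + 2 * t by lra.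
rewrite -(ler_pXn2r (ltn0Sn 1)) ?nnegrE ?expR_ge0 ?invr_ge0 ?sqrtr_ge0//.
rewrite exprVn sqr_sqrtr ?(ltW u0)// -expRM_natl.
have -> : 2%:R * (t ^+ 2 - t) = (2 * t) ^+ 2 / 2 - 2 * t by field.
by apply: expR_sqr_sub_ge; rewrite mulr_ge0.
Qed.

End exp_inequalities.

Lemma measurable_lt_set d (T : measurableType d) (R : realType) (f g : T -> R) :
  measurable_fun setT f -> measurable_fun setT g -> measurable [set w | f w < g w].
Proof.
move=> mf mg; have := measurable_fun_ltr mf mg measurableT (Y := [set true]).
rewrite setTI (_ : _ @^-1` _ = [set w | f w < g w])//; first by apply.
Qed.

Section chi_square.
Context (R : realType) d (T : measurableType d) (P : probability T R).

Lemma chernoff (f : T -> R) (a b : R) : measurable_fun setT f ->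
  (\int[P]_w (expR (f w))%:E <= (expR b)%:E)%E ->
  (P [set w | (a < f w)%R] <= (expR (b - a))%:E)%E.
Proof.
move=> mf hb; have mE : measurable [set w | (a < f w)%R] by exact: measurable_lt_set.
have me : measurable_fun setT (fun w => (expR (f w))%:E).
  by apply/measurable_EFinP; exact: measurableT_comp.
rewrite -[X in P X](setIT _) -integral_indic//.
apply: (@le_trans _ _ (\int[P]_w ((expR (- a))%:E * (expR (f w))%:E))%E).
  apply: ge0_le_integral => //.
  - by apply/measurable_EFinP; exact: measurable_indic.
  - by apply: emeasurable_funM.
  - move=> w _; rewrite -EFinM -expRD lee_fin indicE.
    have [|_] := boolP (w \in _); last exact: expR_ge0.
    by rewrite inE /= => aw; rewrite -[leLHS]expR0 ler_expR addrC subr_ge0 ltW.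
rewrite ge0_integralZl_EFin ?expR_ge0//.
by rewrite addrC expRD EFinM lee_wpmul2l// lee_fin expR_ge0.
Qed.

Variables (Y : nat -> T -> R).
Hypothesis iY : iid_std_normal P Y.

Lemma chi_square_mgf (t : R) (N : nat) : t < 2^-1 ->
  (\int[P]_w (expR (t * \sum_(k < N) Y k w ^+ 2))%:E =
   ((Num.sqrt (1 - 2 * t))^-1 ^+ N)%:E)%E.
Proof.
move=> t2; elim: N => [|N IH].
  under eq_integral do rewrite big_ord0 mulr0 expR0.
  by rewrite integral_cst// [X in (_ * X)%E]probability_setT mule1.
pose F (f : family nat R) : \bar R := (expR (t * \sum_(k < N) f k ^+ 2))%:E.
pose G (f : family nat R) : \bar R := (expR (t * f N ^+ 2))%:E.
have mG : measurable_fun setT G.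
  apply/measurable_EFinP; apply: measurableT_comp => //; apply: measurable_funM => //.
  by apply: measurable_funX; exact: measurable_coord.
have mF : measurable_fun setT F.
  apply/measurable_EFinP; apply: measurableT_comp => //; apply: measurable_funM => //.
  by apply: measurable_sum => k; apply: measurable_funX; exact: measurable_coord.
transitivity (\int[P]_w (F (Y^~ w) * G (Y^~ w)))%E.
  by apply: eq_integral => w _; rewrite big_ord_recr/= mulrDr expRD EFinM.
rewrite (iid_blocksM iY (J := fun k => (k < N)%N)) //.
- rewrite IH (iid_expect1 (f := fun x => (expR (t * x ^+ 2))%:E) N iY) ?normal_exp_sqr//.
    by rewrite exprSr EFinM.
  by apply/measurable_EFinP; apply: measurableT_comp => //; apply: measurable_funM => //.
- by move=> f; rewrite lee_fin expR_ge0.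
- by move=> f; rewrite lee_fin expR_ge0.
- by move=> f g fg; rewrite /F; congr ((expR (_ * _))%:E); apply: eq_bigr => k _; rewrite fg.
- by move=> f g fg; rewrite /G fg ?ltnn.
Qed.

Let mS N : measurable_fun setT (fun w => \sum_(k < N) Y k w ^+ 2).
Proof. by have [mY _] := iY; apply: measurable_sum => k; apply: measurable_funX. Qed.

Lemma chi_square_upper (N : nat) (x : R) : 0 <= x ->
  (P [set w | (N%:R + 2 * (Num.sqrt N%:R * Num.sqrt x) + 2 * x <
               \sum_(k < N) Y k w ^+ 2)%R] <= (expR (- x))%:E)%E.
Proof.
rewrite le_eqVlt => /orP[/eqP <-|x0].
  by rewrite oppr0 expR0; apply: probability_le1; exact: measurable_lt_set.
case: N => [|N].
  rewrite (_ : [set w | _] = set0) ?measure0 ?lee_fin ?expR_ge0//.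
  apply/seteqP; split => w //=; rewrite big_ord0 sqrtr0 mul0r mulr0 !add0r.
  by rewrite ltNge mulr_ge0// ltW.
set s := Num.sqrt _; set r := Num.sqrt x.
have s0 : 0 < s by rewrite sqrtr_gt0.
have r0 : 0 < r by rewrite sqrtr_gt0.
have s2 : s ^+ 2 = N.+1%:R by rewrite sqr_sqrtr.
have r2 : r ^+ 2 = x by rewrite sqr_sqrtr// ltW.
have sr0 : 0 < s + 2 * r by rewrite addr_gt0// mulr_gt0.
(* The optimal parameter for the bound [invsqrt_le_exp]; the total exponent is then exactly
   [- x]. *)
pose t := r / (s + 2 * r).
have t0 : 0 < t by rewrite divr_gt0.
have t1 : 1 - 2 * t = s / (s + 2 * r) by rewrite /t; field; rewrite gt_eqF.
have t2 : t < 2^-1.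
  have : 0 < 1 - 2 * t by rewrite t1 divr_gt0.
  lra.
rewrite (_ : [set w | _] = [set w | t * (N.+1%:R + 2 * (s * r) + 2 * x) <
    t * \sum_(k < N.+1) Y k w ^+ 2]); last first.
  by apply/seteqP; split => w /=; rewrite ltr_pM2l.
apply: (le_trans (@chernoff _ _ (N.+1%:R * (t + t ^+ 2 / (1 - 2 * t))) _ _)).
- exact: measurable_funM.
- rewrite chi_square_mgf// lee_fin expRM_natl lerXn2r ?nnegrE ?expR_ge0 ?invr_ge0 ?sqrtr_ge0//.
  by apply: invsqrt_le_exp; rewrite (ltW t0).
rewrite lee_fin ler_expR t1 -s2 -r2 /t le_eqVlt; apply/orP; left; apply/eqP.
by field; rewrite !gt_eqF.
Qed.

Lemma chi_square_lower (N : nat) (x : R) : 0 <= x ->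
  (P [set w | (\sum_(k < N) Y k w ^+ 2 < N%:R - 2 * (Num.sqrt N%:R * Num.sqrt x))%R]
   <= (expR (- x))%:E)%E.
Proof.
rewrite le_eqVlt => /orP[/eqP <-|x0].
  by rewrite oppr0 expR0; apply: probability_le1; exact: measurable_lt_set.
case: N => [|N].
  rewrite (_ : [set w | _] = set0) ?measure0 ?lee_fin ?expR_ge0//.
  by apply/seteqP; split => w //=; rewrite big_ord0 sqrtr0 mul0r mulr0 subr0 ltxx.
set s := Num.sqrt _; set r := Num.sqrt x.
have s0 : 0 < s by rewrite sqrtr_gt0.
have r0 : 0 < r by rewrite sqrtr_gt0.
have s2 : s ^+ 2 = N.+1%:R by rewrite sqr_sqrtr.
have r2 : r ^+ 2 = x by rewrite sqr_sqrtr// ltW.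
(* Minimizes the exponent [s ^+ 2 * t ^+ 2 - 2 * s * r * t], with minimum [- r ^+ 2 = - x]. *)
pose t := r / s.
have t0 : 0 < t by rewrite divr_gt0.
rewrite (_ : [set w | _] = [set w | - t * (N.+1%:R - 2 * (s * r)) <
    - t * \sum_(k < N.+1) Y k w ^+ 2]); last first.
  by apply/seteqP; split => w /=; rewrite !mulNr ltrN2 ltr_pM2l.
apply: (le_trans (@chernoff _ _ (N.+1%:R * (t ^+ 2 - t)) _ _)).
- exact: measurable_funM.
- rewrite chi_square_mgf; last by lra.
  rewrite lee_fin expRM_natl lerXn2r ?nnegrE ?expR_ge0 ?invr_ge0 ?sqrtr_ge0//.
  by rewrite mulrN opprK; apply: invsqrt1D_le_exp; rewrite ltW.
rewrite lee_fin ler_expR -s2 -r2 /t le_eqVlt; apply/orP; left; apply/eqP.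
by field; rewrite gt_eqF.
Qed.

End chi_square.

(** * Tails of sums of squared linear forms, with fixed and with random coefficients *)

Section linear_forms.
Context (R : realType) (K : eqType) d (T : measurableType d) (P : probability T R).
Variable X : (K + nat * nat)%type -> T -> R.
Hypothesis iX : iid_std_normal P X.

Local Notation linform a n k w := (\sum_(i < n) a%function (nat_of_ord i) * X (inr (k, nat_of_ord i)) w).

Let mX i : measurable_fun setT (X i). Proof. by have [] := iX. Qed.

Let mL (a : nat -> R) n N :
  measurable_fun setT (fun w => \sum_(k < N) linform a n (nat_of_ord k) w ^+ 2).
Proof.
apply: measurable_sum => k; apply: measurable_funX; apply: measurable_sum => i.
exact: measurable_funM.
Qed.

(* The forms [sum_i a_i X(k, i)] are, up to a common sign, [|a|] times the first
   coordinates of rotated rows. *)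
Lemma linform_rotated (a : nat -> R) (n N : nat) :
  \sum_(i < n) a i ^+ 2 != 0 ->
  exists Y : nat -> T -> R, iid_std_normal P Y /\ forall w,
    \sum_(k < N) linform a n (nat_of_ord k) w ^+ 2 =
    (\sum_(i < n) a i ^+ 2) * \sum_(k < N) Y k w ^+ 2.
Proof.
move=> a0; case: n a0 => [|n] a0; first by rewrite big_ord0 eqxx in a0.
have s0 : 0 < \sum_(i < n.+1) a i ^+ 2.
  by rewrite lt_def a0 sumr_ge0// => i _; exact: sqr_ge0.
set s := \sum_(i < n.+1) a i ^+ 2 in s0 *.
pose q i := a i / Num.sqrt s.
have q1 : \sum_(l < n.+1) q l ^+ 2 = 1.
  under eq_bigr do rewrite /q expr_div_n sqr_sqrtr ?(ltW s0)//.
  by rewrite -mulr_suml divff.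
have [X' [eps [iX' eps2 _ e2 _]]] := rotate_rows N iX q1.
exists (fun k => X' (inr (k, 0%N))); split.
  have hI : injective (fun k : nat => inr (k, 0%N) : (K + nat * nat)%type) by move=> k l [].
  exact: (iid_reindex iX' hI).
move=> w; rewrite mulr_sumr; apply: eq_bigr => k _.
have -> : \sum_(i < n.+1) a i * X (inr (nat_of_ord k, nat_of_ord i)) w =
    Num.sqrt s * (eps * X' (inr (nat_of_ord k, 0%N)) w).
  rewrite e2// mulr_sumr; apply: eq_bigr => i _; rewrite /q mulrA; congr (_ * _).
  by rewrite mulrCA divff ?mulr1// gt_eqF// sqrtr_gt0.
by rewrite exprMn exprMn eps2 mul1r sqr_sqrtr// ltW.
Qed.

Lemma linform_upper (a : nat -> R) (n N : nat) (x : R) : 0 <= x ->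
  (P [set w | ((\sum_(i < n) a i ^+ 2) * (N%:R + 2 * (Num.sqrt N%:R * Num.sqrt x) + 2 * x) <
     \sum_(k < N) linform a n (nat_of_ord k) w ^+ 2)%R] <= (expR (- x))%:E)%E.
Proof.
move=> x0; have [a0|a0] := eqVneq (\sum_(i < n) a i ^+ 2) 0.
  rewrite (_ : [set w | _] = set0) ?measure0 ?lee_fin ?expR_ge0//.
  apply/seteqP; split => w //=; rewrite a0 mul0r big1 ?ltxx// => k _.
  rewrite big1 ?expr0n// => i _; move/eqP: a0.
  rewrite psumr_eq0 => [|j _]; last exact: sqr_ge0.
  by move=> /allP/(_ i); rewrite mem_index_enum sqrf_eq0 => /(_ isT)/eqP ->; rewrite mul0r.
have [Y [iY eY]] := linform_rotated N a0.
have s0 : 0 < \sum_(i < n) a i ^+ 2.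
  by rewrite lt_def a0 sumr_ge0// => i _; exact: sqr_ge0.
apply: le_trans (chi_square_upper iY N x0).
rewrite (_ : [set w | _] = [set w | (N%:R + 2 * (Num.sqrt N%:R * Num.sqrt x) + 2 * x <
               \sum_(k < N) Y k w ^+ 2)%R])//.
by apply/seteqP; split => w /=; rewrite eY ltr_pM2l.
Qed.

Lemma linform_lower (a : nat -> R) (n N : nat) (x : R) : 0 <= x ->
  (P [set w | (\sum_(k < N) linform a n (nat_of_ord k) w ^+ 2 <
     (\sum_(i < n) a i ^+ 2) * (N%:R - 2 * (Num.sqrt N%:R * Num.sqrt x)))%R] <= (expR (- x))%:E)%E.
Proof.
move=> x0; have [a0|a0] := eqVneq (\sum_(i < n) a i ^+ 2) 0.
  rewrite (_ : [set w | _] = set0) ?measure0 ?lee_fin ?expR_ge0//.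
  apply/seteqP; split => w //=; rewrite a0 mul0r.
  by rewrite ltNge sumr_ge0// => k _; exact: sqr_ge0.
have [Y [iY eY]] := linform_rotated N a0.
have s0 : 0 < \sum_(i < n) a i ^+ 2.
  by rewrite lt_def a0 sumr_ge0// => i _; exact: sqr_ge0.
apply: le_trans (chi_square_lower iY N x0).
rewrite (_ : [set w | _] = [set w | (\sum_(k < N) Y k w ^+ 2 <
   N%:R - 2 * (Num.sqrt N%:R * Num.sqrt x))%R])//.
by apply/seteqP; split => w /=; rewrite eY ltr_pM2l.
Qed.

(** A bound valid for every frozen value of the left block integrates to the same bound. The
    coefficients of a linear form in the right block may thus be random, as long as they depend on
    the left block only. *)
Lemma iid_conditional_bound (E : set (family (K + nat * nat)%type R)) (b : R) :
  measurable E ->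
  (forall f : K -> R, (P [set w | E (fun x => if x is inl k then f k else X x w)] <= b%:E)%E) ->
  (P [set w | E (X^~ w)] <= b%:E)%E.
Proof.
move=> mE hE.
have mEw : measurable [set w | E (X^~ w)].
  by rewrite -[X in measurable X]setTI; apply: (measurable_family mX).
pose F (f : family (K + nat * nat)%type R) : \bar R := (\1_E f)%:E.
have mF : measurable_fun setT F by apply/measurable_EFinP; exact: measurable_indic.
have F0 f : (0 <= F f)%E by rewrite lee_fin.
pose J (x : (K + nat * nat)%type) := if x is inl _ then true else false.
have -> : P [set w | E (X^~ w)] = (\int[P]_w F (X^~ w))%E.
  by rewrite -[X in P X](setIT _) -integral_indic.
rewrite (iid_fubini iX J mF F0).
have mi (w : T) i : measurable_fun setT (fun w' => if J i then X i w else X i w').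
  by case: (J i).
have in_le (w : T) : (\int[P]_w' F (fun i => if J i then X i w else X i w') <= b%:E)%E.
  have := hE (fun k => X (inl k) w).
  set B := [set w' | _]; set g := fun w' : T => _.
  have gE w' : (fun i => if J i then X i w else X i w') =
      (fun x => match x with inl k => X (inl k) w | inr _ => X x w' end).
    by apply/funext => -[k|k].
  have mB : measurable B.
    rewrite (_ : B = [set w' | E (fun i => if J i then X i w else X i w')]).
      by rewrite -[X in measurable X]setTI; apply: (measurable_family (mi w)).
    by apply/seteqP; split => w' /=; rewrite gE.
  rewrite -[X in (P X <= _)%E](setIT _) -integral_indic//.
  rewrite [in X in (X -> _)%E](_ : (\int[P]_x (\1_B x)%:E)%E = (\int[P]_w' F (fun i => if J i then X i w else X i w'))%E)//.
  by apply: eq_integral => w' _; rewrite /F gE.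
apply: (@le_trans _ _ (\int[P]_w (cst b%:E w))%E).
  apply: ge0_le_integral => //.
  - by move=> w _; apply: integral_ge0.
  - apply: (measurable_fun_fubini_tonelli_F (m2 := P)
      (fun z : T * T => F (fun i => if J i then X i z.1 else X i z.2))) => //.
    apply: (measurableT_comp mF); apply: measurable_family => i.
    by case: (J i); apply: measurableT_comp.
rewrite integral_cst// [X in (_ * X)%E]probability_setT mule1//.
Qed.

Lemma cond_linform_upper (a : nat -> family K R -> R) (n N : nat) (x : R) :
  (forall i, measurable_fun setT (a i)) -> 0 <= x ->
  (P [set w | ((\sum_(i < n) a i (fun k => X (inl k) w) ^+ 2) *
       (N%:R + 2 * (Num.sqrt N%:R * Num.sqrt x) + 2 * x) <
     \sum_(k < N) (\sum_(i < n) a i (fun k => X (inl k) w) * X (inr (nat_of_ord k, nat_of_ord i)) w) ^+ 2)%R]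
   <= (expR (- x))%:E)%E.
Proof.
move=> ma x0.
have mleft : measurable_fun setT
    (fun f : family (K + nat * nat)%type R => (fun k => f (inl k)) : family K R).
  by apply: measurable_family => k; exact: measurable_coord.
have ma' i : measurable_fun setT
    (fun f : family (K + nat * nat)%type R => a i (fun k => f (inl k))).
  exact: (measurableT_comp (ma i) mleft).
apply: (@iid_conditional_bound [set f : family (K + nat * nat)%type R |
   (\sum_(i < n) a i (fun k => f (inl k)) ^+ 2) *
       (N%:R + 2 * (Num.sqrt N%:R * Num.sqrt x) + 2 * x) <
     \sum_(k < N) (\sum_(i < n) a i (fun k => f (inl k)) * f (inr (nat_of_ord k, nat_of_ord i))) ^+ 2]).
  apply: measurable_lt_set.
    by apply: measurable_funM => //; apply: measurable_sum => i; exact: measurable_funX.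
  apply: measurable_sum => k; apply: measurable_funX; apply: measurable_sum => i.
  by apply: measurable_funM => //; exact: measurable_coord.
by move=> f; exact: (linform_upper (fun i => a i f) n N x0).
Qed.

Lemma cond_linform_lower (a : nat -> family K R -> R) (n N : nat) (x : R) :
  (forall i, measurable_fun setT (a i)) -> 0 <= x ->
  (P [set w |
     (\sum_(k < N) (\sum_(i < n) a i (fun k => X (inl k) w) * X (inr (nat_of_ord k, nat_of_ord i)) w) ^+ 2
     < (\sum_(i < n) a i (fun k => X (inl k) w) ^+ 2) *
       (N%:R - 2 * (Num.sqrt N%:R * Num.sqrt x)))%R]
   <= (expR (- x))%:E)%E.
Proof.
move=> ma x0.
have mleft : measurable_fun setT
    (fun f : family (K + nat * nat)%type R => (fun k => f (inl k)) : family K R).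
  by apply: measurable_family => k; exact: measurable_coord.
have ma' i : measurable_fun setT
    (fun f : family (K + nat * nat)%type R => a i (fun k => f (inl k))).
  exact: (measurableT_comp (ma i) mleft).
apply: (@iid_conditional_bound [set f : family (K + nat * nat)%type R |
     \sum_(k < N) (\sum_(i < n) a i (fun k => f (inl k)) * f (inr (nat_of_ord k, nat_of_ord i))) ^+ 2 <
   (\sum_(i < n) a i (fun k => f (inl k)) ^+ 2) *
       (N%:R - 2 * (Num.sqrt N%:R * Num.sqrt x))]).
  apply: measurable_lt_set.
    apply: measurable_sum => k; apply: measurable_funX; apply: measurable_sum => i.
    by apply: measurable_funM => //; exact: measurable_coord.
  by apply: measurable_funM => //; apply: measurable_sum => i; exact: measurable_funX.
by move=> f; exact: (linform_lower (fun i => a i f) n N x0).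
Qed.

End linear_forms.

(** * Inner products, quadratic forms and the Rayleigh characterization of the top eigenvector *)

Section vdot_theory.
Context (R : realType) (p : nat).
Implicit Types (a b c f g h u : 'cV[R]_p) (M N : 'M[R]_p).

Lemma vdotC a b : vdot a b = vdot b a.
Proof. by apply: eq_bigr => k _; rewrite mulrC. Qed.

Lemma vdotDl a b c : vdot (a + b) c = vdot a c + vdot b c.
Proof. by rewrite -big_split; apply: eq_bigr => k _; rewrite mxE mulrDl. Qed.

Lemma vdotZl (x : R) a b : vdot (x *: a) b = x * vdot a b.
Proof. by rewrite mulr_sumr; apply: eq_bigr => k _; rewrite mxE mulrA. Qed.

Lemma vdotNl a b : vdot (- a) b = - vdot a b.
Proof. by rewrite -scaleN1r vdotZl mulN1r. Qed.

Lemma vdotBl a b c : vdot (a - b) c = vdot a c - vdot b c.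
Proof. by rewrite vdotDl vdotNl. Qed.

Lemma vdotDr a b c : vdot c (a + b) = vdot c a + vdot c b.
Proof. by rewrite vdotC vdotDl !(vdotC c). Qed.

Lemma vdotZr (x : R) a b : vdot a (x *: b) = x * vdot a b.
Proof. by rewrite vdotC vdotZl vdotC. Qed.

Lemma vdotNr a b : vdot a (- b) = - vdot a b.
Proof. by rewrite vdotC vdotNl vdotC. Qed.

Lemma vdotBr a b c : vdot c (a - b) = vdot c a - vdot c b.
Proof. by rewrite vdotDr vdotNr. Qed.

Lemma vdot0l a : vdot 0 a = 0.
Proof. by rewrite -(scale0r a) vdotZl mul0r. Qed.

Lemma vdot_sumr (I : Type) (r : seq I) (F : I -> 'cV[R]_p) a :
  vdot a (\sum_(i <- r) F i) = \sum_(i <- r) vdot a (F i).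
Proof.
elim/big_ind2: _ => [|x1 x2 y1 y2 <- <-|//]; last by rewrite vdotDr.
by rewrite vdotC vdot0l.
Qed.

Lemma vdot_suml (I : Type) (r : seq I) (F : I -> 'cV[R]_p) a :
  vdot (\sum_(i <- r) F i) a = \sum_(i <- r) vdot (F i) a.
Proof. by rewrite vdotC vdot_sumr; apply: eq_bigr => i _; rewrite vdotC. Qed.

Lemma vdot_ge0 a : 0 <= vdot a a.
Proof. by apply: sumr_ge0 => k _; rewrite -expr2 sqr_ge0. Qed.

Lemma vdot_eq0 a : (vdot a a == 0) = (a == 0).
Proof.
apply/idP/eqP => [|->]; last by rewrite vdot0l.
rewrite psumr_eq0 => [/allP h|k _]; last by rewrite -expr2 sqr_ge0.
apply/matrixP => k j; rewrite (ord1 j) mxE; apply/eqP.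
by have := h k (mem_index_enum _); rewrite -expr2 sqrf_eq0.
Qed.

Lemma vdot_mulmx a M b : vdot a (M *m b) = vdot (M^T *m a) b.
Proof.
have E (x y : 'cV[R]_p) : vdot x y = (x^T *m y) 0 0.
  by rewrite mxE; apply: eq_bigr => k _; rewrite mxE.
by rewrite !E trmx_mul trmxK mulmxA.
Qed.

Lemma psd_cauchy N f g : N^T = N -> (forall h, 0 <= vdot h (N *m h)) ->
  vdot f (N *m g) ^+ 2 <= vdot f (N *m f) * vdot g (N *m g).
Proof.
move=> sN N0; set F := vdot f (N *m f); set t := vdot g (N *m g); set s := vdot f (N *m g).
have gf : vdot g (N *m f) = s by rewrite vdot_mulmx sN vdotC.
have expand (x y : R) : 0 <= x ^+ 2 * F - 2 * x * y * s + y ^+ 2 * t.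
  have := N0 (x *: f - y *: g).
  rewrite mulmxBr -!scalemxAr !(vdotBl, vdotBr, vdotZl, vdotZr) gf -/s -/t -/F.
  by move=> h; apply: le_trans h _; rewrite le_eqVlt; apply/orP; left; apply/eqP; ring.
have t0 : 0 <= t by exact: N0.
move: t0; rewrite le_eqVlt => /orP[/eqP t0|t0].
  have [->|s0] := eqVneq s 0; first by rewrite -t0 mulr0 expr0n.
  (* If the form vanishes at [g], it is affine in [y] along [f - y *: g]; with a nonzero slope it
     would take the value [-1] at this [y]. *)
  have := expand 1 ((F + 1) / (2 * s)); rewrite -t0 mulr0 addr0 expr1n mul1r.
  have -> : F - 2 * 1 * ((F + 1) / (2 * s)) * s = -1 by field.
  by rewrite lerNr oppr0 ler10.
have := expand t s.
have -> : t ^+ 2 * F - 2 * t * s * s + s ^+ 2 * t = t * (F * t - s ^+ 2) by ring.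
by rewrite pmulr_rge0// subr_ge0.
Qed.

Lemma vdot_cauchy_sqr f g : vdot f g ^+ 2 <= vdot f f * vdot g g.
Proof.
have := @psd_cauchy 1%:M f g (trmx1 _ _); rewrite !mul1mx; apply => h.
by rewrite mul1mx vdot_ge0.
Qed.

Lemma vnorm_ge0 a : 0 <= vnorm a. Proof. exact: sqrtr_ge0. Qed.

Lemma sqr_vnorm a : vnorm a ^+ 2 = vdot a a.
Proof. by rewrite sqr_sqrtr// vdot_ge0. Qed.

Lemma vnorm_eq0 a : (vnorm a == 0) = (a == 0).
Proof. by rewrite -sqrf_eq0 sqr_vnorm vdot_eq0. Qed.

Lemma vnormZ (x : R) a : vnorm (x *: a) = `|x| * vnorm a.
Proof. by rewrite /vnorm vdotZl vdotZr mulrA -expr2 sqrtrM ?sqr_ge0// sqrtr_sqr. Qed.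

Lemma vdot_cauchy f g : `|vdot f g| <= vnorm f * vnorm g.
Proof.
rewrite -(ler_pXn2r (ltn0Sn 1)) ?nnegrE ?mulr_ge0 ?vnorm_ge0// real_normK ?num_real// exprMn !sqr_vnorm.
exact: vdot_cauchy_sqr.
Qed.

Lemma vdot_mx_bound M f g :
  `|vdot f (M *m g)| <= (\sum_(i < p) \sum_(j < p) `|M i j|) * (vnorm f * vnorm g).
Proof.
have coord h k : `|h k 0| <= vnorm h.
  rewrite -(ler_pXn2r (ltn0Sn 1)) ?nnegrE ?vnorm_ge0// real_normK ?num_real// sqr_vnorm /vdot.
  rewrite (bigD1 k)//= -expr2 lerDl sumr_ge0// => l _; by rewrite -expr2 sqr_ge0.
apply: (le_trans (ler_norm_sum _ _ _)); rewrite mulr_suml; apply: ler_sum => i _.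
rewrite mxE mulr_sumr mulr_suml; apply: (le_trans (ler_norm_sum _ _ _)); apply: ler_sum => j _.
rewrite mulrCA !normrM; apply: ler_wpM2l => //.
by apply: ler_pM.
Qed.

(** Polarization after rescaling: [F] and [G] share the norm [a * b], so the parallelogram identity
    turns the two quadratic bounds into the product of the norms, with no loss of constant. *)
Lemma quad_bilinear_bound M (B : R) f g : M^T = M ->
  (forall h, `|vdot h (M *m h)| <= B * vdot h h) -> `|vdot f (M *m g)| <= B * (vnorm f * vnorm g).
Proof.
move=> sM MB.
have [f0|f0] := eqVneq (vnorm f) 0.
  by move/eqP: f0; rewrite vnorm_eq0 => /eqP ->; rewrite vdot0l normr0 /vnorm vdot0l sqrtr0 mul0r mulr0.
have [g0|g0] := eqVneq (vnorm g) 0.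
  by move/eqP: g0; rewrite vnorm_eq0 => /eqP ->; rewrite mulmx0 vdotC vdot0l normr0 /vnorm vdot0l sqrtr0 !mulr0.
have gf x y : vdot x (M *m y) = vdot y (M *m x) by rewrite vdot_mulmx sM vdotC.
set a := vnorm f; set b := vnorm g; set F := b *: f; set G := a *: g.
have a0 : 0 < a by rewrite lt_def f0 vnorm_ge0.
have b0 : 0 < b by rewrite lt_def g0 vnorm_ge0.
have pol : 4 * vdot F (M *m G) = vdot (F + G) (M *m (F + G)) - vdot (F - G) (M *m (F - G)).
  by rewrite mulmxDr mulmxBr !(vdotDl, vdotDr, vdotNl, vdotNr) (gf G F); ring.
have FG : vdot F (M *m G) = a * b * vdot f (M *m g).
  by rewrite /F /G -scalemxAr vdotZl vdotZr; ring.
have par : vdot (F + G) (F + G) + vdot (F - G) (F - G) = 4 * (a * b) ^+ 2.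
  rewrite !(vdotDl, vdotDr, vdotNl, vdotNr) /F /G !(vdotZl, vdotZr).
  by rewrite -!sqr_vnorm -/a -/b; ring.
have : 4 * `|vdot F (M *m G)| <= 4 * (B * (a * b) ^+ 2).
  rewrite -{1}(ger0_norm (ler0n R 4)) -normrM pol (le_trans (ler_normB _ _))//.
  by rewrite (le_trans (lerD (MB _) (MB _)))// -mulrDr par mulrCA.
rewrite ler_pM2l// FG normrM (ger0_norm (ltW (mulr_gt0 a0 b0))).
rewrite (_ : B * (a * b) ^+ 2 = a * b * (B * (a * b))); last by ring.
by rewrite ler_pM2l// mulr_gt0.
Qed.

Definition rayleigh_set M : set R := [set r | exists2 h, vdot h h = 1 & r = vdot h (M *m h)].

(** An algebraic substitute for compactness of the sphere. [N = B - M] is positive semidefinite;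
    were it invertible, Cauchy-Schwarz for [N] at [h] and [invmx N *m h] would keep
    [vdot h (N *m h)] above a positive constant on the unit sphere, against the choice of [B] as a
    supremum. A kernel vector of [N] is the eigenvector. *)
Lemma rayleigh_sup_eigen M : M^T = M -> (0 < p)%N ->
  exists2 h : 'cV[R]_p, h != 0 & M *m h = sup (rayleigh_set M) *: h.
Proof.
move=> sM p0; set B := sup _.
have [e e1] : exists e : 'cV[R]_p, vdot e e = 1.
  exists (delta_mx (Ordinal p0) 0); rewrite /vdot (bigD1 (Ordinal p0))//= !mxE !eqxx mulr1.
  by rewrite big1 ?addr0// => k /negbTE kp; rewrite mxE kp mul0r.
have hs : has_sup (rayleigh_set M).
  split; first by exists (vdot e (M *m e)), e.
  exists (\sum_(i < p) \sum_(j < p) `|M i j|) => _ [h h1 ->].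
  apply: le_trans (ler_norm _) _; apply: le_trans (vdot_mx_bound _ _ _) _.
  by rewrite /vnorm h1 sqrtr1 !mulr1.
pose N := B%:M - M.
have sN : N^T = N by rewrite /N linearB/= tr_scalar_mx sM.
have NE h : vdot h (N *m h) = B * vdot h h - vdot h (M *m h).
  by rewrite mulmxBl mul_scalar_mx vdotBr vdotZr.
have N0 h : 0 <= vdot h (N *m h).
  have [->|h0] := eqVneq h 0; first by rewrite vdot0l.
  have hh : 0 < vdot h h by rewrite lt_def vdot_eq0 h0 vdot_ge0.
  rewrite NE subr_ge0 -ler_pdivrMr//.
  apply: ub_le_sup; first by case: hs.
  exists ((vnorm h)^-1 *: h).
    by rewrite vdotZl vdotZr mulrA -expr2 exprVn sqr_vnorm mulVf// gt_eqF.
  rewrite -scalemxAr vdotZl vdotZr mulrA -expr2 exprVn sqr_vnorm mulrC.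
  by [].
have [uN|nN] := boolP (N \in unitmx).
  set C := \sum_(i < p) \sum_(j < p) `|invmx N i j|.
  have C0 : 0 <= C by apply: sumr_ge0 => i _; apply: sumr_ge0.
  have C1 : 0 < C + 1 by rewrite ltr_wpDl.
  have low h : vdot h h = 1 -> (C + 1)^-1 <= vdot h (N *m h).
    move=> h1; have := psd_cauchy h (invmx N *m h) sN N0.
    rewrite mulmxA mulmxV// mul1mx h1 expr1n.
    move=> le1; rewrite -[leLHS]mul1r ler_pdivrMr//.
    apply: le_trans le1 _; apply: ler_wpM2l; first exact: N0.
    rewrite vdotC.
    apply: le_trans (ler_norm _) _; apply: le_trans (vdot_mx_bound _ _ _) _.
    by rewrite /vnorm h1 sqrtr1 !mulr1 -/C lerDl.
  have : B <= B - (C + 1)^-1.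
    apply: ge_sup; first by case: hs.
    by move=> _ [h h1 ->]; have := low h h1; rewrite NE h1 mulr1; lra.
  have c0 : 0 < (C + 1)^-1 by rewrite invr_gt0.
  by rewrite lerBrDr gerDl leNgt c0.
have : ~~ row_free N by rewrite row_free_unit.
rewrite -kermx_eq0 => /rowV0Pn[x /sub_kermxP xN x0].
exists x^T; first by rewrite -(inj_eq (@trmx_inj _ _ _)) trmxK trmx0.
have : (x *m N)^T = 0 by rewrite xN trmx0.
rewrite trmx_mul sN mulmxBl mul_scalar_mx => /eqP.
by rewrite subr_eq0 => /eqP <-.
Qed.

(** The hypothesis compares [lam] with eigenvalues only; since the supremum of the Rayleigh quotient
    is itself an eigenvalue, [lam] dominates the whole quadratic form. *)
Lemma top_eigvec_rayleigh M u : M^T = M -> top_unit_eigvec M u ->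
  [/\ vdot u u = 1, M *m u = vdot u (M *m u) *: u &
      forall h, vdot h (M *m h) <= vdot u (M *m u) * vdot h h].
Proof.
move=> sM [u1 [lam [Mu top]]].
have uu : vdot u u = 1 by rewrite -sqr_vnorm u1 expr1n.
have lamE : vdot u (M *m u) = lam by rewrite Mu vdotZr uu mulr1.
rewrite lamE; split => // h.
have p0 : (0 < p)%N.
  rewrite lt0n; apply/eqP => p0; move: uu; rewrite /vdot big1 => [/esym/eqP|k _].
    by rewrite oner_eq0.
  by exfalso; have := ltn_ord k; move: (nat_of_ord k) => kk; rewrite p0.
have [->|h0] := eqVneq h 0; first by rewrite !vdot0l mulr0.
have hh : 0 < vdot h h by rewrite lt_def vdot_eq0 h0 vdot_ge0.
have [w w0 Mw] := rayleigh_sup_eigen sM p0.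
rewrite -ler_pdivrMr//; apply: le_trans (top _ _ w0 Mw).
apply: ub_le_sup.
  exists (\sum_(i < p) \sum_(j < p) `|M i j|) => _ [g g1 ->].
  apply: le_trans (ler_norm _) _; apply: le_trans (vdot_mx_bound _ _ _) _.
  by rewrite /vnorm g1 sqrtr1 !mulr1.
exists ((vnorm h)^-1 *: h).
  by rewrite vdotZl vdotZr mulrA -expr2 exprVn sqr_vnorm mulVf// gt_eqF.
by rewrite -scalemxAr vdotZl vdotZr mulrA -expr2 exprVn sqr_vnorm mulrC.
Qed.

End vdot_theory.

(** * Events of large probability *)

Section likely.
Context (R : realType) d (T : measurableType d) (P : probability T R).

(** Failure is measured through a measurable superset [B], because [Q] will quantify over all
    vectors and its own measurability is not at hand. *)
Definition likely (Q : T -> Prop) (e : R) : Prop :=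
  exists B : set T, [/\ measurable B, (P B <= e%:E)%E & forall w, ~ B w -> Q w].

Lemma likely_sub (Q Q' : T -> Prop) (e e' : R) : likely Q e -> e <= e' ->
  (forall w, Q w -> Q' w) -> likely Q' e'.
Proof.
move=> [B [mB PB BQ]] ee' QQ'; exists B; split => //.
- by apply: le_trans PB _; rewrite lee_fin.
- by move=> w /BQ/QQ'.
Qed.

Lemma likely_not (E : set T) (e : R) : measurable E -> (P E <= e%:E)%E ->
  likely (fun w => ~ E w) e.
Proof. by move=> mE PE; exists E. Qed.

Lemma likely_and (Q Q' : T -> Prop) (e e' : R) : likely Q e -> likely Q' e' ->
  likely (fun w => Q w /\ Q' w) (e + e').
Proof.
move=> [B [mB PB BQ]] [B' [mB' PB' BQ']]; exists (B `|` B'); split.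
- exact: measurableU.
- by apply: (@le_trans _ _ (P B + P B')%E); [exact: measureU2|rewrite EFinD leeD].
- by move=> w /not_orP[/BQ ? /BQ'].
Qed.

Lemma likely_forall (I : eqType) (s : seq I) (C : pred I) (Q : I -> T -> Prop) (e : I -> R) :
  (forall i, C i -> likely (Q i) (e i)) ->
  likely (fun w => forall i, i \in s -> C i -> Q i w) (\sum_(i <- s | C i) e i).
Proof.
move=> h; elim: s => [|i s IH].
  by exists set0; split => //; rewrite measure0 big_nil.
rewrite big_cons; case: ifPn => Ci.
  apply: (likely_sub (likely_and (h i Ci) IH)) => // w [Qi Qs] j.
  by rewrite inE => /orP[/eqP ->//|]; exact: Qs.
apply: (likely_sub IH) => // w Qs j; rewrite inE => /orP[/eqP -> Ci'|]; last exact: Qs.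
by rewrite Ci' in Ci.
Qed.

Lemma likely_forall_fin (I : finType) (C : pred I) (Q : I -> T -> Prop) (e : R) (N : R) :
  (forall i, C i -> likely (Q i) e) -> 0 <= e -> \sum_(i | C i) 1 <= N ->
  likely (fun w => forall i, C i -> Q i w) (N * e).
Proof.
move=> h e0 hN; apply: (likely_sub (likely_forall (index_enum I) h)).
  by rewrite (eq_bigr (fun i => 1 * e)) ?mulr_suml -?mulr_suml ?ler_wpM2r// => i _; rewrite mul1r.
by move=> w Q' i; apply: Q'; rewrite mem_index_enum.
Qed.

End likely.

(** * A net of the sphere and the norm of the centred noise covariance *)

Section net.
Context (R : realType) (p : nat).

Definition intvec (k : 'I_p -> int) : 'cV[R]_p := \col_i (k i)%:~R.

Let near_int (x : R) : `|x - (Num.floor (x + 2^-1))%:~R| <= 2^-1.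
Proof.
have := ge_floor (x + 2^-1); have := lt_succ_floor (x + 2^-1).
rewrite intrD; set f := (Num.floor _)%:~R => h1 h2.
by rewrite ler_norml; apply/andP; split; lra.
Qed.

(** Rounds [5 / 2 * s * h] with [s ^+ 2 = p]: an error of at most [1 / 2] per coordinate becomes,
    after scaling back by [2 / (5 * s)], a squared distance of at most [1 / 25]. The l1 norm is at
    most [5 / 2 * p + p / 2], because that of [h] is at most [s]. *)
Lemma net_approx (h : 'cV[R]_p) : (0 < p)%N -> vdot h h = 1 ->
  exists (k : 'I_p -> int) (c : R), [/\ (\sum_i `|k i|%N <= 3 * p)%N, 0 < c &
    vdot (h - c *: intvec k) (h - c *: intvec k) <= 25^-1].
Proof.
move=> p0 h1; set s := Num.sqrt p%:R : R.
have s0 : 0 < s by rewrite sqrtr_gt0 ltr0n.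
have s2 : s ^+ 2 = p%:R by rewrite sqr_sqrtr.
pose x i := h i 0 * s * 5 / 2.
pose k i := Num.floor (x i + 2^-1).
have sumh : \sum_i `|h i 0| <= s.
  pose a : 'cV[R]_p := \col_i `|h i 0|; pose b : 'cV[R]_p := const_mx 1.
  have := vdot_cauchy a b; have -> : vdot a b = \sum_i `|h i 0|.
    by apply: eq_bigr => i _; rewrite !mxE mulr1.
  have -> : vnorm a = 1.
    rewrite /vnorm (_ : vdot a a = 1) ?sqrtr1// -h1; apply: eq_bigr => i _.
    by rewrite mxE -normrM ger0_norm// -expr2 sqr_ge0.
  have -> : vnorm b = s.
    congr Num.sqrt; rewrite /vdot (eq_bigr (fun=> 1)) => [|i _]; last by rewrite !mxE mulr1.
    by rewrite sumr_const card_ord.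
  by rewrite mul1r; apply: le_trans; exact: ler_norm.
exists k, (2 / (5 * s)); split.
- rewrite -(ler_nat R) natr_sum.
  have kb i : (`|k i|%N)%:R <= `|h i 0| * (s * 5 / 2) + 2^-1.
    rewrite natr_absz intr_norm.
    have -> : (k i)%:~R = x i - (x i - (k i)%:~R) by rewrite opprB addrC subrK.
    apply: le_trans (ler_normB _ _) _; apply: lerD (near_int (x i)).
    rewrite /x -!mulrA normrM (ger0_norm (_ : 0 <= s * (5 / 2))) ?mulrA//.
    by rewrite !mulr_ge0// ltW.
  apply: (le_trans (ler_sum _ (fun i _ => kb i))).
  rewrite big_split/= sumr_const card_ord -mulr_suml natrM -[2^-1 *+ p]mulr_natr -s2.
  have : (\sum_i `|h i 0|) * (s * 5 / 2) <= s * (s * 5 / 2).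
    by apply: ler_wpM2r => //; rewrite !mulr_ge0// ltW.
  by move=> hh; apply: le_trans (lerD hh (lexx _)) _; rewrite le_eqVlt; apply/orP; left; apply/eqP; field.
- by rewrite divr_gt0// mulr_gt0.
- have -> : 25^-1 = \sum_(i < p) (25 * s ^+ 2)^-1.
    by rewrite sumr_const card_ord -[_ *+ p]mulr_natr -s2; field; rewrite gt_eqF.
  apply: ler_sum => i _; rewrite !mxE -expr2.
  have -> : h i 0 - 2 / (5 * s) * (k i)%:~R = 2 / (5 * s) * (x i - (k i)%:~R).
    by rewrite /x; field; rewrite gt_eqF.
  rewrite exprMn -[(x i - _) ^+ 2]real_normK ?num_real//.
  have hh : `|x i - (k i)%:~R| ^+ 2 <= 2^-1 ^+ 2 by rewrite lerXn2r ?nnegrE// near_int.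
  apply: (le_trans (ler_wpM2l _ hh)); first exact: sqr_ge0.
  by rewrite le_eqVlt; apply/orP; left; apply/eqP; field; rewrite gt_eqF.
Qed.

(* For unit vectors at angle [alpha] the values of the quadratic form differ by at most
   [2 sin alpha] times its norm; here [sin alpha <= 1/5]. *)
Lemma net_quadratic (M : 'M[R]_p) (b : R) : (0 < p)%N -> M^T = M ->
  (forall k : 'I_p -> int, (\sum_i `|k i|%N <= 3 * p)%N ->
     `|vdot (intvec k) (M *m intvec k)| <= b * vdot (intvec k) (intvec k)) ->
  forall h, `|vdot h (M *m h)| <= 5 / 3 * b * vdot h h.
Proof.
move=> p0 sM Mk.
pose E : set R := [set r | exists2 h, vdot h h = 1 & r = `|vdot h (M *m h)|].
have [e e1] : exists e : 'cV[R]_p, vdot e e = 1.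
  exists (delta_mx (Ordinal p0) 0); rewrite /vdot (bigD1 (Ordinal p0))//= !mxE !eqxx mulr1.
  by rewrite big1 ?addr0// => k /negbTE kp; rewrite mxE kp mul0r.
have hs : has_sup E.
  split; first by exists `|vdot e (M *m e)|, e.
  exists (\sum_(i < p) \sum_(j < p) `|M i j|) => _ [h h1 ->].
  by apply: le_trans (vdot_mx_bound _ _ _) _; rewrite /vnorm h1 sqrtr1 !mulr1.
set B := sup E.
have BQ h : `|vdot h (M *m h)| <= B * vdot h h.
  have [->|h0] := eqVneq h 0; first by rewrite !vdot0l normr0 mulr0.
  have hh : 0 < vdot h h by rewrite lt_def vdot_eq0 h0 vdot_ge0.
  rewrite -ler_pdivrMr//; apply: ub_le_sup; first by case: hs.
  exists ((vnorm h)^-1 *: h).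
    by rewrite vdotZl vdotZr mulrA -expr2 exprVn sqr_vnorm mulVf// gt_eqF.
  rewrite -scalemxAr vdotZl vdotZr mulrA -expr2 exprVn sqr_vnorm normrM mulrC.
  by rewrite [in RHS]ger0_norm// invr_ge0 ltW.
have B0 : 0 <= B by have := BQ e; rewrite e1 mulr1; exact: le_trans.
(* The norm [B] reappears on the right with a factor below one, and the self-bound
   [B <= b + 2 / 5 * B] yields the constant [5 / 3]. *)
have claim h : vdot h h = 1 -> `|vdot h (M *m h)| <= b + 2 / 5 * B.
  move=> h1; have [k [c [ksum c0 hk]]] := net_approx p0 h1.
  set kv := intvec k in hk.
  have kv0 : kv != 0.
    by apply/eqP => kv0; move: hk; rewrite kv0 scaler0 subr0 h1; lra.
  have nkv : 0 < vnorm kv by rewrite lt_def vnorm_eq0 kv0 vnorm_ge0.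
  pose y := (vnorm kv)^-1 *: kv.
  have y1 : vdot y y = 1.
    by rewrite vdotZl vdotZr mulrA -expr2 exprVn sqr_vnorm mulVf// vdot_eq0.
  have Qy : `|vdot y (M *m y)| <= b.
    rewrite -scalemxAr vdotZl vdotZr mulrA -expr2 exprVn normrM ger0_norm ?invr_ge0 ?sqr_ge0//.
    by rewrite mulrC ler_pdivrMr ?exprn_gt0// sqr_vnorm Mk.
  have diff : vdot h (M *m h) = vdot y (M *m y) + vdot (h - y) (M *m (h + y)).
    rewrite mulmxDr !(vdotDl, vdotDr, vdotNl, vdotNr).
    by rewrite (_ : vdot y (M *m h) = vdot h (M *m y)); [ring|rewrite vdot_mulmx sM vdotC].
  rewrite diff; apply: le_trans (ler_normD _ _) _; apply: lerD => //.
  apply: le_trans (quad_bilinear_bound _ _ sM BQ) _; rewrite mulrC; apply: ler_wpM2r => //.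
  set g := vdot h y.
  rewrite /vnorm -sqrtrM ?vdot_ge0//.
  have -> : vdot (h - y) (h - y) * vdot (h + y) (h + y) = 4 * (1 - g ^+ 2).
    by rewrite !(vdotDl, vdotDr, vdotNl, vdotNr) (vdotC y h) h1 y1 -/g; ring.
  have gk : 1 - g ^+ 2 <= 25^-1.
    apply: le_trans hk; rewrite (_ : c *: kv = (c * vnorm kv) *: y); last first.
      by rewrite scalerA mulfK// gt_eqF.
    have gen (y' : 'cV[R]_p) (c' : R) : vdot y' y' = 1 ->
        1 - vdot h y' ^+ 2 <= vdot (h - c' *: y') (h - c' *: y').
      move=> y1'; rewrite !(vdotBl, vdotBr, vdotZl, vdotZr) (vdotC y' h) h1 y1' -subr_ge0.
      set g' := vdot h y'.
      rewrite (_ : _ - _ = (c' - g') ^+ 2); first exact: sqr_ge0.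
      ring.
    exact: gen.
  rewrite (_ : 2 / 5 = Num.sqrt ((2 / 5) ^+ 2)); last by rewrite sqrtr_sqr ger0_norm.
  by rewrite ler_sqrt ?sqr_ge0//; lra.
have Bb : B <= 5 / 3 * b.
  have : B <= b + 2 / 5 * B by apply: ge_sup; [by case: hs|move=> _ [h h1 ->]; exact: claim].
  lra.
by move=> h; apply: le_trans (BQ h) _; rewrite ler_wpM2r ?vdot_ge0.
Qed.

Let D := (3 * p)%N.
(** Encodes the integers of absolute value at most [D], the range of every coordinate of a net
    point, by [2 D + 1] ordinals: the union bound runs over a finite type. *)
Definition netval (j : 'I_(D + D.+1)) : int := (nat_of_ord j)%:Z - D%:Z.

(** Weigh a vector by [2 / 3] to the power of its l1 norm; net points weigh at least [(2 / 3) ^+ D].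
    The total weight of all vectors factors over the coordinates, each factor being a two-sided
    geometric sum of at most [3 + 2 = 5]. So there are at most [(5 * (3 / 2) ^+ 3) ^+ p] points, and
    [5 * (3 / 2) ^+ 3 <= (3 / 2) ^+ 8 <= expR 4]. *)
Lemma net_count :
  \sum_(k : {ffun 'I_p -> 'I_(D + D.+1)} | (\sum_i `|netval (k i)|%N <= D)%N) (1 : R)
    <= expR (4 * p%:R).
Proof.
pose g (j : 'I_(D + D.+1)) : R := (2 / 3) ^+ `|netval j|%N.
have g0 j : 0 <= g j by rewrite exprn_ge0.
have geo N : \sum_(i < N) (2 / 3 : R) ^+ i <= 3.
  have := subrX1 (2 / 3 : R) N; have t0 : 0 <= (2 / 3 : R) ^+ N by exact: exprn_ge0.
  by move: t0; set S := \sum_(i < N) _; set t := _ ^+ N; lra.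
have gsum : \sum_j g j <= 5.
  rewrite big_split_ord/=.
  have -> : \sum_(i < D.+1) g (rshift D i) = \sum_(i < D.+1) (2 / 3) ^+ i.
    by apply: eq_bigr => i _; rewrite /g /netval/= PoszD addrC addKr.
  have -> : \sum_(i < D) g (lshift D.+1 i) = \sum_(i < D) (2 / 3) ^+ i.+1.
    rewrite (reindex_inj rev_ord_inj)/=; apply: eq_bigr => i _; rewrite /g /netval/=.
    by congr (_ ^+ _); have := ltn_ord i; lia.
  have -> : \sum_(i < D) (2 / 3 : R) ^+ i.+1 = 2 / 3 * \sum_(i < D) (2 / 3) ^+ i.
    by rewrite mulr_sumr; apply: eq_bigr => i _; rewrite exprS.
  by have := geo D; have := geo D.+1; set S1 := \sum_(i < D) _; set S2 := \sum_(i < D.+1) _; lra.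
apply: (@le_trans _ _ ((3 / 2) ^+ D * \sum_(k : {ffun 'I_p -> 'I_(D + D.+1)}) \prod_i g (k i))).
  rewrite mulr_sumr [leRHS](bigID (fun k : {ffun _} => (\sum_i `|netval (k i)|%N <= D)%N))/=.
  rewrite -[leLHS]addr0; apply: lerD; last first.
    by apply: sumr_ge0 => k _; rewrite mulr_ge0 ?exprn_ge0// prodr_ge0.
  have gen (a b : nat) : (a <= b)%N -> 1 <= (3 / 2 : R) ^+ b * (2 / 3) ^+ a.
    move=> ab; rewrite -(subnK ab) exprD -mulrA -exprMn.
    rewrite (_ : 3 / 2 * (2 / 3) = 1 :> R); last by field.
    by rewrite expr1n mulr1 exprn_ege1//; lra.
  by apply: ler_sum => k kD; rewrite /g prodrXr; exact: gen.
rewrite -(bigA_distr_bigA (fun (i : 'I_p) j => g j)) prodr_const card_ord.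
rewrite [4 * _]mulrC expRM_natl /D exprM -exprMn lerXn2r ?nnegrE ?expR_ge0//.
  by rewrite mulr_ge0 ?exprn_ge0// sumr_ge0.
apply: (@le_trans _ _ ((3 / 2) ^+ 3 * 5)); first by rewrite ler_wpM2l ?exprn_ge0.
have -> : (4 : R) = 8%:R * 2^-1 by field.
rewrite expRM_natl.
have e2 : 3 / 2 <= expR (2^-1 : R).
  by apply: le_trans (expR_ge1Dx _); lra.
apply: (@le_trans _ _ ((3 / 2) ^+ 8)); first by rewrite !exprS expr0; lra.
by rewrite lerXn2r ?nnegrE ?expR_ge0.
Qed.

End net.

Section noise.
Context (R : realType) (K : eqType) d (T : measurableType d) (P : probability T R).
Variable X : (K + nat * nat)%type -> T -> R.
Hypothesis iX : iid_std_normal P X.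

Definition gram (n p : nat) (w : T) : 'M[R]_p :=
  \matrix_(k, l) \sum_(i < n) X (inr (nat_of_ord i, nat_of_ord k)) w * X (inr (nat_of_ord i, nat_of_ord l)) w.

Lemma vdot_gram (n p : nat) (w : T) (h g : 'cV[R]_p) :
  vdot h (gram n p w *m g) = \sum_(i < n)
    (\sum_(l < p) h l 0 * X (inr (nat_of_ord i, nat_of_ord l)) w) *
    (\sum_(l < p) g l 0 * X (inr (nat_of_ord i, nat_of_ord l)) w).
Proof.
transitivity (\sum_(k < p) \sum_(l < p) \sum_(i < n)
   (h k 0 * X (inr (nat_of_ord i, nat_of_ord k)) w) * (g l 0 * X (inr (nat_of_ord i, nat_of_ord l)) w)).
  apply: eq_bigr => k _; rewrite mxE mulr_sumr; apply: eq_bigr => l _.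
  rewrite mxE mulr_suml mulr_sumr; apply: eq_bigr => i _; ring.
under eq_bigr do rewrite exchange_big/=.
rewrite exchange_big/=; apply: eq_bigr => i _.
by rewrite mulr_suml; apply: eq_bigr => k _; rewrite mulr_sumr.
Qed.

(** The term [4 p] in the deviation level [x] pays for the union bound over the at most [expR (4 p)]
    net points. *)
Lemma noise_likely (n p : nat) (y : R) : (0 < p)%N -> (0 < n)%N -> 0 <= y ->
  let x := 4 * p%:R + y in
  likely P (fun w => forall h : 'cV[R]_p,
     `|vdot h (gram n p w *m h) - n%:R * vdot h h| <=
       5 / 3 * (2 * (Num.sqrt n%:R * Num.sqrt x) + 2 * x) * vdot h h) (2 * expR (- y)).
Proof.
move=> p0 n0 y0 x; have x0 : 0 <= x by rewrite addr_ge0// mulr_ge0.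
set D := (3 * p)%N.
pose kv (k : {ffun 'I_p -> 'I_(D + D.+1)}) : nat -> R :=
  fun l => if insub l is Some i then (netval (k i))%:~R else 0.
have kvE k (i : 'I_p) : kv k i = (netval (k i))%:~R by rewrite /kv valK.
pose L (k : {ffun 'I_p -> 'I_(D + D.+1)}) w :=
  \sum_(i < n) (\sum_(l < p) kv k l * X (inr (nat_of_ord i, nat_of_ord l)) w) ^+ 2.
pose S k := \sum_(l < p) kv k l ^+ 2.
have mX i : measurable_fun setT (X i) by have [] := iX.
have mL k : measurable_fun setT (L k).
  apply: measurable_sum => i; apply: measurable_funX; apply: measurable_sum => l.
  exact: measurable_funM.
have h1 k : likely P (fun w => ~ (S k * (n%:R + 2 * (Num.sqrt n%:R * Num.sqrt x) + 2 * x) < L k w) /\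
    ~ (L k w < S k * (n%:R - 2 * (Num.sqrt n%:R * Num.sqrt x)))) (2 * expR (- x)).
  rewrite (_ : 2 * expR (- x) = expR (- x) + expR (- x)); last by ring.
  apply: likely_and.
    apply: (@likely_not _ _ _ _ [set w | S k * (n%:R + 2 * (Num.sqrt n%:R * Num.sqrt x) + 2 * x) < L k w]).
      exact: measurable_lt_set.
    exact: (linform_upper iX (kv k) p n x0).
  apply: (@likely_not _ _ _ _ [set w | L k w < S k * (n%:R - 2 * (Num.sqrt n%:R * Num.sqrt x))]).
    exact: measurable_lt_set.
  exact: (linform_lower iX (kv k) p n x0).
have e0 : 0 <= 2 * expR (- x) by rewrite mulr_ge0// expR_ge0.
have hl := @likely_forall_fin _ _ _ P _ (fun k : {ffun 'I_p -> 'I_(D + D.+1)} =>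
   (\sum_i `|netval (k i)|%N <= D)%N) _ _ _ (fun k _ => h1 k) e0 (net_count R p).
apply: (likely_sub hl).
  by rewrite mulrCA -expRD /x opprD addNKr.
move=> w hw h.
have sM : (gram n p w - n%:R%:M)^T = gram n p w - n%:R%:M.
  rewrite linearB/= tr_scalar_mx; congr (_ - _).
  by apply/matrixP => k l; rewrite !mxE; apply: eq_bigr => i _; rewrite mulrC.
have ME (f : 'cV[R]_p) : vdot f ((gram n p w - n%:R%:M) *m f) = vdot f (gram n p w *m f) - n%:R * vdot f f.
  by rewrite mulmxBl mul_scalar_mx vdotBr vdotZr.
rewrite -ME; apply: net_quadratic => // k kD; rewrite ME.
have kb i : (`|k i| <= D)%N.
  by apply: leq_trans kD; rewrite (bigD1 i)//= leq_addr.
have kd i : (absz (k i + D%:Z)%R < D + D.+1)%N by have := kb i; lia.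
pose k' : {ffun 'I_p -> 'I_(D + D.+1)} := [ffun i => Ordinal (kd i)].
have k'E i : netval (k' i) = k i.
  by rewrite /netval ffunE /=; have := kb i; lia.
have ck' : (\sum_i `|netval (k' i)|%N <= D)%N by under eq_bigr do rewrite k'E.
have [hU hLw] := hw k' ck'.
have SE : S k' = vdot (intvec R k) (intvec R k).
  by apply: eq_bigr => l _; rewrite kvE k'E mxE expr2.
have LE : L k' w = vdot (intvec R k) (gram n p w *m intvec R k).
  rewrite vdot_gram; apply: eq_bigr => i _; rewrite expr2.
  by congr (_ * _); apply: eq_bigr => l _; rewrite kvE k'E mxE.
rewrite -SE -LE; move/negP: hU; move/negP: hLw; rewrite -!leNgt => hlow hup.
have S0 : 0 <= S k' by rewrite SE vdot_ge0.
have Sx : 0 <= S k' * x by rewrite mulr_ge0.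
rewrite ler_norml; apply/andP; split.
  apply: le_trans (lerB hlow (lexx _)); rewrite -subr_ge0.
  rewrite (_ : _ - _ = 2 * (S k' * x)); first by rewrite mulr_ge0.
  ring.
apply: le_trans (lerB hup (lexx _)) _; rewrite -subr_ge0.
rewrite (_ : _ - _ = 0)//; ring.
Qed.

End noise.

(** * Deterministic perturbation of the leading eigenvector *)

Section perturbation.
Context (R : realType) (T : Type) (p m n : nat) (rho : nat -> 'cV[R]_p) (sigma : R)
  (v z : nat -> nat -> T -> R) (w : T).

(** Empirical inner product over the sample. It makes the form of [S] the Gram form of the
    projections [xcomb], and the columns [vcol j] are nearly orthonormal for it. *)
Definition ip (f g : nat -> R) : R := (n%:R)^-1 * \sum_(i < n) f i * g i.
Definition vcol (j : nat) : nat -> R := fun i => v i j w.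
Definition zcomb (h : 'cV[R]_p) : nat -> R := fun i => vdot h (\col_k z i k w).
Definition xcomb (h : 'cV[R]_p) : nat -> R := fun i => vdot h (obs rho m sigma v z i w).

Local Notation S := (sample_cov n rho m sigma v z w).

Lemma ipC f g : ip f g = ip g f.
Proof. by congr (_ * _); apply: eq_bigr => i _; rewrite mulrC. Qed.

Lemma ipDl f f' g : ip (fun i => f i + f' i) g = ip f g + ip f' g.
Proof. by rewrite /ip -mulrDr -big_split; congr (_ * _); apply: eq_bigr => i _; rewrite mulrDl. Qed.

Lemma ipZl (c : R) f g : ip (fun i => c * f i) g = c * ip f g.
Proof. by rewrite /ip mulrCA; congr (_ * _); rewrite mulr_sumr; apply: eq_bigr => i _; rewrite mulrA. Qed.

Lemma ip_suml (F : 'I_m -> nat -> R) g :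
  ip (fun i => \sum_(j < m) F j i) g = \sum_(j < m) ip (F j) g.
Proof.
rewrite /ip -mulr_sumr exchange_big/=; congr (_ * _); apply: eq_bigr => i _.
by rewrite mulr_suml.
Qed.

Lemma sample_cov_sym : S^T = S.
Proof.
rewrite /sample_cov linearZ/=; congr (_ *: _); rewrite linear_sum/=.
by apply: eq_bigr => i _; rewrite trmx_mul trmxK.
Qed.

Lemma vdot_sample_cov h g : vdot h (S *m g) = ip (xcomb h) (xcomb g).
Proof.
have xx (x : 'cV[R]_p) : x *m x^T *m g = vdot x g *: x.
  rewrite -mulmxA (_ : x^T *m g = (vdot x g)%:M) ?mul_mx_scalar//.
  apply/matrixP => a b; rewrite !mxE !ord1 eqxx mulr1n; apply: eq_bigr => k _.
  by rewrite mxE.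
rewrite /sample_cov -scalemxAl vdotZr mulmx_suml vdot_sumr /ip; congr (_ * _).
by apply: eq_bigr => i _; rewrite xx vdotZr mulrC (vdotC _ g).
Qed.

Lemma xcombE h i : xcomb h i = \sum_(j < m) vdot h (rho j) * vcol j i + sigma * zcomb h i.
Proof.
rewrite /xcomb /obs vdotDr vdotZr vdot_sumr; congr (_ + _).
by apply: eq_bigr => j _; rewrite vdotZr mulrC.
Qed.

Lemma ip_xcomb h f : ip (xcomb h) f =
  \sum_(j < m) vdot h (rho j) * ip (vcol j) f + sigma * ip (zcomb h) f.
Proof.
rewrite (_ : xcomb h = fun i => \sum_(j < m) (vdot h (rho j) * vcol j i) + sigma * zcomb h i).
  rewrite ipDl ipZl ip_suml; congr (_ + _).
  by apply: eq_bigr => j _; rewrite ipZl.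
by apply/funext => i; rewrite xcombE.
Qed.

Lemma quad_expand h g : vdot h (S *m g) =
  \sum_(j < m) vdot h (rho j) * (\sum_(k < m) vdot g (rho k) * ip (vcol j) (vcol k)) +
  sigma * (\sum_(j < m) vdot h (rho j) * ip (vcol j) (zcomb g)) +
  sigma * (\sum_(j < m) vdot g (rho j) * ip (vcol j) (zcomb h)) +
  sigma ^+ 2 * ip (zcomb h) (zcomb g).
Proof.
rewrite vdot_sample_cov ip_xcomb.
have -> : \sum_(j < m) vdot h (rho j) * ip (vcol j) (xcomb g) =
  \sum_(j < m) vdot h (rho j) * (\sum_(k < m) vdot g (rho k) * ip (vcol j) (vcol k)) +
  sigma * (\sum_(j < m) vdot h (rho j) * ip (vcol j) (zcomb g)).
  rewrite mulr_sumr -big_split; apply: eq_bigr => j _; rewrite /= ipC ip_xcomb ipC mulrDr.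
  congr (_ * _ + _); last by ring.
  by apply: eq_bigr => k _; rewrite ipC.
rewrite (ipC (zcomb h)) ip_xcomb mulrDr -!addrA; congr (_ + (_ + (_ + _))).
by rewrite mulrA -expr2 ipC.
Qed.

Let r (j : nat) := vnorm (rho j).
Let a := \sum_(j < m) r j.

Lemma sum_vnorm_ge0 : 0 <= a. Proof. by apply: sumr_ge0 => j _; exact: vnorm_ge0. Qed.

Lemma wsum_bound (h : 'cV[R]_p) (c : 'I_m -> R) (e : R) :
  (forall j, `|c j| <= e) -> `|\sum_(j < m) vdot h (rho j) * c j| <= vnorm h * e * a.
Proof.
move=> ce; apply: (le_trans (ler_norm_sum _ _ _)); rewrite mulr_sumr; apply: ler_sum => j _.
rewrite normrM mulrAC; apply: ler_pM => //; exact: vdot_cauchy.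
Qed.

Lemma wsum_bound_perp (h : 'cV[R]_p) (c : 'I_m -> R) (e : R) : (0 < m)%N ->
  vdot h (rho 0) = 0 ->
  (forall j, `|c j| <= e) -> `|\sum_(j < m) vdot h (rho j) * c j| <= vnorm h * e * (a - r 0).
Proof.
move=> m0 h0 ce; rewrite (bigD1 (Ordinal m0))//= h0 mul0r add0r.
have -> : a - r 0 = \sum_(j < m | j != Ordinal m0) r j.
  by rewrite /a (bigD1 (Ordinal m0))//= addrAC subrr add0r.
rewrite mulr_sumr.
apply: (le_trans (ler_norm_sum _ _ _)); apply: ler_sum => j _.
rewrite normrM mulrAC; apply: ler_pM => //; exact: vdot_cauchy.
Qed.

Variable eta : R.
Hypothesis eta0 : 0 <= eta.
Hypothesis Vorth : forall j k, (j < m)%N -> (k < m)%N ->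
  `|ip (vcol j) (vcol k) - (j == k)%:R| <= eta.

Lemma vv_bound h g :
  `|\sum_(j < m) vdot h (rho j) * (\sum_(k < m) vdot g (rho k) * ip (vcol j) (vcol k)) -
    \sum_(j < m) vdot h (rho j) * vdot g (rho j)| <= eta * a ^+ 2 * (vnorm h * vnorm g).
Proof.
rewrite -sumrB.
rewrite (eq_bigr (fun j : 'I_m => vdot h (rho j) *
  (\sum_(k < m) vdot g (rho k) * (ip (vcol j) (vcol k) - ((j : nat) == k)%:R)))); last first.
  move=> j _; rewrite -mulrBr; congr (_ * _).
  rewrite [in RHS](eq_bigr (fun k : 'I_m => vdot g (rho k) * ip (vcol j) (vcol k) -
    vdot g (rho k) * ((j : nat) == k)%:R)); last by move=> k _; rewrite mulrBr.
  rewrite [RHS]sumrB; congr (_ - _); rewrite (bigD1 j)//= eqxx mulr1 big1 ?addr0//.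
  by move=> k kj; rewrite (_ : (_ == _) = false) ?mulr0//; apply/negbTE; rewrite eq_sym.
apply: (le_trans (wsum_bound h (fun j => _) (e := vnorm g * eta * a))).
  by move=> j; apply: wsum_bound => k; exact: Vorth.
by rewrite le_eqVlt; apply/orP; left; apply/eqP; ring.
Qed.

Hypothesis m0 : (0 < m)%N.
Hypothesis rho0 : 0 < r 0.
Hypothesis orth : forall j k, (j < m)%N -> (k < m)%N -> j <> k -> vdot (rho j) (rho k) = 0.
Hypothesis sigma0 : 0 < sigma.
Variables (B beta r2 : R).
Variable q : 'cV[R]_p.
Hypothesis rho0E : rho 0 = r 0 *: q.
Hypothesis qq : vdot q q = 1.
Hypothesis Zq1 : `|ip (zcomb q) (zcomb q) - 1| <= eta.
Hypothesis VZq : forall j, (j < m)%N -> `|ip (vcol j) (zcomb q)| <= eta.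
Hypothesis VZ : forall j h, (j < m)%N -> `|ip (vcol j) (zcomb h)| <= B * vnorm h.
(** Restricted to the complement of [q]: at [h = q] the product is close to one by [Zq1], whereas
    [B] is meant to be of the order of [s]. *)
Hypothesis Zqperp : forall h, vdot h q = 0 -> `|ip (zcomb q) (zcomb h)| <= B * vnorm h.
Hypothesis ZZ : forall h, `|ip (zcomb h) (zcomb h) - vdot h h| <= beta * vdot h h.
Hypothesis r2P : forall j, (0 < j < m)%N -> r j <= r2.
Hypothesis r20 : 0 <= r2.

Let vnorm_q : vnorm q = 1. Proof. by rewrite /vnorm qq sqrtr1. Qed.

Lemma vdotq_rho (j : 'I_m) : vdot q (rho j) = if j == Ordinal m0 then r 0 else 0.
Proof.
case: eqP => [->|j0] /=.
  by rewrite rho0E vdotZr qq mulr1.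
apply: (mulfI (lt0r_neq0 rho0)); rewrite -vdotZl -rho0E mulr0 orth// => j00.
by apply: j0; apply/val_inj.
Qed.

Lemma sum_vdotq (c : 'I_m -> R) : \sum_(j < m) vdot q (rho j) * c j = r 0 * c (Ordinal m0).
Proof.
rewrite (bigD1 (Ordinal m0))// vdotq_rho eqxx big1 => [|j /negbTE j0].
  by rewrite /= addr0.
by rewrite vdotq_rho j0 mul0r.
Qed.

(** With [s] the left side, [vdot h u = s] while the squared norm of [u] is at most [r2 ^+ 2 * s],
    the first component being absent; Cauchy-Schwarz between [h] and [u] concludes after division by
    [s]. *)
Lemma bessel h : vdot h q = 0 -> \sum_(j < m) vdot h (rho j) * vdot h (rho j) <= r2 ^+ 2 * vdot h h.
Proof.
move=> hq; have h0 : vdot h (rho 0) = 0 by rewrite rho0E vdotZr hq mulr0.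
set s := \sum_(j < m) _.
pose u := \sum_(j < m) vdot h (rho j) *: rho j.
have hu : vdot h u = s by rewrite vdot_sumr; apply: eq_bigr => j _; rewrite vdotZr.
have uu : vdot u u <= r2 ^+ 2 * s.
  rewrite {1}/u vdot_suml mulr_sumr; apply: ler_sum => j _; rewrite vdotZl.
  have -> : vdot (rho j) u = vdot h (rho j) * r j ^+ 2.
    rewrite vdot_sumr (bigD1 j)//= vdotZr sqr_vnorm big1 ?addr0// => k kj.
    rewrite vdotZr orth ?mulr0// => jk; move/eqP: kj; apply; exact/esym/val_inj.
  rewrite mulrA mulrC; have [j0|j0] := eqVneq (nat_of_ord j) 0%N.
    by rewrite j0 h0 !mulr0.
  rewrite -expr2 ler_wpM2r ?sqr_ge0// lerXn2r ?nnegrE ?vnorm_ge0//.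
  by apply: r2P; rewrite lt0n j0 ltn_ord.
have s0 : 0 <= s by apply: sumr_ge0 => j _; rewrite -expr2 sqr_ge0.
move: s0; rewrite le_eqVlt => /orP[/eqP <-|s0]; first by rewrite mulr_ge0 ?sqr_ge0 ?vdot_ge0.
have := vdot_cauchy_sqr h u; rewrite hu => /le_trans/(_ (ler_wpM2l (vdot_ge0 h) uu)).
by rewrite (_ : vdot h h * (r2 ^+ 2 * s) = r2 ^+ 2 * vdot h h * s) ?expr2 ?ler_pM2r//; ring.
Qed.

Lemma quad_qq_ge :
  r 0 ^+ 2 - eta * a ^+ 2 - 2 * sigma * r 0 * eta + sigma ^+ 2 * (1 - eta) <= vdot q (S *m q).
Proof.
rewrite quad_expand.
have h1 := vv_bound q q; rewrite (sum_vdotq (fun j => vdot q (rho j))) in h1.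
rewrite vdotq_rho eqxx vnorm_q !mulr1 -expr2 in h1.
rewrite !(sum_vdotq (fun j => ip (vcol j) (zcomb q)))/=.
have h2 := VZq m0; have r0 := ltW rho0.
move: h1; set V := \sum_(j < m) _; rewrite ler_norml => /andP[h1 _].
have h3 : - (r 0 * eta) <= r 0 * ip (vcol 0) (zcomb q).
  by rewrite -mulrN ler_wpM2l//; move: h2; rewrite ler_norml => /andP[].
have h4 : sigma * - (r 0 * eta) <= sigma * (r 0 * ip (vcol 0) (zcomb q)).
  by rewrite ler_wpM2l// ltW.
have h5 : sigma ^+ 2 * (1 - eta) <= sigma ^+ 2 * ip (zcomb q) (zcomb q).
  by rewrite ler_wpM2l ?sqr_ge0//; move: Zq1; rewrite ler_norml => /andP[+ _]; lra.
by lra.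
Qed.

(** Orthogonality removes the signal. There remain [sigma * r 0 * B] from noise against the first
    factor and [sigma ^+ 2 * B] from noise against noise; the other terms carry [eta]. *)
Lemma quad_qy_le h : vdot h q = 0 ->
  `|vdot q (S *m h)| <= vnorm h * (eta * a ^+ 2 + sigma * r 0 * B + sigma * a * eta + sigma ^+ 2 * B).
Proof.
move=> hq; have h0 : vdot h (rho 0) = 0 by rewrite rho0E vdotZr hq mulr0.
rewrite quad_expand.
have h1 := vv_bound q h.
rewrite (sum_vdotq (fun j => vdot h (rho j))) h0 mulr0 subr0 vnorm_q mul1r in h1.
rewrite (sum_vdotq (fun j => ip (vcol j) (zcomb h)))/=.
have h2 := VZ h m0.
have h3 := wsum_bound h (fun j : 'I_m => VZq (ltn_ord j)).
have h4 := Zqperp hq.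
have s0 := ltW sigma0; have r0 := ltW rho0.
apply: (le_trans (ler_normD _ _)); apply: (le_trans (lerD (ler_normD _ _) (lexx _))).
apply: (le_trans (lerD (lerD (ler_normD _ _) (lexx _)) (lexx _))).
have h2' : `|sigma * (r 0 * ip (vcol 0) (zcomb h))| <= sigma * (r 0 * (B * vnorm h)).
  by rewrite normrM (ger0_norm s0) normrM (ger0_norm r0) !ler_wpM2l.
have h3' : `|sigma * (\sum_(j < m) vdot h (rho j) * ip (vcol j) (zcomb q))| <=
    sigma * (vnorm h * eta * a).
  by rewrite normrM (ger0_norm s0) ler_wpM2l.
have h4' : `|sigma ^+ 2 * ip (zcomb q) (zcomb h)| <= sigma ^+ 2 * (B * vnorm h).
  by rewrite normrM (ger0_norm (sqr_ge0 sigma)) ler_wpM2l ?sqr_ge0.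
by apply: (le_trans (lerD (lerD (lerD h1 h2') h3') h4')); rewrite le_eqVlt; apply/orP; left; apply/eqP; ring.
Qed.

Lemma quad_hh_le h : vdot h (S *m h) <= \sum_(j < m) vdot h (rho j) * vdot h (rho j) +
  eta * a ^+ 2 * vdot h h + 2 * sigma * `|\sum_(j < m) vdot h (rho j) * ip (vcol j) (zcomb h)|
  + sigma ^+ 2 * (1 + beta) * vdot h h.
Proof.
rewrite quad_expand.
have h1 := vv_bound h h; rewrite -expr2 sqr_vnorm in h1.
have s0 := ltW sigma0.
have h2 := ler_wpM2l s0 (ler_norm (\sum_(j < m) vdot h (rho j) * ip (vcol j) (zcomb h))).
have h3 : sigma ^+ 2 * ip (zcomb h) (zcomb h) <= sigma ^+ 2 * ((1 + beta) * vdot h h).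
  by rewrite ler_wpM2l ?sqr_ge0//; have := ZZ h; rewrite ler_norml => /andP[_]; lra.
move: h1; set V := \sum_(j < m) _; rewrite ler_norml => /andP[_ h1].
by lra.
Qed.

(** A direction orthogonal to [q] does not see the first component, so the cross term costs
    [a - r 0] instead of [a]; the constants of [limit_gap_bound] use this saving. *)
Lemma quad_yy_le h : vdot h q = 0 -> 0 <= B ->
  vdot h (S *m h) <= vdot h h * (r2 ^+ 2 + eta * a ^+ 2 + 2 * sigma * (a - r 0) * B + sigma ^+ 2 * (1 + beta)).
Proof.
move=> hq B0; have h0 : vdot h (rho 0) = 0 by rewrite rho0E vdotZr hq mulr0.
apply: (le_trans (quad_hh_le h)).
have h1 := bessel hq.
have h2 := wsum_bound_perp m0 h0 (fun j : 'I_m => VZ h (ltn_ord j)).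
have s0 : 0 <= 2 * sigma by rewrite mulr_ge0// ltW.
have h3 := ler_wpM2l s0 h2.
rewrite (_ : vnorm h * (B * vnorm h) * (a - r 0) = vdot h h * (B * (a - r 0))) in h3; last first.
  by rewrite -sqr_vnorm; ring.
by lra.
Qed.

(* The gap times the squared sine is at most the variation of the quadratic form of the
   perturbation between [q] and the top eigenvector. *)
Lemma sin_bound (u : 'cV[R]_p) : 0 <= B -> vdot u u = 1 ->
  vdot q (S *m q) <= vdot u (S *m u) ->
  vnorm (u - vdot u q *: q) *
    (r 0 ^+ 2 - r2 ^+ 2 - eta * (2 * a ^+ 2 + 2 * sigma * r 0 + sigma ^+ 2)
     - 2 * sigma * (a - r 0) * B - sigma ^+ 2 * beta)
  <= 2 * sigma * B * (r 0 + sigma) + 2 * eta * a * (a + sigma).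
Proof.
move=> B0 u1 qu; set g := vdot u q.
have [y yE] : exists y, y = u - g *: q by eexists.
rewrite -yE; set x := vnorm y.
have s0 := ltW sigma0; have r0 := ltW rho0; have a0 := sum_vnorm_ge0.
have yq : vdot y q = 0 by rewrite yE vdotBl vdotZl qq mulr1 subrr.
have x2 : x ^+ 2 = 1 - g ^+ 2.
  rewrite sqr_vnorm {1}yE vdotBl vdotZl (vdotC q) yq mulr0 subr0.
  by rewrite yE vdotBr u1 vdotZr -/g -expr2.
have g1 : `|g| <= 1.
  by have := vdot_cauchy u q; rewrite vnorm_q mulr1 /vnorm u1 sqrtr1.
have uE : u = g *: q + y by rewrite yE addrC subrK.
have Suu : vdot u (S *m u) = g ^+ 2 * vdot q (S *m q) + 2 * g * vdot q (S *m y) + vdot y (S *m y).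
  rewrite uE mulmxDr -scalemxAr !(vdotDl, vdotDr, vdotZl, vdotZr).
  rewrite (_ : vdot y (S *m q) = vdot q (S *m y)); last by rewrite vdot_mulmx sample_cov_sym vdotC.
  ring.
have h1 := quad_qq_ge; have h2 := quad_qy_le yq; have h3 := quad_yy_le yq B0.
rewrite -/x in h2; rewrite -sqr_vnorm -/x in h3.
have x0 : 0 <= x by exact: vnorm_ge0.
set D := eta * a ^+ 2 + sigma * r 0 * B + sigma * a * eta + sigma ^+ 2 * B in h2.
have gqy : g * vdot q (S *m y) <= x * D.
  apply: le_trans (ler_norm _) _; rewrite normrM; apply: le_trans h2.
  by rewrite ler_piMl.
(* Inserts [u = g *: q + y] into the comparison of Rayleigh quotients, with [1 - g ^+ 2 = x ^+ 2].
   The last term is quadratic in [x], so dividing by [x] leaves a bound linear in the sine. *)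
have key : x ^+ 2 * vdot q (S *m q) <= 2 * (x * D) + vdot y (S *m y).
  have -> : x ^+ 2 * vdot q (S *m q) = vdot q (S *m q) - g ^+ 2 * vdot q (S *m q).
    by rewrite x2; ring.
  by rewrite lerBlDr; apply: le_trans qu _; rewrite Suu; lra.
have h1' := ler_wpM2l (sqr_ge0 x) h1.
move: x0; rewrite le_eqVlt => /orP[/eqP <-|x0].
  rewrite mul0r addr_ge0// !mulr_ge0// ?addr_ge0//.
rewrite -(ler_pM2l x0).
have D2 : 2 * sigma * B * (r 0 + sigma) + 2 * eta * a * (a + sigma) = 2 * D.
  by rewrite /D; ring.
rewrite D2; move: h1' key h3; set Q := vdot q _; set Y := vdot y _; rewrite !mulrA -!expr2; nra.
Qed.

Lemma top_value_le (u : 'cV[R]_p) : 0 <= B -> vdot u u = 1 ->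
  vdot u (S *m u) <= (1 + eta) * a ^+ 2 + 2 * sigma * a * B + sigma ^+ 2 * (1 + beta).
Proof.
move=> B0 u1; apply: (le_trans (quad_hh_le u)); rewrite u1 !mulr1.
have u1' : vnorm u = 1 by rewrite /vnorm u1 sqrtr1.
have s0 := ltW sigma0.
have h2 := wsum_bound u (fun j : 'I_m => VZ u (ltn_ord j)).
have h1 : `|\sum_(j < m) vdot u (rho j) * vdot u (rho j)| <= vnorm u * a * a.
  apply: wsum_bound => j; apply: le_trans (vdot_cauchy _ _) _; rewrite u1' mul1r.
  by rewrite /a (bigD1 j)//= lerDl sumr_ge0// => k _; exact: vnorm_ge0.
have h1' := le_trans (ler_norm _) h1.
rewrite u1' !mulr1 !mul1r in h2 h1'.
have h3 := ler_wpM2l (_ : 0 <= 2 * sigma) h2.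
have {}h3 := h3 (mulr_ge0 (ler0n _ _) s0).
by rewrite mulrDl mul1r -!expr2 in h1' *; lra.
Qed.

(** The eigenvector equation is tested against [y0], orthogonal to [q]: [g * vdot y0 (S *m q) = lam
    * vdot y0 y - vdot y0 (S *m y)]. As [S] lies between [0] and [lam], both terms on the right are
    at most [lam * x], while [vdot y0 (S *m q)] is at least about [sigma * kappa]. *)
Lemma sin_lower_bound (u y0 : 'cV[R]_p) (kappa : R) :
  0 <= B -> vdot u u = 1 -> S *m u = vdot u (S *m u) *: u ->
  (forall h, vdot h (S *m h) <= vdot u (S *m u) * vdot h h) ->
  vdot y0 q = 0 -> vdot y0 y0 = 1 -> kappa <= ip (xcomb q) (zcomb y0) ->
  `|vdot u q| * (sigma * kappa - eta * a * (a + sigma)) <=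
  2 * ((1 + eta) * a ^+ 2 + 2 * sigma * a * B + sigma ^+ 2 * (1 + beta)) *
    vnorm (u - vdot u q *: q).
Proof.
move=> B0 u1 Su top yq0 y01 kap; set g := vdot u q.
have [y yE] : exists y, y = u - g *: q by eexists.
rewrite -yE; set x := vnorm y.
have s0 := ltW sigma0; have a0 := sum_vnorm_ge0.
have y0n : vnorm y0 = 1 by rewrite /vnorm y01 sqrtr1.
have y00 : vdot y0 (rho 0) = 0 by rewrite rho0E vdotZr yq0 mulr0.
set lam := vdot u (S *m u) in Su top *.
have lamL := top_value_le B0 u1; rewrite -/lam in lamL.
set L := (1 + eta) * _ + _ + _ in lamL *.
have psd h : 0 <= vdot h (S *m h).
  rewrite vdot_sample_cov mulr_ge0 ?invr_ge0// sumr_ge0// => i _.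
  by rewrite -expr2 sqr_ge0.
have lam0 : 0 <= lam by exact: psd.
have low : sigma * kappa - eta * a * (a + sigma) <= vdot y0 (S *m q).
  rewrite quad_expand.
  have h1 := vv_bound y0 q; rewrite vnorm_q y0n !mulr1 in h1.
  rewrite (eq_bigr (fun j : 'I_m => vdot q (rho j) * vdot y0 (rho j)) (F1 := fun j : 'I_m => vdot y0 (rho j) * vdot q (rho j))) in h1; last first.
    by move=> j _; rewrite mulrC.
  rewrite (sum_vdotq (fun j => vdot y0 (rho j))) y00 mulr0 subr0 in h1.
  have h2 := wsum_bound y0 (fun j : 'I_m => VZq (ltn_ord j)); rewrite y0n mul1r in h2.
  have := ler_wpM2l s0 kap; rewrite ip_xcomb (ipC (zcomb y0)).
  move: h1 h2; rewrite !ler_norml => /andP[h1 _] /andP[h2 _].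
  have h2' := ler_wpM2l s0 h2.
  by move: h1 h2'; set s1 := \sum_(j < m) _; set s2 := \sum_(j < m) _; set s3 := \sum_(j < m) _; nra.
have uE : u = g *: q + y by rewrite yE addrC subrK.
have eqn : g * vdot y0 (S *m q) = lam * vdot y0 y - vdot y0 (S *m y).
  have : vdot y0 (S *m u) = lam * vdot y0 u by rewrite Su vdotZr.
  rewrite [in LHS]uE [in RHS]uE mulmxDr -scalemxAr !(vdotDr, vdotZr) yq0 mulr0 add0r.
  by move=> <-; rewrite addrK.
have b1 : `|vdot y0 y| <= x by have := vdot_cauchy y0 y; rewrite y0n mul1r.
have b2 : `|vdot y0 (S *m y)| <= lam * x.
  rewrite -(ler_pXn2r (ltn0Sn 1)) ?nnegrE ?mulr_ge0 ?vnorm_ge0// real_normK ?num_real//.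
  apply: (le_trans (psd_cauchy y0 y sample_cov_sym psd)).
  have t1 := top y0; rewrite y01 mulr1 in t1.
  by rewrite exprMn sqr_vnorm expr2 -mulrA; apply: ler_pM.
have x0 : 0 <= x by exact: vnorm_ge0.
have up : `|g * vdot y0 (S *m q)| <= 2 * L * x.
  rewrite eqn; apply: (le_trans (ler_normB _ _)); rewrite normrM (ger0_norm lam0).
  apply: (@le_trans _ _ (lam * x + lam * x)); first by rewrite lerD// ler_wpM2l.
  by have h := ler_wpM2r x0 lamL; rewrite -mulrA mulr_natl mulr2n lerD.
apply: le_trans up; rewrite normrM ler_wpM2l//.
by apply: le_trans low _; exact: ler_norm.
Qed.

End perturbation.

(** * Probability that a sample is good *)

Section good_events.
Context (R : realType) d (T : measurableType d) (P : probability T R).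
Variables (v z : nat -> nat -> T -> R).
Hypothesis iX : iid_std_normal P (join_arrays v z).
Variables (n p : nat) (eta : R).
Hypotheses (n0 : (0 < n)%N) (p0 : (0 < p)%N) (eta0 : 0 < eta) (eta1 : eta <= 1).
(** At the level [x = n e], the root of [n x] is [n eta / 4], so the chi-square deviation is at most
    [n (eta / 2 + eta^2 / 8)], within [n eta], while the failure probability stays exponentially
    small in [n]. *)
Let e := eta ^+ 2 / 16.
Let x := n%:R * e.
Hypothesis x1 : 1 <= x.
Let s := Num.sqrt (p%:R / n%:R) : R.
Let B := (1 + eta) * (s + eta).

Let X := join_arrays v z.
Let mX i : measurable_fun setT (X i). Proof. by have [] := iX. Qed.
Let nR0 : 0 < n%:R :> R. Proof. by rewrite ltr0n. Qed.
Let x0 : 0 <= x. Proof. exact: le_trans x1. Qed.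
Let s0 : 0 <= s. Proof. exact: sqrtr_ge0. Qed.
Let sx : Num.sqrt x = Num.sqrt n%:R * (eta / 4).
Proof.
rewrite sqrtrM ?ler0n// /e (_ : 16 = 4 ^+ 2); last by rewrite expr2; ring.
by rewrite -expr_div_n sqrtr_sqr ger0_norm// divr_ge0// ltW.
Qed.
Let snn : Num.sqrt n%:R * Num.sqrt n%:R = n%:R :> R.
Proof. by rewrite -expr2 sqr_sqrtr. Qed.
Let sp : Num.sqrt p%:R = Num.sqrt n%:R * s.
Proof. by rewrite -sqrtrM// mulrCA divff ?mulr1// gt_eqF. Qed.
Let s2 : p%:R = n%:R * s ^+ 2.
Proof. by rewrite sqr_sqrtr ?divr_ge0// mulrCA divff ?mulr1// gt_eqF. Qed.

Let dev : 2 * (Num.sqrt n%:R * Num.sqrt x) + 2 * x <= n%:R * eta.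
Proof.
rewrite sx (_ : Num.sqrt n%:R * (Num.sqrt n%:R * (eta / 4)) =
  Num.sqrt n%:R * Num.sqrt n%:R * (eta / 4)); last by ring.
rewrite snn /x /e -subr_ge0.
rewrite (_ : _ - _ = n%:R * (eta * (4 - eta)) / 8); last by field.
by rewrite divr_ge0// mulr_ge0// ?ler0n// mulr_ge0 ?(ltW eta0)//; move: eta1; lra.
Qed.

Let concentrate (S : R) :
  ~ (n%:R + 2 * (Num.sqrt n%:R * Num.sqrt x) + 2 * x < S) ->
  ~ (S < n%:R - 2 * (Num.sqrt n%:R * Num.sqrt x)) ->
  `|(n%:R)^-1 * S - 1| <= eta.
Proof.
move=> /negP; rewrite -leNgt => h1 /negP; rewrite -leNgt => h2.
have -> : (n%:R)^-1 * S - 1 = (S - n%:R) / n%:R.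
  by rewrite mulrBl divff ?gt_eqF// mulrC.
rewrite normrM normfV (ger0_norm (ltW nR0)) ler_pdivrMr// [eta * _]mulrC.
apply: le_trans dev; rewrite ler_norml; apply/andP; split; last by lra.
have h3 : 0 <= 2 * x by rewrite mulr_ge0.
by move: h1 h2 h3; lra.
Qed.

Lemma vcol_norm_likely (j : nat) :
  likely P (fun w => `|ip n (vcol v w j) (vcol v w j) - 1| <= eta) (2 * expR (- x)).
Proof.
have hI : injective (fun i : nat => inl (i, j) : (nat * nat + nat * nat)%type) by move=> i k [].
have iY := iid_reindex iX hI.
rewrite (_ : 2 * expR (- x) = expR (- x) + expR (- x)); last by ring.
pose S w := \sum_(i < n) v i j w ^+ 2.
have mS : measurable_fun setT S.
  by apply: measurable_sum => i; apply: measurable_funX; exact: (mX (inl (nat_of_ord i, j))).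
have h1 : likely P (fun w => ~ (n%:R + 2 * (Num.sqrt n%:R * Num.sqrt x) + 2 * x < S w)) (expR (- x)).
  apply: (@likely_not _ _ _ _ [set w | n%:R + 2 * (Num.sqrt n%:R * Num.sqrt x) + 2 * x < S w]).
    exact: measurable_lt_set.
  exact: (chi_square_upper iY n x0).
have h2 : likely P (fun w => ~ (S w < n%:R - 2 * (Num.sqrt n%:R * Num.sqrt x))) (expR (- x)).
  apply: (@likely_not _ _ _ _ [set w | S w < n%:R - 2 * (Num.sqrt n%:R * Num.sqrt x)]).
    exact: measurable_lt_set.
  exact: (chi_square_lower iY n x0).
apply: (likely_sub (likely_and h1 h2)) => // w [h3 h4].
rewrite /ip (eq_bigr (fun i : 'I_n => v i j w ^+ 2)); last by move=> i _; rewrite expr2.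
exact: concentrate.
Qed.

Lemma zcomb_norm_likely (q : 'cV[R]_p) : vdot q q = 1 ->
  likely P (fun w => `|ip n (zcomb z w q) (zcomb z w q) - 1| <= eta) (2 * expR (- x)).
Proof.
move=> q1; pose a (l : nat) : R := if insub l is Some i then q i 0 else 0.
have aE (i : 'I_p) : a i = q i 0 by rewrite /a valK.
have a1 : \sum_(i < p) a i ^+ 2 = 1.
  by rewrite -q1; apply: eq_bigr => i _; rewrite aE expr2.
rewrite (_ : 2 * expR (- x) = expR (- x) + expR (- x)); last by ring.
pose S w := \sum_(i < n) (\sum_(l < p) a l * X (inr (nat_of_ord i, nat_of_ord l)) w) ^+ 2.
have mS : measurable_fun setT S.
  apply: measurable_sum => i; apply: measurable_funX; apply: measurable_sum => l.
  exact: measurable_funM.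
have h1 : likely P (fun w => ~ (n%:R + 2 * (Num.sqrt n%:R * Num.sqrt x) + 2 * x < S w)) (expR (- x)).
  apply: (@likely_not _ _ _ _ [set w | n%:R + 2 * (Num.sqrt n%:R * Num.sqrt x) + 2 * x < S w]).
    exact: measurable_lt_set.
  by have := linform_upper iX a p n x0; rewrite a1 mul1r.
have h2 : likely P (fun w => ~ (S w < n%:R - 2 * (Num.sqrt n%:R * Num.sqrt x))) (expR (- x)).
  apply: (@likely_not _ _ _ _ [set w | S w < n%:R - 2 * (Num.sqrt n%:R * Num.sqrt x)]).
    exact: measurable_lt_set.
  by have := linform_lower iX a p n x0; rewrite a1 mul1r.
apply: (likely_sub (likely_and h1 h2)) => // w [h3 h4].
rewrite /ip (_ : \sum_(i < n) _ = S w); first exact: concentrate.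
apply: eq_bigr => i _; rewrite expr2 /zcomb.
by congr (_ * _); apply: eq_bigr => l _; rewrite mxE aE.
Qed.

(** The second hypothesis is the complement of a tail event with one degree of freedom, given [g].
    The squared norm of [g] is at most [2 n] and, as [1 <= x], the last factor is at most [5 x]; so
    the squared product is at most [10 * e = 5 / 8 * eta ^+ 2]. *)
Let small_ip (f g : nat -> R) : `|ip n g g - 1| <= eta ->
  (\sum_(i < n) g i * f i) ^+ 2 <=
    (\sum_(i < n) g i ^+ 2) * (1%:R + 2 * (Num.sqrt 1%:R * Num.sqrt x) + 2 * x) ->
  `|ip n f g| <= eta.
Proof.
move=> g1 h.
have G : \sum_(i < n) g i ^+ 2 <= n%:R * 2.
  have : ip n g g <= 2 by move: g1; rewrite ler_norml => /andP[_]; move: eta1; lra.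
  by rewrite /ip mulrC ler_pdivrMr// mulrC (eq_bigr (fun i : 'I_n => g i ^+ 2)).
have sqx : Num.sqrt x <= x.
  by rewrite -{2}[x]sqr_sqrtr// expr2 ler_peMl ?sqrtr_ge0// -sqrtr1 ler_sqrt.
have tail : 1%:R + 2 * (Num.sqrt 1%:R * Num.sqrt x) + 2 * x <= 5 * x.
  by rewrite sqrtr1 mul1r; move: sqx x1; lra.
have G0 : 0 <= \sum_(i < n) g i ^+ 2 by apply: sumr_ge0 => i _; exact: sqr_ge0.
have h' : (\sum_(i < n) g i * f i) ^+ 2 <= n%:R * 2 * (5 * x).
  apply: le_trans h _; apply: ler_pM => //; rewrite sqrtr1 mul1r.
  by move: (sqrtr_ge0 x) x0; lra.
rewrite ipC /ip -(ler_pXn2r (ltn0Sn 1)) ?nnegrE// ?(ltW eta0)// real_normK ?num_real//.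
rewrite exprMn exprVn mulrC ler_pdivrMr ?exprn_gt0//.
apply: le_trans h' _; rewrite /x /e -subr_ge0.
rewrite (_ : _ - _ = (n%:R * eta) ^+ 2 * (3 / 8)); last by field.
by rewrite mulr_ge0 ?sqr_ge0.
Qed.

Lemma vcol_orth_likely (j k : nat) : j != k ->
  likely P (fun w => `|ip n (vcol v w j) (vcol v w k)| <= eta) (3 * expR (- x)).
Proof.
move=> jk.
pose h (y : (nat + nat * nat)%type) : (nat * nat + nat * nat)%type :=
  match y with inl i => inl (i, k) | inr (r, i) => if r == 0%N then inl (i, j) else inr (i, r) end.
have hI : injective h.
  move=> [i|[r i]] [i'|[r' i']] /=; rewrite ?[if _ then _ else _]fun_if.
  - by case=> ->.
  - by case: eqP => // _ [_ /eqP]; rewrite eq_sym (negbTE jk).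
  - by case: eqP => // _ [_ /eqP]; rewrite (negbTE jk).
  - by case: (r =P 0%N) => [->|_]; case: (r' =P 0%N) => [->|_] // [-> // ->].
have iY := iid_reindex iX hI.
pose a (i : nat) (f : family nat R) : R := f i.
have ma i : measurable_fun setT (a i) by exact: measurable_coord.
have hb := cond_linform_upper iY n 1 ma x0.
have hl : likely P (fun w => (\sum_(i < n) v i k w * v i j w) ^+ 2 <=
    (\sum_(i < n) v i k w ^+ 2) * (1%:R + 2 * (Num.sqrt 1%:R * Num.sqrt x) + 2 * x)) (expR (- x)).
  apply: (likely_sub (likely_not _ hb)) => //.
    apply: measurable_lt_set.
      apply: measurable_funM => //; apply: measurable_sum => i; apply: measurable_funX.
      exact: (mX (inl (nat_of_ord i, k))).
    apply: measurable_sum => r; apply: measurable_funX; apply: measurable_sum => i.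
    apply: measurable_funM; first exact: (mX (inl (nat_of_ord i, k))).
    exact: (mX (h (inr (nat_of_ord r, nat_of_ord i)))).
  by move=> w /negP /=; rewrite -leNgt big_ord1.
apply: (likely_sub (likely_and hl (vcol_norm_likely k))).
  by rewrite le_eqVlt; apply/orP; left; apply/eqP; ring.
by move=> w [h1 h2]; exact: small_ip.
Qed.

Lemma vcol_zcomb_likely (q : 'cV[R]_p) (j : nat) : vdot q q = 1 ->
  likely P (fun w => `|ip n (vcol v w j) (zcomb z w q)| <= eta) (3 * expR (- x)).
Proof.
move=> q1.
(* The transposition of [0] and [j]: row 0 of the array must be factor [j], and the reindexing must
   stay injective. *)
pose sw (r : nat) := if r == 0%N then j else if r == j then 0%N else r.
have swI : injective sw.
  by move=> r r'; rewrite /sw; do ![case: eqP => ?]; subst => //; congruence.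
pose h (y : (nat * nat + nat * nat)%type) : (nat * nat + nat * nat)%type :=
  match y with inl y => inr y | inr (r, i) => inl (i, sw r) end.
have hI : injective h.
  by move=> [[i l]|[r i]] [[i' l']|[r' i']] //= []; [move=> -> ->|move=> -> /swI ->].
have iY := iid_reindex iX hI.
pose a (i : nat) (f : family (nat * nat)%type R) : R := \sum_(l < p) q l 0 * f (i, nat_of_ord l).
have ma i : measurable_fun setT (a i).
  by apply: measurable_sum => l; apply: measurable_funM => //; exact: measurable_coord.
have aE w i : a i (fun y => X (h (inl y)) w) = zcomb z w q i.
  by apply: eq_bigr => l _; rewrite mxE.
have hb := cond_linform_upper iY n 1 ma x0.
have hl : likely P (fun w => (\sum_(i < n) zcomb z w q i * v i j w) ^+ 2 <=
    (\sum_(i < n) zcomb z w q i ^+ 2) * (1%:R + 2 * (Num.sqrt 1%:R * Num.sqrt x) + 2 * x)) (expR (- x)).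
  have maw i : measurable_fun setT (fun w => a i (fun y => X (h (inl y)) w)).
    by apply: measurable_sum => l; apply: measurable_funM => //; exact: mX.
  apply: (likely_sub (likely_not _ hb)) => //.
    apply: measurable_lt_set.
      by apply: measurable_funM => //; apply: measurable_sum => i; apply: measurable_funX; exact: maw.
    apply: measurable_sum => r; apply: measurable_funX; apply: measurable_sum => i.
    by apply: measurable_funM; [exact: maw|exact: (mX (h (inr (nat_of_ord r, nat_of_ord i))))].
  move=> w /negP /=; rewrite -leNgt big_ord1.
  rewrite (eq_bigr (fun i : 'I_n => zcomb z w q i * v i j w)); last first.
    by move=> i _; rewrite aE.
  by rewrite [in leRHS](eq_bigr (fun i : 'I_n => zcomb z w q i ^+ 2))// => i _; rewrite aE.
apply: (likely_sub (likely_and hl (zcomb_norm_likely q1))).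
  by rewrite le_eqVlt; apply/orP; left; apply/eqP; ring.
by move=> w [h1 h2]; exact: small_ip.
Qed.

Let Bsq (N : nat) (G C : R) : (N <= p)%N -> G <= n%:R * (1 + eta) -> 0 <= G ->
  C <= G * (N%:R + 2 * (Num.sqrt N%:R * Num.sqrt x) + 2 * x) -> C <= (n%:R * B) ^+ 2.
Proof.
move=> Np GG G0 h.
have h1 : N%:R + 2 * (Num.sqrt N%:R * Num.sqrt x) + 2 * x <=
    p%:R + 2 * (Num.sqrt p%:R * Num.sqrt x) + 2 * x.
  rewrite lerD2r lerD ?ler_nat// ler_wpM2l// ler_wpM2r ?sqrtr_ge0//.
  by rewrite ler_sqrt ?ler0n// ler_nat.
have h2 : p%:R + 2 * (Num.sqrt p%:R * Num.sqrt x) + 2 * x = n%:R * (s ^+ 2 + s * eta / 2 + eta ^+ 2 / 8).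
  rewrite sp sx (_ : Num.sqrt n%:R * s * (Num.sqrt n%:R * (eta / 4)) =
    Num.sqrt n%:R * Num.sqrt n%:R * (s * (eta / 4))); last by ring.
  by rewrite snn s2 /x /e; field.
have e0 := ltW eta0.
have q0 : 0 <= s ^+ 2 + s * eta / 2 + eta ^+ 2 / 8.
  by rewrite !addr_ge0// ?sqr_ge0// ?mulr_ge0// ?sqr_ge0.
apply: le_trans h _.
apply: (@le_trans _ _ (n%:R * (1 + eta) * (n%:R * (s ^+ 2 + s * eta / 2 + eta ^+ 2 / 8)))).
  rewrite -h2; apply: ler_pM => //.
  by rewrite !addr_ge0// ?mulr_ge0// ?sqrtr_ge0.
rewrite (_ : (n%:R * B) ^+ 2 = n%:R * (1 + eta) * (n%:R * ((1 + eta) * (s + eta) ^+ 2))); last first.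
  by rewrite /B; ring.
apply: ler_wpM2l; first by rewrite mulr_ge0// addr_ge0.
apply: ler_wpM2l; first exact: ltW.
have h3 : (s + eta) ^+ 2 <= (1 + eta) * (s + eta) ^+ 2.
  by rewrite ler_peMl ?sqr_ge0// lerDl.
apply: le_trans h3; rewrite -subr_ge0.
rewrite (_ : _ - _ = s * eta * (3 / 2) + eta ^+ 2 * (7 / 8)); last by field.
by rewrite addr_ge0// mulr_ge0// ?sqr_ge0// mulr_ge0.
Qed.

Let B0 : 0 <= B.
Proof. by rewrite mulr_ge0// addr_ge0// ltW. Qed.

Let G_of_norm (g : nat -> R) : `|ip n g g - 1| <= eta ->
  \sum_(i < n) g i ^+ 2 <= n%:R * (1 + eta).
Proof.
rewrite ler_norml => /andP[_ h]; have : ip n g g <= 1 + eta by move: h; lra.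
by rewrite /ip mulrC ler_pdivrMr// mulrC (eq_bigr (fun i : 'I_n => g i ^+ 2)).
Qed.

Let ip_zcomb w (t : nat -> R) (h : 'cV[R]_p) :
  ip n t (zcomb z w h) = (n%:R)^-1 * vdot h (\col_l \sum_(i < n) t i * z i l w).
Proof.
congr (_ * _); rewrite /zcomb /vdot.
transitivity (\sum_(i < n) \sum_(k < p) h k 0 * (t i * z i k w)).
  by apply: eq_bigr => i _; rewrite mulr_sumr; apply: eq_bigr => k _; rewrite mxE mulrCA.
by rewrite exchange_big/=; apply: eq_bigr => k _; rewrite mxE mulr_sumr.
Qed.

(** The product is linear in [h], represented by the vector [c / n] with [c] the combination of the
    noise vectors with weights [v i j]. Given the factors, its squared norm is a multiple of a
    chi-square with [p] degrees of freedom, and Cauchy-Schwarz gives all [h] at once. *)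
Lemma vcol_zcomb_unif_likely (j : nat) :
  likely P (fun w => forall h : 'cV[R]_p, `|ip n (vcol v w j) (zcomb z w h)| <= B * vnorm h)
    (3 * expR (- x)).
Proof.
pose h (y : (nat * nat + nat * nat)%type) : (nat * nat + nat * nat)%type :=
  match y with inl y => inl y | inr (k, i) => inr (i, k) end.
have hI : injective h by move=> [[i l]|[r i]] [[i' l']|[r' i']] //= [-> ->].
have iY := iid_reindex iX hI.
pose a (i : nat) (f : family (nat * nat)%type R) : R := f (i, j).
have ma i : measurable_fun setT (a i) by exact: measurable_coord.
have hb := cond_linform_upper iY n p ma x0.
have hl : likely P (fun w => \sum_(l < p) (\sum_(i < n) v i j w * z i l w) ^+ 2 <=
    (\sum_(i < n) v i j w ^+ 2) * (p%:R + 2 * (Num.sqrt p%:R * Num.sqrt x) + 2 * x)) (expR (- x)).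
  apply: (likely_sub (likely_not _ hb)) => //.
    apply: measurable_lt_set.
      apply: measurable_funM => //; apply: measurable_sum => i; apply: measurable_funX.
      exact: (mX (inl (nat_of_ord i, j))).
    apply: measurable_sum => r; apply: measurable_funX; apply: measurable_sum => i.
    apply: measurable_funM; first exact: (mX (inl (nat_of_ord i, j))).
    exact: (mX (inr (nat_of_ord i, nat_of_ord r))).
  by move=> w /negP /=; rewrite -leNgt.
apply: (likely_sub (likely_and hl (vcol_norm_likely j))).
  by rewrite le_eqVlt; apply/orP; left; apply/eqP; ring.
move=> w [h1 h2] g; rewrite ip_zcomb; set c := \col_l _.
have cc : vdot c c <= (n%:R * B) ^+ 2.
  rewrite (_ : vdot c c = \sum_(l < p) (\sum_(i < n) v i j w * z i l w) ^+ 2); last first.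
    by apply: eq_bigr => l _; rewrite mxE expr2.
  apply: (Bsq (leqnn p) _ _ h1); first exact: (G_of_norm h2).
  by apply: sumr_ge0 => i _; exact: sqr_ge0.
have cn : vnorm c <= n%:R * B.
  rewrite -(ler_pXn2r (ltn0Sn 1)) ?nnegrE ?vnorm_ge0 ?(mulr_ge0 (ltW nR0) B0)//.
  by rewrite sqr_vnorm.
rewrite normrM ger0_norm ?invr_ge0// mulrC ler_pdivrMr//.
apply: le_trans (vdot_cauchy _ _) _.
by rewrite mulrC [B * _]mulrC -mulrA [vnorm c * _]mulrC ler_wpM2l ?vnorm_ge0// mulrC.
Qed.

(** With [y = 4 p + x = n (4 s^2 + eta^2 / 16)], the root of [n y] is at most [n (2 s + eta / 4)];
    doubling it and [y] gives [4 s] and [8 s^2]. The factor [5 / 3] is the loss of the net. *)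
Lemma zcomb_unif_likely :
  likely P (fun w => forall h : 'cV[R]_p,
     `|ip n (zcomb z w h) (zcomb z w h) - vdot h h| <=
     5 / 3 * (4 * s + 8 * s ^+ 2 + eta) * vdot h h) (2 * expR (- x)).
Proof.
have := noise_likely iX p0 n0 x0 => /=; set y := 4 * p%:R + x => hn.
have y0 : 0 <= y by rewrite addr_ge0// mulr_ge0.
apply: (likely_sub hn) => // w hw h.
have -> : ip n (zcomb z w h) (zcomb z w h) = (n%:R)^-1 * vdot h (gram X n p w *m h).
  rewrite vdot_gram /ip; congr (_ * _); apply: eq_bigr => i _; rewrite /zcomb.
  by congr (_ * _); apply: eq_bigr => l _; rewrite mxE.
have -> : (n%:R)^-1 * vdot h (gram X n p w *m h) - vdot h h =
    (vdot h (gram X n p w *m h) - n%:R * vdot h h) / n%:R.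
  by field; rewrite gt_eqF.
rewrite normrM normfV (ger0_norm (ltW nR0)) ler_pdivrMr//.
apply: le_trans (hw h) _.
rewrite [leRHS]mulrAC ler_wpM2r ?vdot_ge0// -[leRHS]mulrA ler_wpM2l//.
have sy : Num.sqrt y <= Num.sqrt n%:R * (2 * s + eta / 4).
  have e0 := ltW eta0.
  rewrite -(ler_pXn2r (ltn0Sn 1)) ?nnegrE ?sqrtr_ge0 ?mulr_ge0 ?sqrtr_ge0// ?addr_ge0// ?mulr_ge0//.
  rewrite sqr_sqrtr// exprMn sqr_sqrtr ?ler0n// /y s2 /x /e -subr_ge0.
  rewrite (_ : _ - _ = n%:R * s * eta); last by field.
  by rewrite !mulr_ge0// ltW.
have h1 : Num.sqrt n%:R * Num.sqrt y <= n%:R * (2 * s + eta / 4).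
  by rewrite -[X in _ <= X * _]snn -[leRHS]mulrA ler_wpM2l ?sqrtr_ge0.
have h2 : y = n%:R * (4 * s ^+ 2 + eta ^+ 2 / 16) by rewrite /y s2 /x /e; field.
rewrite h2 -subr_ge0.
have : 2 * (Num.sqrt n%:R * Num.sqrt (n%:R * (4 * s ^+ 2 + eta ^+ 2 / 16))) <= 2 * (n%:R * (2 * s + eta / 4)).
  by rewrite -h2 ler_wpM2l.
have h3 : 0 <= n%:R * (eta / 2 - eta ^+ 2 / 8).
  rewrite mulr_ge0// ?(ltW nR0)// (_ : _ - _ = eta * (4 - eta) / 8); last by field.
  by rewrite divr_ge0// mulr_ge0 ?(ltW eta0)//; move: eta1; lra.
by move: h3; set A := Num.sqrt n%:R * _; lra.
Qed.

Definition rotidx (y : ((nat * nat + nat) + nat * nat)%type) : (nat * nat + nat * nat)%type :=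
  match y with
  | inl (inl y) => inl y | inl (inr i) => inr (i, 0%N) | inr (l, i) => inr (i, l.+1)
  end.

Lemma rotidx_inj : injective rotidx.
Proof.
by move=> [[[i l]|i]|[l i]] [[[i' l']|i']|[l' i']] //= [] => [-> ->|->|-> ->].
Qed.

(* In rotated coordinates the component of [sum_i t_i z_i] orthogonal to [q] is made of
   the coordinates of index at least 1. *)
Lemma perp_rotated (q : 'cV[R]_p) : vdot q q = 1 ->
  exists X' (eps : R), [/\ iid_std_normal P (X' \o rotidx), eps ^+ 2 = 1,
    (forall y w, X' (inl y) w = X (inl y) w),
    (forall i w, (i < n)%N -> eps * X' (inr (i, 0%N)) w = zcomb z w q i) &
    (forall w (t : nat -> R) (c := \col_(l < p) \sum_(i < n) t i * z i l w),
      vdot (c - vdot c q *: q) (c - vdot c q *: q) =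
      \sum_(l < p.-1) (\sum_(i < n) t i * X' (inr (nat_of_ord i, (nat_of_ord l).+1)) w) ^+ 2)].
Proof.
case: p p0 q => // p' _ q q1.
pose a (l : nat) : R := if insub l is Some i then q i 0 else 0.
have aE (i : 'I_p'.+1) : a i = q i 0 by rewrite /a valK.
have a1 : \sum_(i < p'.+1) a i ^+ 2 = 1.
  by rewrite -q1; apply: eq_bigr => i _; rewrite aE expr2.
have [X' [eps [iX' eps2 e1 e2 e3]]] := rotate_rows n iX a1.
have zE i w : (i < n)%N -> eps * X' (inr (i, 0%N)) w = zcomb z w q i.
  by move=> i_n; rewrite e2//; apply: eq_bigr => l _; rewrite mxE aE.
exists X', eps; split => //; first exact: (iid_reindex iX' rotidx_inj).
move=> w t c.
(* The sum of squares depends on [Y] only through inner products of its rows, which the rotation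
   preserves. *)
have gramE (Y : (nat * nat + nat * nat)%type -> T -> R) :
    \sum_(l < p'.+1) (\sum_(i < n) t i * Y (inr (nat_of_ord i, nat_of_ord l)) w) ^+ 2 =
    \sum_(i < n) \sum_(k < n) t i * t k *
      \sum_(l < p'.+1) Y (inr (nat_of_ord i, nat_of_ord l)) w * Y (inr (nat_of_ord k, nat_of_ord l)) w.
  transitivity (\sum_(l < p'.+1) \sum_(i < n) \sum_(k < n) t i * t k *
      (Y (inr (nat_of_ord i, nat_of_ord l)) w * Y (inr (nat_of_ord k, nat_of_ord l)) w)).
    apply: eq_bigr => l _; rewrite expr2 mulr_suml; apply: eq_bigr => i _.
    by rewrite mulr_sumr; apply: eq_bigr => k _; ring.
  rewrite exchange_big/=; apply: eq_bigr => i _.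
  by rewrite exchange_big/=; apply: eq_bigr => k _; rewrite mulr_sumr.
have cc : vdot c c = \sum_(l < p'.+1) (\sum_(i < n) t i * X' (inr (nat_of_ord i, nat_of_ord l)) w) ^+ 2.
  transitivity (\sum_(l < p'.+1) (\sum_(i < n) t i * X (inr (nat_of_ord i, nat_of_ord l)) w) ^+ 2).
    by apply: eq_bigr => l _; rewrite mxE expr2.
  rewrite !gramE; apply: eq_bigr => i _; apply: eq_bigr => k _.
  by rewrite e3.
have cq : vdot c q = eps * \sum_(i < n) t i * X' (inr (nat_of_ord i, 0%N)) w.
  rewrite mulr_sumr (eq_bigr (fun i : 'I_n => t i * zcomb z w q i)); last first.
    by move=> i _; rewrite -zE// mulrCA.
  rewrite /vdot (eq_bigr (fun l : 'I_p'.+1 => \sum_(i < n) t i * (q l 0 * z i l w))); last first.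
    by move=> l _; rewrite mxE mulr_suml; apply: eq_bigr => i _; ring.
  rewrite exchange_big/=; apply: eq_bigr => i _; rewrite -mulr_sumr; congr (_ * _).
  by apply: eq_bigr => l _; rewrite mxE.
have [c' c'E] : exists c', c' = c by eexists.
rewrite -c'E !(vdotBl, vdotBr, vdotZl, vdotZr) q1 (vdotC q) c'E cc.
rewrite big_ord_recl/= cq.
set A := \sum_(i < n) _; set C := \sum_(i < p') _.
rewrite (_ : _ - _ = A ^+ 2 * (1 - eps ^+ 2) + C); last by ring.
by rewrite eps2 subrr mulr0 add0r.
Qed.

(** For [h] orthogonal to [q], the vector [c] may be replaced by its projection off [q], whose
    squared norm is, given the noise along [q], a multiple of a chi-square with [p.-1] degrees of
    freedom. *)
Lemma zcomb_perp_likely (q : 'cV[R]_p) : vdot q q = 1 ->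
  likely P (fun w => forall h : 'cV[R]_p, vdot h q = 0 ->
     `|ip n (zcomb z w q) (zcomb z w h)| <= B * vnorm h) (3 * expR (- x)).
Proof.
move=> q1; have [X' [eps [iY eps2 e1 e2 e3]]] := perp_rotated q1.
have [mY _] := iY.
pose a (i : nat) (f : family (nat * nat + nat)%type R) : R := f (inr i).
have ma i : measurable_fun setT (a i) by exact: measurable_coord.
have hb := cond_linform_upper iY n p.-1 ma x0.
have hl : likely P (fun w =>
   \sum_(l < p.-1) (\sum_(i < n) X' (inr (nat_of_ord i, 0%N)) w * X' (inr (nat_of_ord i, (nat_of_ord l).+1)) w) ^+ 2 <=
    (\sum_(i < n) X' (inr (nat_of_ord i, 0%N)) w ^+ 2) *
      (p.-1%:R + 2 * (Num.sqrt p.-1%:R * Num.sqrt x) + 2 * x)) (expR (- x)).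
  apply: (likely_sub (likely_not _ hb)) => //.
    apply: measurable_lt_set.
      apply: measurable_funM => //; apply: measurable_sum => i; apply: measurable_funX.
      exact: (mY (inl (inr (nat_of_ord i)))).
    apply: measurable_sum => r; apply: measurable_funX; apply: measurable_sum => i.
    by apply: measurable_funM; [exact: (mY (inl (inr (nat_of_ord i))))|exact: (mY (inr (nat_of_ord r, nat_of_ord i)))].
  by move=> w /negP /=; rewrite -leNgt.
apply: (likely_sub (likely_and hl (zcomb_norm_likely q1))).
  by rewrite le_eqVlt; apply/orP; left; apply/eqP; ring.
move=> w [h1 h2] g gq; rewrite ip_zcomb; set c := \col_l _.
have zX (i : 'I_n) : zcomb z w q i ^+ 2 = X' (inr (nat_of_ord i, 0%N)) w ^+ 2.
  by rewrite -e2// exprMn eps2 mul1r.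
have cperp : vdot (c - vdot c q *: q) (c - vdot c q *: q) <= (n%:R * B) ^+ 2.
  rewrite /c e3.
  apply: (@Bsq p.-1 (\sum_(i < n) zcomb z w q i ^+ 2)); first exact: leq_pred.
  - exact: (G_of_norm h2).
  - by apply: sumr_ge0 => i _; exact: sqr_ge0.
  rewrite (eq_bigr _ (fun i _ => zX i)); apply: le_trans h1.
  rewrite le_eqVlt; apply/orP; left; apply/eqP; apply: eq_bigr => l _.
  rewrite (_ : \sum_(i < n) _ = eps * \sum_(i < n) X' (inr (nat_of_ord i, 0%N)) w *
     X' (inr (nat_of_ord i, (nat_of_ord l).+1)) w); first by rewrite exprMn eps2 mul1r.
  by rewrite mulr_sumr; apply: eq_bigr => i _; rewrite -e2// mulrA.
have -> : vdot g c = vdot g (c - vdot c q *: q) by rewrite vdotBr vdotZr gq mulr0 subr0.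
have cn : vnorm (c - vdot c q *: q) <= n%:R * B.
  rewrite -(ler_pXn2r (ltn0Sn 1)) ?nnegrE ?vnorm_ge0 ?(mulr_ge0 (ltW nR0) B0)//.
  by rewrite sqr_vnorm.
rewrite normrM ger0_norm ?invr_ge0// mulrC ler_pdivrMr//.
apply: le_trans (vdot_cauchy _ _) _.
by rewrite mulrC [B * _]mulrC -mulrA [vnorm _ * (B * _)]mulrC ler_wpM2r ?vnorm_ge0// mulrC.
Qed.

Definition good_sample (m : nat) (q : 'cV[R]_p) (w : T) : Prop :=
  [/\ forall j k, (j < m)%N -> (k < m)%N ->
       `|ip n (vcol v w j) (vcol v w k) - (j == k)%:R| <= eta,
      `|ip n (zcomb z w q) (zcomb z w q) - 1| <= eta,
      forall j, (j < m)%N -> `|ip n (vcol v w j) (zcomb z w q)| <= eta,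
      forall j (h : 'cV[R]_p), (j < m)%N -> `|ip n (vcol v w j) (zcomb z w h)| <= B * vnorm h &
      (forall h : 'cV[R]_p, vdot h q = 0 ->
         `|ip n (zcomb z w q) (zcomb z w h)| <= B * vnorm h) /\
      (forall h : 'cV[R]_p, `|ip n (zcomb z w h) (zcomb z w h) - vdot h h| <=
         5 / 3 * (4 * s + 8 * s ^+ 2 + eta) * vdot h h)].

Lemma good_sample_likely (m : nat) (q : 'cV[R]_p) : (m <= p)%N -> vdot q q = 1 ->
  likely P (good_sample m q) (7 * p.+1%:R ^+ 2 * expR (- x)).
Proof.
move=> mp q1; set E := expR (- x).
have E0 : 0 <= E by exact: expR_ge0.
have m0 : 0 <= m%:R :> R by [].
have cardm : \sum_(i < m | xpredT i) 1 <= m%:R :> R by rewrite sumr_const card_ord.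
have cardmm : \sum_(i : 'I_m * 'I_m | xpredT i) 1 <= m%:R ^+ 2 :> R.
  by rewrite sumr_const card_prod card_ord -natrX mulnn.
have h1 := @likely_forall_fin _ _ _ P ('I_m * 'I_m)%type xpredT
  (fun i w => `|ip n (vcol v w i.1) (vcol v w i.2) - (nat_of_ord i.1 == i.2)%:R| <= eta)
  (3 * E) (m%:R ^+ 2).
have h2 := @likely_forall_fin _ _ _ P 'I_m xpredT
  (fun i w => `|ip n (vcol v w i) (zcomb z w q)| <= eta) (3 * E) m%:R.
have h3 := @likely_forall_fin _ _ _ P 'I_m xpredT
  (fun i w => forall h : 'cV[R]_p, `|ip n (vcol v w i) (zcomb z w h)| <= B * vnorm h) (3 * E) m%:R.
have {}h1 : likely P (fun w => forall i : 'I_m * 'I_m, true ->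
    `|ip n (vcol v w i.1) (vcol v w i.2) - (nat_of_ord i.1 == i.2)%:R| <= eta) (m%:R ^+ 2 * (3 * E)).
  apply: h1 => //; last by rewrite mulr_ge0.
  move=> [i k] _ /=; have [->|ik] := eqVneq (nat_of_ord i) k.
    by apply: (likely_sub (vcol_norm_likely k)) => //; rewrite ler_wpM2r// ler_nat.
  by apply: (likely_sub (vcol_orth_likely ik)) => // w; rewrite subr0.
have {}h2 : likely P (fun w => forall i : 'I_m, true ->
    `|ip n (vcol v w i) (zcomb z w q)| <= eta) (m%:R * (3 * E)).
  by apply: h2 => //; [move=> i _; exact: vcol_zcomb_likely|rewrite mulr_ge0].
have {}h3 : likely P (fun w => forall i : 'I_m, true -> forall h : 'cV[R]_p,
    `|ip n (vcol v w i) (zcomb z w h)| <= B * vnorm h) (m%:R * (3 * E)).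
  by apply: h3 => //; [move=> i _; exact: vcol_zcomb_unif_likely|rewrite mulr_ge0].
have h4 := zcomb_norm_likely q1.
have h5 := zcomb_perp_likely q1.
have h6 := zcomb_unif_likely.
apply: (likely_sub (likely_and (likely_and (likely_and h1 h2) (likely_and h3 h4)) (likely_and h5 h6))).
  have mpR : m%:R <= p%:R :> R by rewrite ler_nat.
  have pR : 1 <= p%:R :> R by rewrite ler1n.
  have m2 : m%:R ^+ 2 <= p%:R ^+ 2 :> R by rewrite lerXn2r ?nnegrE.
  have -> : m%:R ^+ 2 * (3 * E) + m%:R * (3 * E) + (m%:R * (3 * E) + 2 * E) + (3 * E + 2 * E) =
     (3 * m%:R ^+ 2 + 6 * m%:R + 7) * E by ring.
  rewrite ler_wpM2r//; have : 0 <= p%:R ^+ 2 :> R by exact: sqr_ge0.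
  have -> : 7 * p.+1%:R ^+ 2 = 7 * p%:R ^+ 2 + 14 * p%:R + 7 :> R by rewrite -[p.+1%:R]natr1; ring.
  by move: m2 mpR pR; lra.
move=> w [[[e1 e2] [e3 e4]] [e5 e6]]; split => //.
- by move=> j k jm km; have /= := e1 (Ordinal jm, Ordinal km) erefl.
- by move=> j jm; have /= := e2 (Ordinal jm) erefl.
- by move=> j h jm; have /= := e3 (Ordinal jm) erefl h.
Qed.

(** The projection of the sample on [q] involves only the factors and the noise along [q]. Given
    these, the part orthogonal to [q] of the noise combined with those weights is Gaussian in
    dimension [p.-1], and [y0] is its direction. At level [p.-1 / 16] the lower chi-square threshold
    is exactly half of [p.-1]. *)
Lemma cross_term_likely (m : nat) (rho : nat -> 'cV[R]_p) (sigma : R) (q : 'cV[R]_p) :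
  vdot q q = 1 -> (1 < p)%N ->
  likely P (fun w => 0 < ip n (xcomb m rho sigma v z w q) (xcomb m rho sigma v z w q) ->
      exists y0 : 'cV[R]_p, [/\ vdot y0 q = 0, vdot y0 y0 = 1 &
        Num.sqrt (ip n (xcomb m rho sigma v z w q) (xcomb m rho sigma v z w q) * (p.-1%:R / (2 * n%:R)))
          <= ip n (xcomb m rho sigma v z w q) (zcomb z w y0)])
    (expR (- (p.-1%:R / 16))).
Proof.
move=> q1 p1; have [X' [eps [iY eps2 e1 e2 e3]]] := perp_rotated q1.
have [mY _] := iY.
pose a (i : nat) (f : family (nat * nat + nat)%type R) : R :=
  \sum_(j < m) vdot q (rho j) * f (inl (i, nat_of_ord j)) + sigma * eps * f (inr i).
have ma i : measurable_fun setT (a i).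
  apply: measurable_funD; last by apply: measurable_funM => //; exact: measurable_coord.
  by apply: measurable_sum => l; apply: measurable_funM => //; exact: measurable_coord.
have x'0 : 0 <= p.-1%:R / 16 :> R by rewrite divr_ge0.
have hb := cond_linform_lower iY n p.-1 ma x'0.
set t := xcomb m rho sigma v z.
have tE w (i : 'I_n) : a i (fun k => (X' \o rotidx) (inl k) w) = t w q i.
  rewrite /t xcombE /a /= -mulrA e2//; congr (_ + _).
  by apply: eq_bigr => j _; rewrite e1.
have half : p.-1%:R - 2 * (Num.sqrt p.-1%:R * Num.sqrt (p.-1%:R / 16)) = p.-1%:R / 2 :> R.
  rewrite sqrtrM// (_ : Num.sqrt 16^-1 = 4^-1); last first.
    by rewrite (_ : 16^-1 = 4^-1 ^+ 2) ?sqrtr_sqr ?ger0_norm// exprVn expr2; congr (_^-1); ring.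
  rewrite [Num.sqrt p.-1%:R * _]mulrA -[Num.sqrt p.-1%:R * Num.sqrt p.-1%:R]expr2 sqr_sqrtr//.
  by field.
rewrite half in hb.
apply: (likely_sub (likely_not _ hb)) => //.
  have maw i : measurable_fun setT (fun w => a i (fun k => (X' \o rotidx) (inl k) w)).
    apply: measurable_funD; last by apply: measurable_funM => //; exact: (mY (inl (inr i))).
    apply: measurable_sum => l; apply: measurable_funM => //.
  apply: measurable_lt_set.
    apply: measurable_sum => r; apply: measurable_funX; apply: measurable_sum => i.
    by apply: measurable_funM; [exact: maw|exact: (mY (inr (nat_of_ord r, nat_of_ord i)))].
  by apply: measurable_funM => //; apply: measurable_sum => i; apply: measurable_funX; exact: maw.
move=> w /negP /=; rewrite -leNgt.
rewrite (eq_bigr (fun i : 'I_n => t w q i ^+ 2)); last by move=> i _; rewrite -tE.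
rewrite (eq_bigr (fun k : 'I_p.-1 =>
   (\sum_(i < n) t w q i * X' (inr (nat_of_ord i, (nat_of_ord k).+1)) w) ^+ 2)); last first.
  by move=> k _; congr (_ ^+ 2); apply: eq_bigr => i _; rewrite -tE.
rewrite -e3; set c := \col_l _; have [y yE] : exists y, y = c - vdot c q *: q by eexists.
rewrite -yE => hy t0.
have tn : \sum_(i < n) t w q i ^+ 2 = n%:R * ip n (t w q) (t w q).
  rewrite /ip mulrA divff ?gt_eqF// mul1r; by apply: eq_bigr => i _; rewrite expr2.
rewrite tn in hy.
have p1R : 0 < p.-1%:R :> R by rewrite ltr0n; case: p p1 => [|[]].
have yy : 0 < vdot y y.
  by apply: lt_le_trans hy; apply: mulr_gt0; [exact: mulr_gt0|exact: divr_gt0].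
have yn : 0 < vnorm y by rewrite /vnorm sqrtr_gt0.
have yq : vdot y q = 0 by rewrite yE vdotBl vdotZl q1 mulr1 subrr.
exists ((vnorm y)^-1 *: y); split.
- by rewrite vdotZl yq mulr0.
- by rewrite vdotZl vdotZr -sqr_vnorm expr2; field; rewrite gt_eqF.
rewrite ip_zcomb -/c (_ : c = y + vdot c q *: q); last by rewrite yE subrK.
rewrite vdotDr vdotZr !vdotZl yq !mulr0 addr0 -sqr_vnorm expr2 mulrA mulVf ?gt_eqF// mul1r.
rewrite -[leRHS]ger0_norm ?mulr_ge0 ?invr_ge0 ?vnorm_ge0// -sqrtr_sqr ler_wsqrtr//.
rewrite exprMn sqr_vnorm exprVn [leRHS]mulrC ler_pdivlMr ?exprn_gt0//.
apply: le_trans hy; rewrite le_eqVlt; apply/orP; left; apply/eqP.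
by field; rewrite gt_eqF.
Qed.

End good_events.

(** * Angles, and their bounds on a good sample *)

Section angle.
Context (R : realType) (p : nat).
Implicit Types a u q : 'cV[R]_p.

Lemma sqr_perp_norm u q : vdot u u = 1 -> vdot q q = 1 ->
  vnorm (u - vdot u q *: q) ^+ 2 = 1 - vdot u q ^+ 2.
Proof.
move=> u1 q1; rewrite sqr_vnorm !(vdotBl, vdotBr, vdotZl, vdotZr) u1 q1 (vdotC q).
by ring.
Qed.

Lemma abs_vdot_le1 u q : vdot u u = 1 -> vdot q q = 1 -> `|vdot u q| <= 1.
Proof.
by move=> u1 q1; have := vdot_cauchy u q; rewrite /vnorm u1 q1 sqrtr1 mulr1.
Qed.

Let vdot_itv u q : vdot u u = 1 -> vdot q q = 1 -> -1 <= `|vdot u q| <= 1.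
Proof. by move=> u1 q1; rewrite abs_vdot_le1// andbT (le_trans _ (normr_ge0 _)). Qed.

Lemma vangle_scale u q (r : R) : 0 < r -> vdot u u = 1 -> vdot q q = 1 ->
  vangle u (r *: q) = acos `|vdot u q|.
Proof.
move=> r0 u1 q1; rewrite /vangle vdotZr vnormZ {1 2}/vnorm u1 q1 sqrtr1 mul1r mulr1.
by rewrite normrM mulrAC divff ?mul1r// normr_eq0 gt_eqF.
Qed.

Lemma sin_vangle u q (r : R) : 0 < r -> vdot u u = 1 -> vdot q q = 1 ->
  sin (vangle u (r *: q)) = vnorm (u - vdot u q *: q).
Proof.
move=> r0 u1 q1; rewrite vangle_scale// sin_acos ?vdot_itv// real_normK ?num_real//.
by rewrite -sqr_perp_norm// sqrtr_sqr ger0_norm ?vnorm_ge0.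
Qed.

Lemma vangle_ge0 u q (r : R) : 0 < r -> vdot u u = 1 -> vdot q q = 1 ->
  0 <= vangle u (r *: q).
Proof. by move=> r0 u1 q1; rewrite vangle_scale// acos_ge0 ?vdot_itv. Qed.

Lemma vangle_ge_acos u q (r g : R) : 0 < r -> vdot u u = 1 -> vdot q q = 1 ->
  `|vdot u q| <= g -> g <= 1 -> acos g <= vangle u (r *: q).
Proof.
move=> r0 u1 q1 ug g1; rewrite vangle_scale// leNgt; apply/negP => lt.
have gi : -1 <= g <= 1 by rewrite g1 andbT (le_trans _ (le_trans (normr_ge0 _) ug)).
have [/andP[g0 gpi] cg] := acos_def gi.
have [/andP[h0 hpi] ch] := acos_def (vdot_itv u1 q1).
by move: lt; rewrite -ltr_cos ?in_itv/= ?g0 ?gpi ?h0 ?hpi// cg ch ltNge ug.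
Qed.

Definition unitv a : 'cV[R]_p := (vnorm a)^-1 *: a.

Lemma unitvK a : 0 < vnorm a -> a = vnorm a *: unitv a.
Proof. by move=> a0; rewrite /unitv scalerA divff ?scale1r// gt_eqF. Qed.

Lemma vdot_unitv a : 0 < vnorm a -> vdot (unitv a) (unitv a) = 1.
Proof.
by move=> a0; rewrite /unitv vdotZl vdotZr -sqr_vnorm; field; rewrite gt_eqF.
Qed.

End angle.

Section good_sample_bounds.
Context (R : realType) d (T : measurableType d) (p m n : nat) (rho : nat -> 'cV[R]_p).
Context (sigma : R) (v z : nat -> nat -> T -> R) (w : T) (eta : R).
Hypotheses (m0 : (0 < m)%N) (rho0 : 0 < vnorm (rho 0)) (sigma0 : 0 < sigma) (eta0 : 0 < eta).
Hypothesis orth : forall j k, (j < m)%N -> (k < m)%N -> j <> k -> vdot (rho j) (rho k) = 0.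
Let q := unitv (rho 0).
Let a := \sum_(j < m) vnorm (rho j).
Let s := Num.sqrt (p%:R / n%:R) : R.
Let S := sample_cov n rho m sigma v z w.
Hypothesis good : good_sample v z n eta m q w.
Variable u : 'cV[R]_p.
Hypothesis top : top_unit_eigvec S u.

Let B0 : 0 <= (1 + eta) * (s + eta).
Proof. by rewrite mulr_ge0// addr_ge0 ?sqrtr_ge0// ltW. Qed.

Lemma good_sin_upper (r2 : R) : (forall j, (0 < j < m)%N -> vnorm (rho j) <= r2) -> 0 <= r2 ->
  sin (vangle u (rho 0)) *
    (vnorm (rho 0) ^+ 2 - r2 ^+ 2
     - eta * (2 * a ^+ 2 + 2 * sigma * vnorm (rho 0) + sigma ^+ 2)
     - 2 * sigma * (a - vnorm (rho 0)) * ((1 + eta) * (s + eta))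
     - sigma ^+ 2 * (5 / 3 * (4 * s + 8 * s ^+ 2 + eta)))
  <= 2 * sigma * ((1 + eta) * (s + eta)) * (vnorm (rho 0) + sigma) + 2 * eta * a * (a + sigma).
Proof.
move=> r2P r20.
have [u1 Su top'] := top_eigvec_rayleigh (sample_cov_sym _ _ _ _ _ _ _) top.
have [g1 g2 g3 g4 [g5 g6]] := good.
have q1 : vdot q q = 1 by exact: vdot_unitv.
have qu : vdot q (S *m q) <= vdot u (S *m u) by have := top' q; rewrite q1 mulr1.
have := sin_bound (ltW eta0) g1 m0 rho0 orth sigma0 (unitvK rho0) q1 g2 g3 g4 g5 g6 r2P r20 B0 u1 qu.
by rewrite (_ : sin (vangle u (rho 0)) = vnorm (u - vdot u q *: q))// {1}(unitvK rho0) sin_vangle.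
Qed.

(** The cross term [2 r sigma eta] is absorbed by [eta (r^2 + sigma^2)], leaving
    [(1 - 2 eta) (r^2 + sigma^2)]. *)
Lemma good_ip_xcomb : eta <= 1 / 4 ->
  sigma ^+ 2 / 2 <= ip n (xcomb m rho sigma v z w q) (xcomb m rho sigma v z w q).
Proof.
move=> eta4; have [g1 g2 g3 g4 [g5 g6]] := good.
have q1 : vdot q q = 1 by exact: vdot_unitv.
have qrho : vdot q (rho 0) = vnorm (rho 0) by rewrite {1}(unitvK rho0) vdotZr q1 mulr1.
have ipq f : ip n (xcomb m rho sigma v z w q) f =
    vnorm (rho 0) * ip n (vcol v w 0) f + sigma * ip n (zcomb z w q) f.
  rewrite ip_xcomb (bigD1 (Ordinal m0))//= big1 ?addr0 ?qrho// => j j0.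
  rewrite /q /unitv vdotZl orth ?mulr0 ?mul0r// => /esym/eqP.
  by move: j0; rewrite -val_eqE/= => /negbTE ->.
rewrite ipq ![ip n _ (xcomb _ _ _ _ _ _ _)]ipC !ipq.
have := g1 0%N 0%N m0 m0; have := g3 0%N m0; have := g2; rewrite eqxx [ip n (zcomb _ _ _) (vcol _ _ _)]ipC.
set r := vnorm _; set A := ip _ _ _; set C := ip _ (vcol _ _ _) (zcomb _ _ _); set D := ip _ (vcol _ _ _) _.
rewrite !ler_norml => /andP[hA _] /andP[hC _] /andP[hD' _].
have hD : - eta <= D - 1 := hD'.
have r0 : 0 <= r by exact: vnorm_ge0.
have h1 : r ^+ 2 * (1 - eta) <= r ^+ 2 * D by rewrite ler_wpM2l ?sqr_ge0//; move: hD; lra.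
have h2 : sigma ^+ 2 * (1 - eta) <= sigma ^+ 2 * A by rewrite ler_wpM2l ?sqr_ge0//; move: hA; lra.
have h3 : r * sigma * (- eta) <= r * sigma * C by rewrite ler_wpM2l// mulr_ge0// ltW.
have h4 : 0 <= eta * (r - sigma) ^+ 2 by rewrite mulr_ge0 ?sqr_ge0// ltW.
have h5 : 0 <= (1 - 2 * eta) * r ^+ 2 by rewrite mulr_ge0 ?sqr_ge0//; move: eta4; lra.
have h6 : 0 <= (1 / 2 - 2 * eta) * sigma ^+ 2 by rewrite mulr_ge0 ?sqr_ge0//; move: eta4; lra.
by move: h1 h2 h3 h4 h5 h6; lra.
Qed.

(** With [g] the cosine and [x] the sine, [sin_lower_bound] becomes [|g| K <= L x]; squaring and
    using [x^2 = 1 - g^2] keeps [g] away from one. *)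
Lemma good_cos_upper (K L : R) : eta <= 1 / 4 ->
  (0 < ip n (xcomb m rho sigma v z w q) (xcomb m rho sigma v z w q) ->
      exists y0 : 'cV[R]_p, [/\ vdot y0 q = 0, vdot y0 y0 = 1 &
        Num.sqrt (ip n (xcomb m rho sigma v z w q) (xcomb m rho sigma v z w q) * (p.-1%:R / (2 * n%:R)))
          <= ip n (xcomb m rho sigma v z w q) (zcomb z w y0)]) ->
  0 < K -> K <= sigma * (sigma / 2 * Num.sqrt (p.-1%:R / n%:R)) - eta * a * (a + sigma) ->
  2 * ((1 + eta) * a ^+ 2 + 2 * sigma * a * ((1 + eta) * (s + eta)) +
    sigma ^+ 2 * (1 + 5 / 3 * (4 * s + 8 * s ^+ 2 + eta))) <= L ->
  `|vdot u q| <= Num.sqrt (L ^+ 2 / (K ^+ 2 + L ^+ 2)).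
Proof.
move=> eta4 cross K0 hK hL.
have tt := good_ip_xcomb eta4.
have s20 : 0 < sigma ^+ 2 / 2 by rewrite divr_gt0// exprn_gt0.
have [y0 [yq0 y01 kap]] := cross (lt_le_trans s20 tt).
have [u1 Su top'] := top_eigvec_rayleigh (sample_cov_sym _ _ _ _ _ _ _) top.
have [g1 g2 g3 g4 [g5 g6]] := good.
have q1 : vdot q q = 1 by exact: vdot_unitv.
have pn0 : 0 <= p.-1%:R / n%:R :> R by rewrite divr_ge0.
have kap' : sigma / 2 * Num.sqrt (p.-1%:R / n%:R) <= ip n (xcomb m rho sigma v z w q) (zcomb z w y0).
  apply: le_trans kap.
  have -> : sigma / 2 = Num.sqrt ((sigma / 2) ^+ 2) by rewrite sqrtr_sqr ger0_norm// divr_ge0// ltW.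
  rewrite -sqrtrM ?sqr_ge0// ler_wsqrtr//.
  rewrite (_ : (sigma / 2) ^+ 2 * (p.-1%:R / n%:R) = sigma ^+ 2 / 2 * (p.-1%:R / (2 * n%:R))).
    by rewrite ler_wpM2r// divr_ge0// mulr_ge0.
  by rewrite invfM; set i := n%:R^-1; field.
have := sin_lower_bound g1 m0 rho0 orth sigma0 (unitvK rho0) q1 g3 g4 g6 B0 u1 Su top' yq0 y01 kap'.
rewrite -/a -/s -/q; set x := vnorm _; set Lam := 2 * _ => h.
have x0 : 0 <= x by exact: vnorm_ge0.
have x2 := sqr_perp_norm u1 q1; rewrite -/x in x2.
have L0 : 0 <= L.
  apply: le_trans hL; have a0 : 0 <= a by apply: sumr_ge0 => j _; exact: vnorm_ge0.
  have e0 := ltW eta0; have sg0 := ltW sigma0; have ss0 : 0 <= s := sqrtr_ge0 _.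
  rewrite mulr_ge0// !addr_ge0// ?mulr_ge0// ?sqr_ge0// ?addr_ge0// ?mulr_ge0// ?sqr_ge0//.
  by rewrite !addr_ge0// ?mulr_ge0// ?sqr_ge0.
have h1 : `|vdot u q| * K <= L * x.
  apply: le_trans (le_trans h _); first by rewrite ler_wpM2l.
  by rewrite ler_wpM2r.
have h2 : vdot u q ^+ 2 * K ^+ 2 <= L ^+ 2 * (1 - vdot u q ^+ 2).
  rewrite -x2 -(real_normK (num_real (vdot u q))) -!exprMn lerXn2r ?nnegrE ?mulr_ge0//.
  exact: ltW.
have KL : 0 < K ^+ 2 + L ^+ 2 by rewrite ltr_pwDl ?exprn_gt0 ?sqr_ge0.
rewrite -[leLHS]normr_id -sqrtr_sqr ler_wsqrtr// real_normK ?num_real// ler_pdivlMr//.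
by move: h2; rewrite mulrBr mulr1 mulrDr lerBrDr [L ^+ 2 * _]mulrC.
Qed.

End good_sample_bounds.

(** * Borel-Cantelli, lower bounds on means, and limits of the deterministic bounds *)

Section probability_tools.
Context (R : realType) d (T : measurableType d) (P : probability T R).

(** Borel-Cantelli for the measurable failure sets: the exceptional set is their limit superior,
    null because a geometric series dominates their probabilities. *)
Lemma likely_ae (Q : nat -> T -> Prop) (K r : R) : 0 <= K -> 0 < r < 1 ->
  (\forall n \near \oo, likely P (Q n) (K * r ^+ n)) ->
  {ae P, forall w, \forall n \near \oo, Q n w}.
Proof.
move=> K0 /andP[r0 r1] [N _ hN].
have hB n : exists B : set T, [/\ measurable B, (P B <= (K * r ^+ n)%:E)%E &
    (N <= n)%N -> forall w, ~ B w -> Q n w].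
  have [Nn|nN] := leqP N n.
    by have [B [mB PB BQ]] := hN n Nn; exists B; split.
  (* Below [N] nothing is claimed of [Q]; the empty set obeys the same geometric bound, so that the
     whole series is dominated. *)
  exists set0; split => //.
  by rewrite measure0 lee_fin mulr_ge0// exprn_ge0// ltW.
have [B hB'] := choice hB.
have mB n : measurable (B n) by have [] := hB' n.
have PB : (\sum_(n <oo) P (B n) < +oo)%E.
  apply: (@le_lt_trans _ _ (K * (1 - r)^-1)%:E); last exact: ltry.
  apply: lime_le; first by apply: is_cvg_nneseries => n _ _; exact: measure_ge0.
  apply: nearW => n; apply: (@le_trans _ _ (\sum_(0 <= i < n) (K * r ^+ i)%:E)%E).
    by apply: lee_sum => i _; have [] := hB' i.
  by rewrite sumEFin lee_fin; apply: geometric_le_lim; rewrite // ger0_norm// ltW.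
exists (lim_sup_set B); split.
- by apply: bigcap_measurable => // k _; apply: bigcup_measurable => i _.
- exact: lim_sup_set_cvg0.
move=> w /= nQ k _; apply: contrapT => nB; apply: nQ.
exists (maxn N k) => // n /=; rewrite geq_max => /andP[Nn kn].
by have [_ _ h] := hB' n; apply: h => // Bw; apply: nB; exists n.
Qed.

(** The integral is a supremum over simple functions below [f], and [k] times the indicator of [A]
    is one of them. *)
Lemma integral_ge_on (f : T -> R) (A : set T) (k : R) : measurable A -> 0 <= k ->
  (forall w, 0 <= f w) -> (forall w, A w -> k <= f w) ->
  (k%:E * P A <= \int[P]_w (f w)%:E)%E.
Proof.
move=> mA k0 f0 kf; rewrite ge0_integralTE; last by move=> w; rewrite lee_fin.
apply: ereal_sup_ubound; exists (scale_nnsfun (indic_nnsfun R mA) k0).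
  move=> w; rewrite lee_fin [leLHS](_ : _ = k * \1_A w)// indicE.
  by have [/set_mem/kf|_] := boolP (w \in A); rewrite ?mulr1 ?mulr0.
exact: (etrans (sintegralrM P k (indic_nnsfun R mA)) (congr1 _ (sintegral_indic P A))).
Qed.

(** Half of the exponent becomes the ratio [r]; the other half absorbs the polynomial, since
    eventually [p + 1 <= (c + 2) n] and [y^2 / 2 <= expR y] at [y = n e / 2] bounds [n^2]. *)
Lemma poly_exp_geometric (p : nat -> nat) (c e : R) : 0 < e -> 0 <= c ->
  ((fun n => (p n)%:R / n%:R : R) @ \oo --> c) ->
  exists K r : R, [/\ 0 <= K, 0 < r < 1 &
    \forall n \near \oo, 7 * (p n).+1%:R ^+ 2 * expR (- (n%:R * e)) <= K * r ^+ n].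
Proof.
move=> e0 c0 pc.
exists (7 * (c + 2) ^+ 2 * (8 / e ^+ 2)), (expR (- (e / 2))); split.
- apply: mulr_ge0; first by apply: mulr_ge0 => //; exact: sqr_ge0.
  by apply: divr_ge0 => //; exact: sqr_ge0.
- by rewrite expR_gt0/= -expR0 ltr_expR oppr_lt0 divr_gt0.
have pn : \forall n \near \oo, (p n)%:R / n%:R <= c + 1 :> R.
  by apply: (cvgr_le _ pc); rewrite ltrDl.
near=> n.
have n0 : (0 < n)%N by near: n; exact: nbhs_infty_gt.
have nR : 1 <= n%:R :> R by rewrite ler1n.
have h1 : (p n).+1%:R <= (c + 2) * n%:R.
  have : (p n)%:R <= (c + 1) * n%:R.
    by rewrite -ler_pdivrMr ?ltr0n//; near: n.
  by rewrite -natr1; move: nR; lra.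
have h2 : (p n).+1%:R ^+ 2 <= ((c + 2) * n%:R) ^+ 2 :> R.
  by rewrite lerXn2r ?nnegrE// mulr_ge0// addr_ge0.
have ne0 : 0 <= n%:R * e / 2 by rewrite divr_ge0// mulr_ge0// ltW.
have h3 : n%:R ^+ 2 <= 8 / e ^+ 2 * expR (n%:R * e / 2).
  rewrite mulrAC ler_pdivlMr ?exprn_gt0//.
  have : (n%:R * e / 2) ^+ 2 / 2 <= expR (n%:R * e / 2).
    by apply: le_trans (expR_ge_quadratic ne0); rewrite lerDr addr_ge0.
  by rewrite -(ler_pM2l (ltr0n R 8)); apply: le_trans; rewrite le_eqVlt; apply/orP; left; apply/eqP; field.
rewrite -expRM_natl mulrN (_ : expR (- (n%:R * e)) = expR (- (n%:R * (e / 2))) * expR (- (n%:R * (e / 2)))); last first.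
  by rewrite -expRD; congr expR; field.
have h4 : n%:R ^+ 2 * expR (- (n%:R * (e / 2))) <= 8 / e ^+ 2.
  rewrite expRN ler_pdivrMr ?expR_gt0//; apply: le_trans h3 _.
  by rewrite mulrA.
rewrite mulrA ler_wpM2r ?expR_ge0//.
apply: (@le_trans _ _ (7 * ((c + 2) * n%:R) ^+ 2 * expR (- (n%:R * (e / 2))))).
  by rewrite ler_wpM2r ?expR_ge0// ler_wpM2l.
rewrite exprMn [7 * (_ * _)]mulrA -[leLHS]mulrA; apply: ler_wpM2l => //.
by apply: mulr_ge0 => //; exact: sqr_ge0.
Unshelve. all: by end_near. Qed.

End probability_tools.

Section real_limits.
Context (R : realType).

Lemma limn_esup_le (x : nat -> \bar R) (M : \bar R) :
  (\forall n \near \oo, (x n <= M)%E) -> (limn_esup x <= M)%E.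
Proof.
move=> xM; rewrite /limn_esup /limf_esup.
apply: (@le_trans _ _ (ereal_sup [set x n | n in [set n | (x n <= M)%E]])).
  by apply: ereal_inf_lbound; exists [set n | (x n <= M)%E].
by apply: ge_ereal_sup => _ [n xn <-].
Qed.

Lemma le_limn_einf (x : nat -> \bar R) (M : \bar R) :
  (\forall n \near \oo, (M <= x n)%E) -> (M <= limn_einf x)%E.
Proof.
move=> Mx; rewrite /limn_einf leeNr; apply: limn_esup_le.
by apply: filterS Mx => n; rewrite leeN2.
Qed.

Section l1_convergence.
Variables (x : nat -> nat -> R) (y : nat -> R).
Hypothesis y_abs : (\sum_(0 <= j <oo) (`|y j|)%:E < +oo)%E.
Hypothesis xy : (fun n => (\sum_(0 <= j <oo) (`|x n j - y j|)%:E)%E) @ \oo --> 0%E.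

Let dist_near (e : R) : 0 < e ->
  \forall n \near \oo, forall N, \sum_(0 <= j < N) `|x n j - y j| <= e.
Proof.
move=> e0.
have nb : nbhs (0%E : \bar R) [set t : \bar R | (t < e%:E)%E].
  by apply: open_nbhs_nbhs; split; [exact: open_ereal_lt_ereal|rewrite /= lte_fin].
have h : \forall n \near \oo, (\sum_(0 <= j <oo) (`|x n j - y j|)%:E < e%:E)%E := xy nb.
apply: filterS h => n hn N.
rewrite -lee_fin -sumEFin; apply: le_trans (ltW hn).
by apply: nneseries_lim_ge => k _ _; rewrite lee_fin.
Qed.

Lemma l1_cvg_coord j : (fun n => x n j) @ \oo --> y j.
Proof.
apply/cvgrPdist_le => e e0; apply: filterS (dist_near e0) => n /(_ j.+1).
apply: le_trans; rewrite distrC big_nat_recr//= lerDr.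
by apply: sumr_ge0.
Qed.

Lemma l1_is_cvg_series : cvgn (series y).
Proof.
apply: normed_cvg; apply: nondecreasing_is_cvgn.
  apply/nondecreasing_seqP => n.
  rewrite -[leRHS]/(\sum_(0 <= j < n.+1) `|y j|) big_nat_recr//=.
  by rewrite -[leLHS]/(\sum_(0 <= j < n) `|y j|) lerDl.
have y0 : (0 <= \sum_(0 <= j <oo) (`|y j|)%:E)%E by apply: nneseries_ge0 => *; rewrite lee_fin.
exists (fine (\sum_(0 <= j <oo) (`|y j|)%:E)%E) => _ [n _ <-].
rewrite -[leLHS]/(\sum_(0 <= j < n) `|y j|) -lee_fin fineK; last by rewrite ge0_fin_numE.
by rewrite -sumEFin; apply: nneseries_lim_ge => k _ _; rewrite lee_fin.
Qed.

(** The sum of [x n] is also its partial sum up to any [N] beyond [m n]. The l1 distance bounds its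
    difference from [series y N] uniformly in [N], and [N] goes to infinity with [n] fixed. *)
Lemma l1_cvg_sum (m : nat -> nat) : (forall n j, (m n <= j)%N -> x n j = 0) ->
  (fun n => \sum_(j < m n) x n j) @ \oo --> limn (series y).
Proof.
move=> x0; apply/cvgrPdist_le => e e0; apply: filterS (dist_near e0) => n h.
have hN N : (m n <= N)%N -> `|series y N - \sum_(j < m n) x n j| <= e.
  move=> mN; have -> : \sum_(j < m n) x n j = \sum_(0 <= j < N) x n j.
    have xtail : \sum_(m n <= j < N) x n j = 0.
      by rewrite big_nat_cond big1// => j /andP[/andP[mj _] _]; exact: x0.
    by rewrite (big_cat_nat (n := m n))//= xtail addr0 big_mkord.
  rewrite distrC /series/= -sumrB; apply: le_trans (h N).
  exact: ler_norm_sum.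
have cy := l1_is_cvg_series.
rewrite ler_norml; apply/andP; split.
  rewrite lerBrDr addrC; apply: limr_ge => //; exists (m n) => // N /= mN.
  by have := hN N mN; rewrite ler_norml => /andP[+ _]; lra.
rewrite lerBlDr; apply: limr_le => //; exists (m n) => // N /= mN.
by have := hN N mN; rewrite ler_norml => /andP[_]; lra.
Qed.

End l1_convergence.

Let cvD (f g : nat -> R) (a b : R) : f @ \oo --> a -> g @ \oo --> b ->
  (fun n => f n + g n) @ \oo --> a + b.
Proof. exact: cvgD. Qed.

Let cvB (f g : nat -> R) (a b : R) : f @ \oo --> a -> g @ \oo --> b ->
  (fun n => f n - g n) @ \oo --> a - b.
Proof. exact: cvgB. Qed.

Let cvM (f g : nat -> R) (a b : R) : f @ \oo --> a -> g @ \oo --> b ->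
  (fun n => f n * g n) @ \oo --> a * b.
Proof. exact: cvgM. Qed.

Let cvX (f : nat -> R) (a : R) : f @ \oo --> a -> (fun n => f n ^+ 2) @ \oo --> a ^+ 2.
Proof. by move=> fa; exact: (cvM fa fa). Qed.

Let cvC (a : R) : (fun n : nat => a) @ \oo --> a.
Proof. exact: cvg_cst. Qed.

Lemma cvg_sqrt_seq (f : nat -> R) (a : R) : f @ \oo --> a ->
  (fun n => Num.sqrt (f n)) @ \oo --> Num.sqrt a.
Proof. by move=> fa; apply: continuous_cvg => //; exact: sqrt_continuous. Qed.

Lemma cvg_pred_ratio (p : nat -> nat) (c : R) : (forall n, (0 < p n)%N) ->
  ((fun n => (p n)%:R / n%:R : R) @ \oo --> c) ->
  ((fun n => (p n).-1%:R / n%:R : R) @ \oo --> c).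
Proof.
move=> p0 pc.
have inv0 : (fun n => n%:R^-1 : R) @ \oo --> 0.
  by rewrite -cvg_shiftS; exact: cvg_harmonic.
have -> : (fun n => (p n).-1%:R / n%:R : R) = (fun n => (p n)%:R / n%:R - n%:R^-1).
  by apply/funext => n; rewrite -[in RHS](prednK (p0 n)) -natr1 mulrDl mul1r addrK.
by rewrite -[c]subr0; exact: cvB.
Qed.

(* Denominator, numerator and eigenvalue bound of the perturbation inequalities, as
   functions of the tolerance [eta], the norms [r0 > r2], the sum [a] of all norms and
   the square root [s] of the aspect ratio. *)
Definition gap_fun (sigma eta r0 r2 a s : R) : R :=
  r0 ^+ 2 - r2 ^+ 2
   - eta * (2 * a ^+ 2 + 2 * sigma * r0 + sigma ^+ 2)
   - 2 * sigma * (a - r0) * ((1 + eta) * (s + eta))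
   - sigma ^+ 2 * (5 / 3 * (4 * s + 8 * s ^+ 2 + eta)).

Definition err_fun (sigma eta r0 a s : R) : R :=
  2 * sigma * ((1 + eta) * (s + eta)) * (r0 + sigma) + 2 * eta * a * (a + sigma).

Definition top_fun (sigma eta a s : R) : R :=
  2 * ((1 + eta) * a ^+ 2 + 2 * sigma * a * ((1 + eta) * (s + eta)) +
    sigma ^+ 2 * (1 + 5 / 3 * (4 * s + 8 * s ^+ 2 + eta))).

Variables (sigma : R) (eta r0 r2 a s : nat -> R) (eta' r0' r2' a' s' : R).
Hypotheses (eta_cvg : eta @ \oo --> eta') (r0_cvg : r0 @ \oo --> r0')
  (r2_cvg : r2 @ \oo --> r2') (a_cvg : a @ \oo --> a') (s_cvg : s @ \oo --> s').

(** The quotient case precedes the product case, a quotient being a product; only constant quotients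
    such as [5 / 3] occur. *)
Ltac cvg_poly :=
  lazymatch goal with
  | |- cvg_to _ (nbhs (?x - ?y)) => apply: cvB; cvg_poly
  | |- cvg_to _ (nbhs (?x + ?y)) => apply: cvD; cvg_poly
  | |- cvg_to _ (nbhs (?x / ?y)) => exact: cvC
  | |- cvg_to _ (nbhs (?x * ?y)) => apply: cvM; cvg_poly
  | |- cvg_to _ (nbhs (?x ^+ 2)) => apply: cvX; cvg_poly
  | _ => first [ assumption | exact: cvC ]
  end.

Lemma gap_fun_cvg : (fun n => gap_fun sigma (eta n) (r0 n) (r2 n) (a n) (s n)) @ \oo -->
  gap_fun sigma eta' r0' r2' a' s'.
Proof. by rewrite /gap_fun; cvg_poly. Qed.

Lemma err_fun_cvg : (fun n => err_fun sigma (eta n) (r0 n) (a n) (s n)) @ \oo -->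
  err_fun sigma eta' r0' a' s'.
Proof. by rewrite /err_fun; cvg_poly. Qed.

Lemma top_fun_cvg : (fun n => top_fun sigma (eta n) (a n) (s n)) @ \oo -->
  top_fun sigma eta' a' s'.
Proof. by rewrite /top_fun; cvg_poly. Qed.

End real_limits.


(* The restriction [bound <= 4/5] forces [5 sigma s <= r0], which absorbs the operator
   norm of the pure noise part. *)
Lemma limit_gap_bound (R : realType) (sigma s r0 r1 rp : R)
    (bound := 4 * sigma * s / (r0 ^+ 2 - r1 ^+ 2) * (rp + (2 + s) * sigma)) :
  0 < sigma -> 0 <= s -> 0 <= r0 -> r0 <= rp -> 0 < r0 ^+ 2 - r1 ^+ 2 -> bound <= 4 / 5 ->
  0 < gap_fun sigma 0 r0 r1 rp s /\
  err_fun sigma 0 r0 rp s <= bound * gap_fun sigma 0 r0 r1 rp s.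
Proof.
rewrite /bound {bound}; set D := r0 ^+ 2 - r1 ^+ 2; set X := rp + (2 + s) * sigma.
move=> sigma0 s0 r00 r0p D0 bound45.
have ss0 : 0 <= sigma * s by rewrite mulr_ge0// ltW.
have hD : 5 * (sigma * s) * X <= D.
  by move: bound45; rewrite mulrAC ler_pdivrMr//; lra.
have X0 : 0 < X.
  rewrite /X ltr_wpDl ?(le_trans r00)// mulr_gt0//; move: s0; lra.
have r0pos : 0 < r0.
  rewrite lt_neqAle r00 andbT eq_sym; apply/eqP => r0E.
  by move: D0; rewrite /D r0E expr0n/= sub0r oppr_gt0 ltNge sqr_ge0.
have Xr : r0 <= X.
  rewrite /X (le_trans r0p)// lerDl mulr_ge0 ?ltW//; move: s0; lra.
have r05 : 5 * (sigma * s) <= r0.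
  rewrite -(ler_pM2r r0pos); apply: (@le_trans _ _ (5 * (sigma * s) * X)).
    by rewrite ler_wpM2l// mulr_ge0.
  by apply: le_trans hD _; rewrite /D -expr2 lerBlDr lerDl sqr_ge0.
(* [sigma * s * E] is what the gap loses at [eta = 0]: [2 * (rp - r0)] comes from the cross terms of
   the other components, [20 / 3] and [40 / 3] from [beta = 5 / 3 (4 s + 8 s^2)]. *)
pose E := 2 * (rp - r0) + sigma * (20 / 3 + 40 / 3 * s).
have gapE : gap_fun sigma 0 r0 r1 rp s = D - sigma * s * E by rewrite /gap_fun /D /E; field.
have errE : err_fun sigma 0 r0 rp s = 2 * (sigma * s) * (r0 + sigma) by rewrite /err_fun; ring.
have sg := sigma0; have r0p' := r0p.
have XE : X = rp + 2 * sigma + sigma * s by rewrite /X; ring.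
have EE : E = 2 * rp - 2 * r0 + 20 / 3 * sigma + 40 / 3 * (sigma * s) by rewrite /E; field.
have h1 : E < 5 * X by rewrite EE XE; move: r05 sg r0p' ss0 r0pos; lra.
have h2 : 4 * E <= 5 * (4 * X - 2 * r0 - 2 * sigma).
  by rewrite EE XE; move: r05 sg r0p' ss0 r0pos; lra.
have h3 : 0 <= 4 * X - 2 * r0 - 2 * sigma by rewrite XE; move: sg r0p' ss0 r0pos; lra.
have gap0 : 0 < D - sigma * s * E.
  rewrite subr_gt0; move: ss0; rewrite le_eqVlt => /orP[/eqP <-|sspos]; first by rewrite mul0r.
  apply: lt_le_trans hD; rewrite (_ : 5 * (sigma * s) * X = sigma * s * (5 * X)); last by ring.
  by rewrite ltr_pM2l.
rewrite gapE errE; split => //.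
rewrite [_ / D * X]mulrAC [_ / D * (_ - _)]mulrAC ler_pdivlMr// -subr_ge0.
(* Splits [D] into [5 * (sigma * s) * X] and a remainder, nonnegative because [bound <= 4 / 5]; the
   remainder has the coefficient of [h3], and [h2] settles the rest. *)
have -> : 4 * sigma * s * X * (D - sigma * s * E) - 2 * (sigma * s) * (r0 + sigma) * D =
  sigma * s * ((D - 5 * (sigma * s) * X) * (4 * X - 2 * r0 - 2 * sigma) +
    sigma * s * X * (5 * (4 * X - 2 * r0 - 2 * sigma) - 4 * E)) by ring.
rewrite mulr_ge0// addr_ge0// mulr_ge0// ?subr_ge0//.
by rewrite mulr_ge0// ltW.
Qed.

Lemma cvg_seq_ge0 (R : realType) (f : nat -> R) (l : R) : f @ \oo --> l ->
  (forall n, 0 <= f n) -> 0 <= l.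
Proof.
move=> fl f0; rewrite leNgt; apply/negP => l0.
have [N _ h] := cvgr_lt _ fl _ l0.
by have := h N (leqnn N); rewrite /= ltNge f0.
Qed.

(** * The two asymptotic statements *)

Section multicomponent_model.
Context (R : realType) d (T : measurableType d) (P : probability T R).
Variables (p m : nat -> nat) (rho : forall n : nat, nat -> 'cV[R]_(p n)).
Variables (sigma c : R) (varrho : nat -> R) (v z : nat -> nat -> T -> R).
Hypothesis mp : forall n, (1 <= m n <= p n)%N.
Hypothesis orth : forall n j k, (j < m n)%N -> (k < m n)%N -> j <> k ->
  vdot (rho n j) (rho n k) = 0.
Hypothesis r10 : forall n, norm_seq (rho n) (m n) 1 < norm_seq (rho n) (m n) 0.
Hypothesis r_mono : forall n j, (1 <= j)%N ->
  norm_seq (rho n) (m n) j.+1 <= norm_seq (rho n) (m n) j.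
Hypothesis sigma0 : 0 < sigma.
Hypothesis iX : iid_std_normal P (join_arrays v z).
Hypothesis varrho_abs : (\sum_(0 <= j <oo) (`|varrho j|)%:E < +oo)%E.
Hypothesis rho_l1 :
  (fun n => (\sum_(0 <= j <oo) (`|norm_seq (rho n) (m n) j - varrho j|)%:E)%E) @ \oo --> 0%E.
Hypothesis c0 : 0 <= c.
Hypothesis pc : (fun n => (p n)%:R / n%:R : R) @ \oo --> c.
Let varrho_plus := limn (series varrho).
(** Padded norms, indexed from 0: [r n 1] plays the part of [r2] also when [m n = 1], where it is
    zero. *)
Let r n j := norm_seq (rho n) (m n) j.
Let a n := \sum_(j < m n) vnorm (rho n j).
Let s n : R := Num.sqrt ((p n)%:R / n%:R).
Let q n := unitv (rho n 0).

Let m0 n : (0 < m n)%N. Proof. by have /andP[] := mp n. Qed.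
Let p0 n : (0 < p n)%N. Proof. by have /andP[h1 h2] := mp n; exact: leq_trans h2. Qed.
Let r0E n : r n 0 = vnorm (rho n 0). Proof. by rewrite /r /norm_seq m0. Qed.
Let r_ge0 n j : 0 <= r n j.
Proof. by rewrite /r /norm_seq; case: ifP => // _; exact: vnorm_ge0. Qed.
Let rho0 n : 0 < vnorm (rho n 0).
Proof. by rewrite -r0E; apply: le_lt_trans (r10 n); exact: r_ge0. Qed.
Let r_le n j : (0 < j < m n)%N -> vnorm (rho n j) <= r n 1.
Proof.
move=> /andP[j0 jm]; have -> : vnorm (rho n j) = r n j by rewrite /r /norm_seq jm.
case: j j0 {jm} => // j _; elim: j => // j IH.
exact: le_trans (r_mono n (ltn0Sn j)) IH.
Qed.
Let q1 n : vdot (q n) (q n) = 1. Proof. exact: vdot_unitv. Qed.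
Let S n w := sample_cov n (rho n) (m n) sigma v z w.

Let r0_cvg : (fun n => vnorm (rho n 0)) @ \oo --> varrho 0.
Proof.
rewrite (_ : (fun n => _) = (fun n => r n 0)); last by apply/funext => n; rewrite r0E.
exact: (@l1_cvg_coord R r varrho rho_l1 0).
Qed.
Let r1_cvg : (fun n => r n 1) @ \oo --> varrho 1.
Proof. exact: (@l1_cvg_coord R r varrho rho_l1 1). Qed.
Let a_cvg : a @ \oo --> varrho_plus.
Proof.
rewrite (_ : a = (fun n => \sum_(j < m n) r n j)).
  by apply: (l1_cvg_sum varrho_abs rho_l1) => n j; rewrite /norm_seq leqNgt => /negbTE ->.
by apply/funext => n; apply: eq_bigr => j _; rewrite /r /norm_seq ltn_ord.
Qed.
Let s_cvg : s @ \oo --> Num.sqrt c.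
Proof. exact: cvg_sqrt_seq. Qed.

Let varrho0_ge0 : 0 <= varrho 0.
Proof. by apply: (cvg_seq_ge0 r0_cvg) => n; exact: vnorm_ge0. Qed.

Let varrho0_le : varrho 0 <= varrho_plus.
Proof.
rewrite -subr_ge0; apply: (@cvg_seq_ge0 _ (fun n => a n - vnorm (rho n 0))).
  exact: (cvgB a_cvg r0_cvg).
move=> n; rewrite subr_ge0 /a (bigD1 (Ordinal (m0 n)))//= lerDl.
by apply: sumr_ge0 => j _; exact: vnorm_ge0.
Qed.

Let good_geometric (eta : R) : 0 < eta -> eta <= 1 -> exists K t : R, [/\ 0 <= K, 0 < t < 1 &
  \forall n \near \oo, likely P (good_sample v z n eta (m n) (q n)) (K * t ^+ n)].
Proof.
move=> eta0 eta1; have e0 : 0 < eta ^+ 2 / 16 by rewrite divr_gt0// exprn_gt0.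
have [K [t [K0 t01 h]]] := poly_exp_geometric e0 c0 pc.
exists K, t; split => //; near=> n.
have n0 : (0 < n)%N by near: n; exact: nbhs_infty_gt.
have x1 : 1 <= n%:R * (eta ^+ 2 / 16).
  by rewrite -ler_pdivrMr// ; near: n; exact: nbhs_infty_ger.
have mpn : (m n <= p n)%N by have /andP[] := mp n.
apply: (likely_sub (good_sample_likely iX n0 (p0 n) eta0 eta1 x1 mpn (q1 n))) => //.
by near: n.
Unshelve. all: by end_near. Qed.

(** Tolerances run through the sequence [harmonic k], so that one null set serves all of them and
    the eigenvectors may be chosen after [w]. *)
Lemma sin_limsup
  (bound := 4 * sigma * Num.sqrt c / (varrho 0 ^+ 2 - varrho 1 ^+ 2)
              * (varrho_plus + (2 + Num.sqrt c) * sigma)) :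
  0 < varrho 0 ^+ 2 - varrho 1 ^+ 2 -> bound <= 4 / 5 ->
  {ae P, forall w, forall u : forall n, 'cV[R]_(p n),
     (forall n, top_unit_eigvec (S n w) (u n)) ->
     (limn_esup (fun n => (sin (vangle (u n) (rho n 0)))%:E) <= bound%:E)%E}.
Proof.
move=> D0 b45.
have [G0 key] := limit_gap_bound sigma0 (sqrtr_ge0 c) varrho0_ge0 varrho0_le D0 b45.
have good_ae : {ae P, forall w, forall k, \forall n \near \oo,
    good_sample v z n (harmonic k) (m n) (q n) w}.
  apply: ae_foralln => k.
  have k1 : harmonic k <= 1 :> R by rewrite /harmonic/= invf_le1// ler1n.
  have [K [t [K0 t01 h]]] := good_geometric (harmonic_gt0 k) k1.
  exact: likely_ae K0 t01 h.
apply: filterS good_ae => w hw u utop; apply/lee_addgt0Pr => e e0; rewrite -EFinD.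
apply: limn_esup_le.
pose gap eta := gap_fun sigma eta (varrho 0) (varrho 1) varrho_plus (Num.sqrt c).
pose err eta := err_fun sigma eta (varrho 0) varrho_plus (Num.sqrt c).
have cst (x : R) : (fun _ : nat => x) @ \oo --> x by exact: cvg_cst.
have harm : (@harmonic R) @ \oo --> 0 by exact: cvg_harmonic.
have gk : (fun k => gap (harmonic k)) @ \oo --> gap 0.
  exact: (gap_fun_cvg harm (cst (varrho 0)) (cst (varrho 1)) (cst varrho_plus)
    (cst (Num.sqrt c))).
have ek : (fun k => err (harmonic k)) @ \oo --> err 0.
  exact: (err_fun_cvg harm (cst (varrho 0)) (cst varrho_plus) (cst (Num.sqrt c))).
have fk : (fun k => (bound + e) * gap (harmonic k) - err (harmonic k)) @ \oo -->
    (bound + e) * gap 0 - err 0.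
  exact: (cvgB (cvgM (cst (bound + e)) gk) ek).
(* The slack [e] makes the limiting inequality strict at zero tolerance; it then survives for some
   small [harmonic k] and, with that tolerance fixed, for all large [n]. *)
have f0 : 0 < (bound + e) * gap 0 - err 0.
  by rewrite subr_gt0; apply: le_lt_trans key _; rewrite ltr_pM2r// ltrDl.
have [k [gk0 fk0]] : exists k, 0 < gap (harmonic k) /\
    0 < (bound + e) * gap (harmonic k) - err (harmonic k).
  have [N _ h] := filterI (cvgr_gt _ gk _ G0) (cvgr_gt _ fk _ f0).
  by exists N; exact: (h N (leqnn N)).
have gn : (fun n => gap_fun sigma (harmonic k) (vnorm (rho n 0)) (r n 1) (a n) (s n)) @ \oo -->
    gap (harmonic k).
  exact: (gap_fun_cvg (cst (harmonic k)) r0_cvg r1_cvg a_cvg s_cvg).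
have en : (fun n => err_fun sigma (harmonic k) (vnorm (rho n 0)) (a n) (s n)) @ \oo -->
    err (harmonic k).
  exact: (err_fun_cvg (cst (harmonic k)) r0_cvg a_cvg s_cvg).
have fn : (fun n => (bound + e) * gap_fun sigma (harmonic k) (vnorm (rho n 0)) (r n 1) (a n) (s n)
      - err_fun sigma (harmonic k) (vnorm (rho n 0)) (a n) (s n)) @ \oo -->
    (bound + e) * gap (harmonic k) - err (harmonic k).
  exact: (cvgB (cvgM (cst (bound + e)) gn) en).
apply: filterS3 (hw k) (cvgr_gt _ gn _ gk0) (cvgr_gt _ fn _ fk0) => n good g0 fpos.
rewrite lee_fin -(ler_pM2r g0).
have := good_sin_upper (m0 n) (rho0 n) sigma0 (harmonic_gt0 k) (@orth n) good (utop n)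
  (@r_le n) (r_ge0 n 1).
move=> h; apply: (le_trans h); rewrite -subr_ge0; exact: ltW.
Qed.

(** [0 < c] acts twice: it sends [p] to infinity, so that the cross term concentrates, and it keeps
    [p / n] away from zero, so that this term has a fixed size. *)
Lemma mean_angle_liminf (u : forall n, T -> 'cV[R]_(p n)) : 0 < c ->
  (forall n w, top_unit_eigvec (S n w) (u n w)) ->
  (0 < limn_einf (fun n => \int[P]_w (vangle (u n w) (rho n 0))%:E))%E.
Proof.
move=> cpos utop; pose s' := Num.sqrt c.
have s'0 : 0 < s' by rewrite sqrtr_gt0.
have rp0 : 0 <= varrho_plus := le_trans varrho0_ge0 varrho0_le.
pose M := varrho_plus * (varrho_plus + sigma).
have M0 : 0 <= M by rewrite mulr_ge0// addr_ge0// ltW.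
(* The coefficient in [good_cos_upper] tends to [4 * k - eta * M]; the choice of [eta] makes the
   loss at most [2 * k], so the coefficient eventually exceeds [k]. *)
pose k := sigma ^+ 2 * s' / 8.
have k0 : 0 < k by rewrite divr_gt0// mulr_gt0// exprn_gt0.
pose eta := Num.min (1 / 4) (2 * k / (M + 1)).
have eta0 : 0 < eta by rewrite lt_min !divr_gt0 ?mulr_gt0// ltr_wpDl.
have eta4 : eta <= 1 / 4 by rewrite ge_min lexx.
have eta1 : eta <= 1 by move: eta4; lra.
have etaM : eta * M <= 2 * k.
  have h : eta <= 2 * k / (M + 1) by rewrite ge_min lexx orbT.
  rewrite ler_pdivlMr ?ltr_wpDl// in h.
  by apply: le_trans h; rewrite ler_wpM2l ?(ltW eta0)// lerDl.
have cst (x : R) : (fun _ : nat => x) @ \oo --> x by exact: cvg_cst.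
have pc' := cvg_pred_ratio p0 pc.
have sq_cvg := cvg_sqrt_seq pc'; rewrite -/s' in sq_cvg.
have K_cvg : (fun n => sigma * (sigma / 2 * Num.sqrt ((p n).-1%:R / n%:R)) - eta * a n * (a n + sigma))
    @ \oo --> sigma * (sigma / 2 * s') - eta * varrho_plus * (varrho_plus + sigma).
  apply: (cvgB (cvgM (cst sigma) (cvgM (cst (sigma / 2)) sq_cvg))).
  exact: (cvgM (cvgM (cst eta) a_cvg) (cvgD a_cvg (cst sigma))).
have K_gt : k < sigma * (sigma / 2 * s') - eta * varrho_plus * (varrho_plus + sigma).
  rewrite (_ : sigma * (sigma / 2 * s') = 4 * k); last by rewrite /k; field.
  by rewrite -mulrA -/M; move: k0 etaM; lra.
pose L := top_fun sigma eta varrho_plus s' + 1.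
have L_cvg : (fun n => top_fun sigma eta (a n) (s n)) @ \oo --> top_fun sigma eta varrho_plus s'.
  exact: (top_fun_cvg (cst eta) a_cvg s_cvg).
pose g := Num.sqrt (L ^+ 2 / (k ^+ 2 + L ^+ 2)).
have kL : 0 < k ^+ 2 + L ^+ 2 by rewrite ltr_pwDl ?exprn_gt0 ?sqr_ge0.
have g1 : g < 1.
  by rewrite -sqrtr1 ltr_sqrt// ltr_pdivrMr// mul1r ltrDr exprn_gt0.
have ag : 0 < acos g by rewrite acos_gt0// g1 andbT (le_trans _ (sqrtr_ge0 _)).
have [C [t [C0 /andP[t0 t1] good_near]]] := good_geometric eta0 eta1.
have geo : (fun n => C * t ^+ n) @ \oo --> 0.
  by apply: (@cvg_geometric _ C t); rewrite ger0_norm// ltW.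
suff h : \forall n \near \oo, ((acos g / 2)%:E <= \int[P]_w (vangle (u n w) (rho n 0))%:E)%E.
  by apply: lt_le_trans (le_limn_einf h); rewrite lte_fin divr_gt0.
near=> n.
have n0 : (0 < n)%N by near: n; exact: nbhs_infty_gt.
(* As [48 = 3 * 16], the cross term fails with probability at most [(1 + 3)^-1 = 1 / 4]; goodness of
   the sample costs another quarter, which leaves one half. *)
have pn48 : 48 <= (p n).-1%:R :> R.
  have h1 : c / 2 <= (p n).-1%:R / n%:R.
    by near: n; apply: (cvgr_ge _ pc'); move: cpos; lra.
  have h2 : 96 / c <= n%:R by near: n; exact: nbhs_infty_ger.
  rewrite ler_pdivrMr// in h2; rewrite ler_pdivlMr ?ltr0n// in h1.
  by move: h1 h2; rewrite [n%:R * c]mulrC; lra.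
have p1 : (1 < p n)%N.
  by rewrite -subn_gt0 subn1 -(ltr0n R); apply: lt_le_trans pn48; rewrite ltr0n.
have cross := cross_term_likely iX n0 (p0 n) (m n) (rho n) sigma (q1 n) p1.
have small : C * t ^+ n <= 1 / 4.
  by near: n; apply: (cvgr_le _ geo).
have exp_small : expR (- ((p n).-1%:R / 16)) <= 1 / 4 :> R.
  rewrite expRN -[1 / 4]/(1 * 4^-1) mul1r lef_pV2 ?posrE ?expR_gt0//.
  by apply: le_trans (expR_ge1Dx _); move: pn48; lra.
have good : likely P (good_sample v z n eta (m n) (q n)) (C * t ^+ n) by near: n.
have [B [mB PB hB]] := likely_and good cross.
have ang w : ~ B w -> acos g <= vangle (u n w) (rho n 0).
  move=> /hB[gd cr]; have [u1 _ _] := top_eigvec_rayleigh (sample_cov_sym _ _ _ _ _ _ _) (utop n w).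
  rewrite [X in vangle _ X](unitvK (rho0 n)).
  apply: (vangle_ge_acos (rho0 n) u1 (q1 n) _ (ltW g1)).
  apply: (good_cos_upper (m0 n) (rho0 n) sigma0 eta0 (@orth n) gd (utop n w) eta4 cr k0).
    by near: n; apply: (cvgr_ge _ K_cvg).
  by near: n; apply: (cvgr_le _ L_cvg); rewrite /L ltrDl.
apply: le_trans (integral_ge_on P (measurableC mB) (ltW ag) _ _) => //.
  rewrite probability_setC// EFinM lee_pmul2l//.
  have : (P B <= (1 / 2)%:E)%E.
    by apply: le_trans PB _; rewrite lee_fin; move: small exp_small; lra.
  have -> : P B = (fine (P B))%:E by rewrite fineK// fin_num_measure.
  set f := fine (P B); rewrite lee_fin => f2.
  have : ((2^-1)%:E <= (1 - f)%:E)%E by rewrite lee_fin; move: f2; lra.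
  by rewrite EFinB.
move=> w; have [u1 _ _] := top_eigvec_rayleigh (sample_cov_sym _ _ _ _ _ _ _) (utop n w).
by rewrite (unitvK (rho0 n)) vangle_ge0// ?q1; exact: rho0.
Unshelve. all: by end_near. Qed.

End multicomponent_model.
Theorem theorem3 (R : realType) (d : measure_display) (T : measurableType d)
  (P : probability T R)
  (p m : nat -> nat) (rho : forall n : nat, nat -> 'cV[R]_(p n))
  (sigma c : R) (varrho : nat -> R)
  (v z : nat -> nat -> T -> R) :
  (* model assumptions *)
  (forall n, 1 <= m n <= p n)%N ->
  (forall n j k, (j < m n)%N -> (k < m n)%N -> j <> k ->
     vdot (rho n j) (rho n k) = 0) ->
  (forall n, norm_seq (rho n) (m n) 1 < norm_seq (rho n) (m n) 0) ->
  (forall n j, (1 <= j)%N ->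
     norm_seq (rho n) (m n) j.+1 <= norm_seq (rho n) (m n) j) ->
  0 < sigma ->
  iid_std_normal P (join_arrays v z) ->
  (* l1 convergence of the norm sequences *)
  (\sum_(0 <= j <oo) (`|varrho j|)%:E < +oo)%E ->
  ((fun n => (\sum_(0 <= j <oo) (`|norm_seq (rho n) (m n) j - varrho j|)%:E)%E)
     @ \oo --> 0%E) ->
  (* p/n -> c in [0,oo) *)
  0 <= c ->
  ((fun n => (p n)%:R / n%:R : R) @ \oo --> c) ->
  let varrho_plus := limn (series varrho) in
  let S := fun n w => sample_cov n (rho n) (m n) sigma v z w in
  let bound := 4 * sigma * Num.sqrt c / (varrho 0 ^+ 2 - varrho 1 ^+ 2)
                 * (varrho_plus + (2 + Num.sqrt c) * sigma) in
  ((0 < varrho 0 ^+ 2 - varrho 1 ^+ 2 -> bound <= 4 / 5 ->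
     {ae P, forall w, forall u : forall n, 'cV[R]_(p n),
        (forall n, top_unit_eigvec (S n w) (u n)) ->
        (limn_esup (fun n => (sin (vangle (u n) (rho n 0)))%:E) <= bound%:E)%E})
  /\
  (0 < c ->
     forall u : forall n, T -> 'cV[R]_(p n),
       (forall n (k : 'I_(p n)), measurable_fun setT (fun w => u n w k 0)) ->
       (forall n w, top_unit_eigvec (S n w) (u n w)) ->
       (0 < limn_einf (fun n => \int[P]_w (vangle (u n w) (rho n 0))%:E))%E)).
Proof.
move=> mp orth r10 r_mono sigma0 iX varrho_abs rho_l1 c0 pc varrho_plus S bound; split.
  exact: sin_limsup.
move=> cpos u _ utop.
exact: (mean_angle_liminf mp orth r10 sigma0 iX varrho_abs rho_l1 c0 pc cpos utop).
Qed.
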